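(* Let $\psi:\mathfrak h_A\to\mathbb C$ be a linear map such that $\psi_h$ is an exp-polynomial map for every $h\in\mathfrak h'$, and such that $A_\psi=\mathbb C[t_1^{\pm r_1},\dots,t_n^{\pm r_n}]$ with $R=r_1\cdots r_n\ge2$. Let $\Phi:\mathfrak h_A\to\mathbb C$ be the linear map associated with $\psi$ (as defined in the context), and let $\mathrm{ch}\,V(\psi)$ and $\mathrm{ch}\,V(\Phi)$ be the characters of $V(\psi)$ and $V(\Phi)$. Then $$\mathrm{ch}\,V(\psi)=(\mathrm{ch}\,V(\Phi))^R .$$
   Context: $\mathfrak g$ is a Kac-Moody Lie algebra over $\mathbb C$ with Cartan subalgebra $\mathfrak h$ and triangular decomposition $\mathfrak g=N^-\oplus\mathfrak h\oplus N^+$; $\mathfrak g'=[\mathfrak g,\mathfrak g]$, $\mathfrak h'=\mathfrak h\cap\mathfrak g'$, $\mathfrak h=\mathfrak h'\oplus\mathfrak h''$ for a fixed complement $\mathfrak h''$. $A=\mathbb C[t_1^{\pm1},\dots,t_n^{\pm1}]$, $t^m=t_1^{m_1}\cdots t_n^{m_n}$. $\mathfrak g_A=(\mathfrak g'\otimes A)\oplus\mathfrak h''$ with $[X\otimes t^m,Y\otimes t^s]=[X,Y]\otimes t^{m+s}$, $[h,X\otimes t^m]=[h,X]\otimes t^m$, $[h,h_1]=0$ for $X,Y\in\mathfrak g'$, $h,h_1\in\mathfrak h''$; $\mathfrak h_A=(\mathfrak h'\otimes A)\oplus\mathfrak h''$. $\mathfrak g$ embeds in $\mathfrak g_A$ via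 $X\mapsto X\otimes1$ on $\mathfrak g'$ and the identity on $\mathfrak h''$. For a linear map $\psi:\mathfrak h_A\to\mathbb C$, $V(\psi)$ is the unique irreducible quotient of $M(\psi)=U(\mathfrak g_A)\otimes_{U((N^+\otimes A)\oplus\mathfrak h_A)}\mathbb C$, where $N^+\otimes A$ acts on $\mathbb C$ by $0$ and $\mathfrak h_A$ via $\psi$. It is a weight module for $\mathfrak h$; when all its weight spaces are finite dimensional (as is the case for exp-polynomial highest weights), its character is $\mathrm{ch}\,V(\psi)=\sum_{\mu\in\mathfrak h^*}\dim V(\psi)_\mu\,e^\mu$. Put $\psi_h(m)=\psi(h\otimes t^m)$. $A_\psi\subseteq A$ is the image of the algebra homomorphism $U(\mathfrak h'\otimes A)\to A$ extending $h\otimes t^m\mapsto\psi(h\otimes t^m)t^m$. An exp-polynomial map $\mathbb Z^n\to\mathbb C$ is a finite sum of functions $p\exp\lambda$ with $p$ a polynomial function and $\lambda\in(\mathbb C^* )^n$, where $(\exp\lambda)(m)=\lambda_1^{m_1}\cdots\lambda_n^{m_n}$. Fix primitive $r_i$-th roots of unity $\xi_i$. $\overline\Gamma=\mathbb Z/r_1\mathbb Z\oplus\cdots\oplus\mathbb Z/r_n\mathbb Z$ acts on $(\mathbb C^* )^n$ by $k\cdot\lambda=(\xi_1^{k_1}\lambda_1,\dots,\xi_n^{k_n}\lambda_n)$, and $B$ is a set of representatives of the orbits. $T_k(p\exp\lambda)=p\exp(k\cdot\lambda)$, $P_R=\sum_{k\in\overline\Gamma}T_k$. For $h\in\mathfrak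 h'$ one can write $\psi_h=P_R\Phi_h$ with $\Phi_h=\sum_{\lambda\in B}p_{h,\lambda}\exp\lambda$ (finite sum, $p_{h,\lambda}$ polynomial functions); for fixed $B$, $\Phi_h$ is unique and linear in $h$. The linear map $\Phi:\mathfrak h_A\to\mathbb C$ is defined by $\Phi(h\otimes t^m)=\Phi_h(m)$ for $h\in\mathfrak h'$, $m\in\mathbb Z^n$, and $\Phi|_{\mathfrak h''}=\tfrac1R\psi|_{\mathfrak h''}$. *)

(* Defs.v *)
From HB Require Import structures.
From mathcomp Require Import all_boot all_order all_algebra finmap generic_quotient.
From mathcomp Require Import boolp classical_sets cardinality fsbigop reals.
From mathcomp Require Import complex.
From mathcomp Require mpoly.
From mathcomp Require Import monalg.

Set Implicit Arguments.
Unset Strict Implicit.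
Unset Printing Implicit Defensive.

Import GRing.Theory.

Local Open Scope ring_scope.
Local Open Scope quotient_scope.

Section Span.
Variables (R : pzRingType) (V : lmodType R) (S : V -> Prop).

Inductive lspan : V -> Prop :=
| lspan0 : lspan 0
| lspan_cons a x y : S x -> lspan y -> lspan (a *: x + y).

Lemma lspanZD a x y : lspan x -> lspan y -> lspan (a *: x + y).
Proof.
elim=> [|b u v Su _ IH] ly; first by rewrite scaler0 add0r.
by rewrite scalerDr scalerA -addrA; apply: lspan_cons => //; apply: IH.
Qed.

Lemma lspan_gen x : S x -> lspan x.
Proof.
by move=> Sx; rewrite -[x]addr0 -[x]scale1r; apply: lspan_cons lspan0.
Qed.

Lemma lspanZ a x : lspan x -> lspan (a *: x).
Proof. by move=> lx; rewrite -[_ *: _]addr0; apply: lspanZD lspan0. Qed.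

Lemma lspanD x y : lspan x -> lspan y -> lspan (x + y).
Proof. by rewrite -{2}[x]scale1r; apply: lspanZD. Qed.

Lemma lspanB x y : lspan x -> lspan y -> lspan (x - y).
Proof. by move=> lx ly; rewrite addrC -scaleN1r; apply: lspanZD. Qed.

End Span.

Definition submodule (R : pzRingType) (V : lmodType R) (S : V -> Prop) :=
  S 0 /\ forall a x y, S x -> S y -> S (a *: x + y).

(* [lquot S] is the quotient of [V] by the submodule spanned by [S]. *)
Section Quotient.
Variables (R : pzRingType) (V : lmodType R) (S : V -> Prop).

Definition lquot_rel : rel V := fun x y => `[< lspan S (x - y) >].

Lemma lquot_rel_equiv : equiv_class_of lquot_rel.
Proof.
split=> [x|x y|y x z].
- by apply/asboolP; rewrite subrr; apply: lspan0.
- by apply/asboolP/asboolP => /(lspanZ (-1)); rewrite scaleN1r opprB.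
- move=> /asboolP xy /asboolP yz; apply/asboolP.
  by rewrite -[x](subrK y) -addrA; apply: lspanD.
Qed.

Canonical lquot_equiv := EquivRelPack lquot_rel_equiv.
Canonical lquot_encModRel := defaultEncModRel lquot_rel.

Definition lquot := {eq_quot lquot_rel}.
HB.instance Definition _ := Choice.on lquot.

Definition lproj (x : V) : lquot := \pi_({eq_quot lquot_rel}) x.
Definition lrepr (x : lquot) : V := repr x.

Lemma lreprK : cancel lrepr lproj.
Proof. exact: reprK. Qed.

Lemma lprojP x y : lproj x = lproj y <-> lspan S (x - y).
Proof.
split=> [/eqquotP/asboolP //|sxy].
by apply/eqquotP/asboolP.
Qed.

Lemma lreprP x : lspan S (lrepr (lproj x) - x).
Proof. by apply/lprojP; rewrite lreprK. Qed.

Definition lquot_add x y := lproj (lrepr x + lrepr y).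
Definition lquot_opp x := lproj (- lrepr x).
Definition lquot_scale a x := lproj (a *: lrepr x).

Lemma lproj_add x y : lproj (x + y) = lquot_add (lproj x) (lproj y).
Proof.
apply/esym/lprojP; rewrite opprD addrACA.
by apply: lspanD; apply: lreprP.
Qed.

Lemma lproj_opp x : lproj (- x) = lquot_opp (lproj x).
Proof.
apply/esym/lprojP; rewrite -opprD -[- (_ - x)]scaleN1r.
by apply: lspanZ; apply: lreprP.
Qed.

Lemma lproj_scale a x : lproj (a *: x) = lquot_scale a (lproj x).
Proof.
by apply/esym/lprojP; rewrite -scalerBr; apply: lspanZ; apply: lreprP.
Qed.

Lemma lquot_addA : associative lquot_add.
Proof.
move=> x y z; rewrite -[x]lreprK -[y]lreprK -[z]lreprK.
by rewrite -!lproj_add addrA.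
Qed.
Lemma lquot_addC : commutative lquot_add.
Proof.
by move=> x y; rewrite -[x]lreprK -[y]lreprK -!lproj_add addrC.
Qed.
Lemma lquot_add0 : left_id (lproj 0) lquot_add.
Proof. by move=> x; rewrite -[x]lreprK -lproj_add add0r. Qed.
Lemma lquot_addN : left_inverse (lproj 0) lquot_opp lquot_add.
Proof. by move=> x; rewrite -[x]lreprK -lproj_opp -lproj_add addNr. Qed.

HB.instance Definition _ := GRing.isZmodule.Build lquot
  lquot_addA lquot_addC lquot_add0 lquot_addN.

Lemma lquot_scaleA a b x :
  lquot_scale a (lquot_scale b x) = lquot_scale (a * b) x.
Proof. by rewrite -[x]lreprK -!lproj_scale scalerA. Qed.
Lemma lquot_scale1 : left_id 1 lquot_scale.
Proof. by move=> x; rewrite -[x]lreprK -lproj_scale scale1r. Qed.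
Lemma lquot_scaleDr : right_distributive lquot_scale +%R.
Proof.
move=> a x y; rewrite -[x]lreprK -[y]lreprK.
by rewrite -[_ + _]lproj_add -!lproj_scale scalerDr lproj_add.
Qed.
Lemma lquot_scaleDl x : {morph lquot_scale^~ x : a b / a + b}.
Proof.
by move=> a b; rewrite -[x]lreprK -!lproj_scale scalerDl lproj_add.
Qed.

HB.instance Definition _ := GRing.Zmodule_isLmodule.Build R lquot
  lquot_scaleA lquot_scale1 lquot_scaleDr lquot_scaleDl.

Lemma lproj_is_linear : linear lproj.
Proof. by move=> a x y; rewrite lproj_add lproj_scale. Qed.
HB.instance Definition _ := GRing.isLinear.Build R V lquot _ lproj
  lproj_is_linear.

End Quotient.

HB.mixin Record Lmodule_isLie (K : fieldType) L of GRing.Lmodule K L := {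
  lie : L -> L -> L;
  lieDl : forall a x y z, lie (a *: x + y) z = a *: lie x z + lie y z;
  lieDr : forall a x y z, lie z (a *: x + y) = a *: lie z x + lie z y;
  liexx : forall x, lie x x = 0;
  jacobi : forall x y z,
    lie x (lie y z) + lie y (lie z x) + lie z (lie x y) = 0 }.

#[short(type="lieAlgType")]
HB.structure Definition LieAlgebra (K : fieldType) :=
  { L of Lmodule_isLie K L & GRing.Lmodule K L }.


Section Subspaces.
Variables (K : fieldType) (V : lmodType K).

Record subspace := Subspace {
  subspace_pred :> {pred V};
  subspace_closed : submod_closed subspace_pred }.
HB.instance Definition _ (S : subspace) :=
  GRing.isSubmodClosed.Build K V (subspace_pred S) (subspace_closed S).

Inductive subspace_type (S : subspace) := Sub_ x of x \in S.
Definition sub_val S (u : subspace_type S) := let: @Sub_ _ x _ := u in x.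
HB.instance Definition _ S := [isSub for @sub_val S].
HB.instance Definition _ S := [Choice of subspace_type S by <:].
HB.instance Definition _ S :=
  [SubChoice_isSubLmodule of subspace_type S by <:].

Lemma submodule_closed (P : V -> Prop) :
  submodule P -> submod_closed [pred x | `[< P x >]].
Proof.
case=> P0 PD; split=> [|a x y]; first exact/asboolP.
by rewrite !inE; apply: PD.
Qed.

Definition subspace_of (P : V -> Prop) (sP : submodule P) :=
  Subspace (submodule_closed sP).

Lemma subspace_ofP P (sP : submodule P) x :
  reflect (P x) (x \in subspace_of sP).
Proof. by rewrite inE; apply: asboolP. Qed.

End Subspaces.
Coercion subspace_type : subspace >-> Sortclass.

Section Subalgebras.
Variables (K : fieldType) (L : lieAlgType K).

Record subalgebra := Subalgebra {
  subalgebra_space :> subspace L;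
  subalgebra_lie : forall x y, x \in subalgebra_space ->
    y \in subalgebra_space -> lie x y \in subalgebra_space }.

Variable S : subalgebra.
Definition subalgebra_type : Type := subspace_type S.
HB.instance Definition _ := SubType.on subalgebra_type.
HB.instance Definition _ := GRing.Lmodule.on subalgebra_type.

Definition sub_lie (x y : subalgebra_type) : subalgebra_type :=
  Sub_ (subalgebra_lie (valP x) (valP y)).

Fact sub_lieDl a x y z :
  sub_lie (a *: x + y) z = a *: sub_lie x z + sub_lie y z.
Proof. by apply: val_inj; rewrite /= lieDl. Qed.
Fact sub_lieDr a x y z :
  sub_lie z (a *: x + y) = a *: sub_lie z x + sub_lie z y.
Proof. by apply: val_inj; rewrite /= lieDr. Qed.
Fact sub_liexx x : sub_lie x x = 0.
Proof. by apply: val_inj; rewrite /= liexx. Qed.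
Fact sub_jacobi x y z :
  sub_lie x (sub_lie y z) + sub_lie y (sub_lie z x) + sub_lie z (sub_lie x y)
  = 0.
Proof. by apply: val_inj; rewrite /= jacobi. Qed.

HB.instance Definition _ := Lmodule_isLie.Build K subalgebra_type
  sub_lieDl sub_lieDr sub_liexx sub_jacobi.

End Subalgebras.

Section Loop.
Variable n : nat.

(* [loop V] is V (x) K[t_1^{+-1}, .., t_n^{+-1}], as finitely supported
   functions on Z^n; [tmon x m] is x (x) t^m. *)
Definition loop (V : zmodType) := {malg V[{ffun 'I_n -> int}]}.
HB.instance Definition _ V := GRing.Zmodule.on (loop V).

Definition tmon (V : zmodType) (x : V) (m : {ffun 'I_n -> int}) : loop V :=
  << x *g m >>.
Definition tcoef (V : zmodType) (m : {ffun 'I_n -> int}) (f : loop V) : V :=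
  f@_m.
HB.instance Definition _ (V : zmodType) m :=
  GRing.Additive.copy (@tcoef V m) (@mcoeff _ V m).

Section LoopModule.
Variables (K : fieldType) (V : lmodType K).

Definition loop_scale (c : K) (f : loop V) : loop V :=
  \sum_(k <- msupp f) tmon (c *: f@_k) k.

Lemma loop_scaleE c f k : (loop_scale c f)@_k = c *: f@_k.
Proof.
rewrite {2}[f]monalgE /loop_scale !raddf_sum.
by apply/eq_bigr=> /= i _; rewrite !mcoeffU scalerMnr.
Qed.

Fact loop_scaleA a b f : loop_scale a (loop_scale b f) = loop_scale (a * b) f.
Proof. by apply/malgP=> k; rewrite !loop_scaleE scalerA. Qed.
Fact loop_scale1 : left_id 1 loop_scale.
Proof. by move=> f; apply/malgP=> k; rewrite loop_scaleE scale1r. Qed.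
Fact loop_scaleDr : right_distributive loop_scale +%R.
Proof.
by move=> a f g; apply/malgP=> k; rewrite !(mcoeffD, loop_scaleE) scalerDr.
Qed.
Fact loop_scaleDl f : {morph loop_scale^~ f : a b / a + b}.
Proof.
by move=> a b; apply/malgP=> k; rewrite !(mcoeffD, loop_scaleE) scalerDl.
Qed.

HB.instance Definition _ := GRing.Zmodule_isLmodule.Build K (loop V)
  loop_scaleA loop_scale1 loop_scaleDr loop_scaleDl.

Lemma loopZE c (f : loop V) m : tcoef m (c *: f) = c *: tcoef m f.
Proof. exact: loop_scaleE. Qed.

Lemma loopDE (f g : loop V) m : tcoef m (f + g) = tcoef m f + tcoef m g.
Proof. exact: mcoeffD. Qed.

Lemma loop0E m : tcoef m (0 : loop V) = 0.
Proof. exact: mcoeff0. Qed.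

Lemma tmonE (x : V) a m : tcoef m (tmon x a) = x *+ (a == m).
Proof. exact: mcoeffU. Qed.

Lemma loop_ext (f g : loop V) : (forall m, tcoef m f = tcoef m g) -> f = g.
Proof. by move=> fg; apply/malgP. Qed.

Lemma tmonP c (x y : V) m : tmon (c *: x + y) m = c *: tmon x m + tmon y m.
Proof.
by apply: loop_ext => k; rewrite loopDE loopZE !tmonE mulrnDl scalerMnr.
Qed.

Lemma loop_ind (P : loop V -> Prop) :
  P 0 -> (forall x m f, P f -> P (tmon x m + f)) -> forall f, P f.
Proof.
move=> P0 PD f; rewrite [f]monalgE.
by elim: (X in \sum_(_ <- X) _) => [|k s IH]; rewrite ?big_nil ?big_cons //;
  apply: PD.
Qed.

Lemma loop_eq_add (X : zmodType) (F G : loop V -> X) :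
  (forall f g, F (f + g) = F f + F g) -> (forall f g, G (f + g) = G f + G g) ->
  (forall x m, F (tmon x m) = G (tmon x m)) -> forall f, F f = G f.
Proof.
move=> FD GD FG; elim/loop_ind=> [|x m f IH]; last by rewrite FD GD FG IH.
have F0 : F 0 = 0 by apply: (addrI (F 0)); rewrite -FD !addr0.
have G0 : G 0 = 0 by apply: (addrI (G 0)); rewrite -GD !addr0.
by rewrite F0 G0.
Qed.

Lemma msuppP_le c (f g : loop V) :
  (msupp (c *: f + g)%R `<=` msupp f `|` msupp g)%fset.
Proof.
apply/fsubsetP=> k; rewrite in_fsetU -!mcoeff_neq0.
rewrite -[_@_k]/(tcoef k (c *: f + g)) loopDE loopZE /tcoef.
apply: contraR; rewrite negb_or !negbK => /andP[/eqP -> /eqP ->].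
by rewrite scaler0 addr0.
Qed.

End LoopModule.

Section Convolution.
Variables (K : fieldType) (V W X : lmodType K) (b : V -> W -> X).
Hypothesis bDl : forall a x y z, b (a *: x + y) z = a *: b x z + b y z.
Hypothesis bDr : forall a x y z, b z (a *: x + y) = a *: b z x + b z y.

Definition conv (f : loop V) (g : loop W) : loop X :=
  \sum_(k <- msupp f) \sum_(l <- msupp g) tmon (b (f@_k) (g@_l)) (k + l).

Let b0l z : b 0 z = 0.
Proof.
have := bDl (-1) 0 0 z.
by rewrite scaler0 addr0 scaleN1r addNr.
Qed.
Let b0r z : b z 0 = 0.
Proof.
have := bDr (-1) 0 0 z.
by rewrite scaler0 addr0 scaleN1r addNr.
Qed.
Let tmon0 m : tmon (0 : X) m = 0.
Proof. exact: monalgU0. Qed.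

Lemma convEw (d e : {fset {ffun 'I_n -> int}}) f g :
  (msupp f `<=` d)%fset -> (msupp g `<=` e)%fset ->
  conv f g = \sum_(k <- d) \sum_(l <- e) tmon (b (f@_k) (g@_l)) (k + l).
Proof.
move=> fd ge; rewrite /conv (big_fset_incl _ fd) /=.
  apply/eq_bigr=> k _; apply/big_fset_incl => // l _ /mcoeff_outdom ->.
  by rewrite b0r tmon0.
move=> k _ /mcoeff_outdom ->.
by rewrite big1 // => l _; rewrite b0l tmon0.
Qed.

Lemma conv_tmon x y k l : conv (tmon x k) (tmon y l) = tmon (b x y) (k + l).
Proof.
rewrite (convEw msuppU_le msuppU_le) !big_seq_fset1.
by rewrite !mcoeffUU.
Qed.


Lemma convDl a f g h : conv (a *: f + g) h = a *: conv f h + conv g h.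
Proof.
have hh := fsubset_refl (msupp h).
rewrite (convEw (msuppP_le a f g) hh).
rewrite (convEw (fsubsetUl (msupp f) (msupp g)) hh).
rewrite (convEw (fsubsetUr (msupp f) (msupp g)) hh).
rewrite scaler_sumr -big_split; apply: eq_bigr => k _ /=.
rewrite scaler_sumr -big_split; apply: eq_bigr => l _ /=.
rewrite -[(_ + _)@_k]/(tcoef k _) loopDE loopZE /tcoef.
by rewrite bDl tmonP.
Qed.

Lemma convDr a f g h : conv h (a *: f + g) = a *: conv h f + conv h g.
Proof.
have hh := fsubset_refl (msupp h).
rewrite (convEw hh (msuppP_le a f g)).
rewrite (convEw hh (fsubsetUl (msupp f) (msupp g))).
rewrite (convEw hh (fsubsetUr (msupp f) (msupp g))).
rewrite scaler_sumr -big_split; apply: eq_bigr => k _ /=.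
rewrite scaler_sumr -big_split; apply: eq_bigr => l _ /=.
rewrite -[(_ + _)@_l]/(tcoef l _) loopDE loopZE /tcoef.
by rewrite bDr tmonP.
Qed.

Lemma convD f g h : conv (f + g) h = conv f h + conv g h.
Proof. by have := convDl 1 f g h; rewrite (scale1r f) (scale1r (conv f h)). Qed.
Lemma convDE f g h : conv h (f + g) = conv h f + conv h g.
Proof. by have := convDr 1 f g h; rewrite (scale1r f) (scale1r (conv h f)). Qed.
Lemma conv0l h : conv 0 h = 0.
Proof. by rewrite /conv msupp0 big_seq_fset0. Qed.
Lemma conv0r h : conv h 0 = 0.
Proof. by rewrite /conv big1 // => k _; rewrite msupp0 big_seq_fset0. Qed.

End Convolution.

Section LoopLie.
Variables (K : fieldType) (L : lieAlgType K).

Definition loop_lie : loop L -> loop L -> loop L := conv (@lie K L).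

Let lDl := @convDl K L L L lie (@lieDl K L) (@lieDr K L).
Let lDr := @convDr K L L L lie (@lieDl K L) (@lieDr K L).
Let lD f g h : loop_lie (f + g) h = loop_lie f h + loop_lie g h :=
  convD (@lieDl K L) (@lieDr K L) f g h.
Let lDE f g h : loop_lie h (f + g) = loop_lie h f + loop_lie h g :=
  convDE (@lieDl K L) (@lieDr K L) f g h.
Let l0 h : loop_lie 0 h = 0 := conv0l lie h.
Let l0r h : loop_lie h 0 = 0 := conv0r lie h.

Lemma loop_lie_tmon x y k l :
  loop_lie (tmon x k) (tmon y l) = tmon (lie x y) (k + l).
Proof. exact: (conv_tmon (@lieDl K L) (@lieDr K L)). Qed.

Let tmonD (x y : L) m : tmon (x + y) m = tmon x m + tmon y m.
Proof. by have := tmonP 1 x y m; rewrite (scale1r x) (scale1r (tmon x m)). Qed.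
Let tmon0 m : tmon (0 : L) m = 0. Proof. exact: monalgU0. Qed.

Let lieC (x y : L) : lie x y + lie y x = 0.
Proof.
have lD1 (u v w : L) : lie (u + v) w = lie u w + lie v w.
  by have := lieDl 1 u v w; rewrite (scale1r u) (scale1r (lie u w)).
have lD2 (u v w : L) : lie w (u + v) = lie w u + lie w v.
  by have := lieDr 1 u v w; rewrite (scale1r u) (scale1r (lie w u)).
have := liexx (x + y).
by rewrite lD1 !lD2 !liexx add0r addr0.
Qed.

Let loop_lieC f g : loop_lie f g + loop_lie g f = 0.
Proof.
elim/loop_ind: f g => [|x k f IH] g; first by rewrite l0 l0r addr0.
rewrite lD lDE addrACA IH addr0.
elim/loop_ind: g => [|y l g IHg]; first by rewrite l0 l0r addr0.
rewrite lD lDE addrACA IHg addr0 !loop_lie_tmon.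
by rewrite [l + k]addrC -tmonD lieC tmon0.
Qed.

Fact loop_liexx f : loop_lie f f = 0.
Proof.
elim/loop_ind: f => [|x k f IH]; first exact: l0.
rewrite lD !lDE IH loop_lie_tmon liexx tmon0 add0r addr0.
exact: loop_lieC.
Qed.

Let add3ACA (a b c a' b' c' : loop L) :
  (a + a') + (b + b') + (c + c') = (a + b + c) + (a' + b' + c').
Proof. by rewrite (addrACA a a' b b') (addrACA (a + b) (a' + b') c c'). Qed.

Let J f g h := loop_lie f (loop_lie g h) + loop_lie g (loop_lie h f)
  + loop_lie h (loop_lie f g).

Let JC f g h : J f g h = J g h f.
Proof. by rewrite /J [RHS]addrC [RHS]addrA. Qed.

Let J0 g h : J 0 g h = 0.
Proof.
by rewrite /J (l0 (loop_lie g h)) (l0r h) (l0r g) (l0 g) (l0r h) !addr0.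
Qed.

Let JD e f g h : J (e + f) g h = J e g h + J f g h.
Proof.
rewrite /J (lD e f (loop_lie g h)) (lDE e f h).
rewrite (lDE (loop_lie h e) (loop_lie h f) g) (lD e f g).
rewrite (lDE (loop_lie e g) (loop_lie f g) h).
exact: add3ACA.
Qed.

Fact loop_jacobi f g h :
  loop_lie f (loop_lie g h) + loop_lie g (loop_lie h f)
    + loop_lie h (loop_lie f g) = 0.
Proof.
rewrite -/(J f g h).
elim/loop_ind: f => [|x k f IH]; first exact: J0.
rewrite JD IH addr0 JC {f IH}.
elim/loop_ind: g => [|y l g IH]; first exact: J0.
rewrite JD IH addr0 JC {g IH}.
elim/loop_ind: h => [|z m h IH]; first exact: J0.
rewrite JD IH addr0 JC {h IH} /J !loop_lie_tmon.
have -> : l + (m + k) = k + (l + m) by rewrite addrA addrC.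
have -> : m + (k + l) = k + (l + m) by rewrite addrC addrA.
by rewrite -!tmonD jacobi tmon0.
Qed.

HB.instance Definition _ := Lmodule_isLie.Build K (loop L)
  lDl lDr loop_liexx loop_jacobi.

End LoopLie.

Section Laurent.
Variable K : fieldType.

Definition laurent := loop K^o.
HB.instance Definition _ := GRing.Lmodule.on laurent.

Let mDl (a : K) (x y z : K^o) : (a *: x + y) * z = a *: (x * z) + y * z.
Proof. by rewrite mulrDl scalerAl. Qed.
Let mDr (a : K) (x y z : K^o) : z * (a *: x + y) = a *: (z * x) + z * y.
Proof. by rewrite mulrDr scalerAr. Qed.

Definition laurent_mul : laurent -> laurent -> laurent := conv *%R.
Definition laurent_one : laurent := tmon (1 : K^o) 0.

Let lDl a f g h : laurent_mul (a *: f + g) h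
  = a *: laurent_mul f h + laurent_mul g h := convDl mDl mDr a f g h.
Let lD f g h : laurent_mul (f + g) h = laurent_mul f h + laurent_mul g h :=
  convD mDl mDr f g h.
Let lDE f g h : laurent_mul h (f + g) = laurent_mul h f + laurent_mul h g :=
  convDE mDl mDr f g h.
Let l0 h : laurent_mul 0 h = 0 := conv0l *%R h.
Let l0r h : laurent_mul h 0 = 0 := conv0r *%R h.

Lemma laurent_mul_tmon (x y : K^o) k l :
  laurent_mul (tmon x k) (tmon y l) = tmon (x * y) (k + l).
Proof. exact: conv_tmon. Qed.

Fact laurent_mulA : associative laurent_mul.
Proof.
move=> f g h; move: f; apply: loop_eq_add => [f e|f e|x k].
- exact: lD.
- by rewrite (lD f e g); apply: lD.
move: g; apply: loop_eq_add => [f e|f e|y l].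
- by rewrite (lD f e h); apply: lDE.
- by rewrite (lDE f e (tmon x k)); apply: lD.
move: h; apply: loop_eq_add => [f e|f e|z m].
- by rewrite (lDE f e (tmon y l)); apply: lDE.
- exact: lDE.
by rewrite !laurent_mul_tmon mulrA addrA.
Qed.

Fact laurent_mulC : commutative laurent_mul.
Proof.
move=> f g; move: f; apply: loop_eq_add => [f e|f e|x k].
- exact: lD.
- exact: lDE.
move: g; apply: loop_eq_add => [f e|f e|y l].
- exact: lDE.
- exact: lD.
by rewrite !laurent_mul_tmon mulrC addrC.
Qed.

Fact laurent_mul1 : left_id laurent_one laurent_mul.
Proof.
apply: loop_eq_add => [f e|//|x k]; first exact: lDE.
by rewrite laurent_mul_tmon mul1r add0r.
Qed.

Fact laurent_one_neq0 : laurent_one != 0.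
Proof.
apply/eqP => /(congr1 (tcoef 0)).
by rewrite loop0E tmonE eqxx mulr1n => /eqP; rewrite oner_eq0.
Qed.

HB.instance Definition _ := GRing.Zmodule_isComNzRing.Build laurent
  laurent_mulA laurent_mulC laurent_mul1 lD laurent_one_neq0.

Fact laurent_scaleAl (a : K) (f g : laurent) : a *: (f * g) = a *: f * g.
Proof. have E := lDl a f 0 g; rewrite (addr0 (a *: f)) l0 in E.
exact: esym (etrans E (addr0 _)). Qed.

HB.instance Definition _ := GRing.Lmodule_isLalgebra.Build K laurent
  laurent_scaleAl.
HB.instance Definition _ := GRing.Lalgebra_isComAlgebra.Build K laurent.

End Laurent.
End Loop.

Section EnvelopingAlgebra.
Variables (K : fieldType) (L : lieAlgType K).

Definition word := MonomialDef.clone (fmonom L) _.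
Local Notation free_alg := {malg K[word]}.

Definition free_gen (x : L) : free_alg := << (fmu x : word) >>.

(* The free algebra on the set [L] modulo the linearity relations is the tensor
   algebra of [L]; the last relation is x y - y x = [x, y]. *)
Inductive env_gen : free_alg -> Prop :=
| env_gen_lin a x y :
    env_gen (free_gen (a *: x + y) - (a *: free_gen x + free_gen y))
| env_gen_lie x y :
    env_gen (free_gen x * free_gen y - free_gen y * free_gen x
             - free_gen (lie x y)).

Definition env_rel (z : free_alg) : Prop :=
  exists u v w, env_gen w /\ z = u * w * v.

Definition env := lquot env_rel.
HB.instance Definition _ := GRing.Lmodule.on env.

Let pr : free_alg -> env := @lproj K free_alg env_rel.
Let rp : env -> free_alg := @lrepr K free_alg env_rel.
Let I := lspan env_rel.

Definition env_one : env := pr 1.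
Definition env_mul (x y : env) : env := pr (rp x * rp y).

Let scaleAr (c : K) (f g : free_alg) : c *: (f * g) = f * (c *: g).
Proof.
apply/malgP => k; rewrite -!mul_malgC.
have C (h : free_alg) : c%:MP * h = h * c%:MP.
  rewrite !malgM_def fgmulUg fgmulgU; apply: eq_bigr => m _.
  by rewrite mul1m mulm1 mulrC.
by rewrite mulrA C -mulrA.
Qed.

Let idealMl (a z : free_alg) : I z -> I (a * z).
Proof.
elim=> [|c x y [u [v [w [gw ->]]]] _ IH]; first by rewrite mulr0; apply: lspan0.
rewrite mulrDr -scaleAr; apply: lspan_cons IH.
by exists (a * u), v, w; rewrite !mulrA.
Qed.

Let idealMr (a z : free_alg) : I z -> I (z * a).
Proof.
elim=> [|c x y [u [v [w [gw ->]]]] _ IH]; first by rewrite mul0r; apply: lspan0.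
rewrite mulrDl -scalerAl; apply: lspan_cons IH.
by exists u, (v * a), w; exact: conj gw (esym (mulrA _ _ _)).
Qed.

Let ideal_coef (z : free_alg) : I z -> z@_(@mone word) = 0.
Proof.
elim=> [|c x y [u [v [w [gw ->]]]] _ IH]; first exact: mcoeff0.
rewrite mcoeffD mcoeffZ IH addr0 !(rmorphM (mcoeff (@mone word))) /=.
suff -> : w@_(@mone word) = 0 by rewrite mulr0 mul0r mulr0.
have g0 t : (free_gen t)@_(@mone word) = 0.
  rewrite mcoeffU1; case: eqP => // /(congr1 (size \o @fmonom_val L)) /=.
  by rewrite fmuE -[@mone _]/(fmone L) fmoneE.
case: gw => [a t s|t s].
  by rewrite mcoeffB mcoeffD mcoeffZ !g0 mulr0 addr0 subr0.
have gg p q : (free_gen p * free_gen q)@_(@mone word) = 0.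
  have [M _] := mcoeff1g_is_multiplicative word K.
  by rewrite M g0 mul0r.
have c0 (A B C : free_alg) : A@_(@mone word) = 0 -> B@_(@mone word) = 0 ->
    C@_(@mone word) = 0 -> (A - B - C)@_(@mone word) = 0.
  by move=> cA cB cC; rewrite !mcoeffB cA cB cC !subr0.
exact: c0 (gg t s) (gg s t) (g0 _).
Qed.

Let prM u v : pr (u * v) = env_mul (pr u) (pr v).
Proof.
apply/esym/lprojP; set u' := rp _; set v' := rp _.
have -> : u' * v' - u * v = u' * (v' - v) + (u' - u) * v.
  by rewrite mulrBr mulrBl addrA subrK.
by apply: lspanD; [apply: idealMl|apply: idealMr]; apply: lreprP.
Qed.

Let prK : cancel rp pr. Proof. exact: lreprK. Qed.
Let prD u v : pr (u + v) = pr u + pr v. Proof. exact: raddfD. Qed.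
Let prZ c u : pr (c *: u) = c *: pr u. Proof. exact: linearZ. Qed.

Fact env_mulA : associative env_mul.
Proof. by move=> x y z; rewrite -[x]prK -[y]prK -[z]prK -!prM mulrA. Qed.
Fact env_mul1 : left_id env_one env_mul.
Proof. by move=> x; rewrite -[x]prK -prM mul1r. Qed.
Fact env_mulr1 : right_id env_one env_mul.
Proof. by move=> x; rewrite -[x]prK -prM mulr1. Qed.
Fact env_mulDl : left_distributive env_mul +%R.
Proof.
by move=> x y z; rewrite -[x]prK -[y]prK -[z]prK -prD -!prM mulrDl prD.
Qed.
Fact env_mulDr : right_distributive env_mul +%R.
Proof.
by move=> x y z; rewrite -[x]prK -[y]prK -[z]prK -prD -!prM mulrDr prD.
Qed.
Fact env_one_neq0 : env_one != 0.
Proof.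
apply/eqP => /lprojP; rewrite subr0 => /ideal_coef.
by rewrite mcoeff1 eqxx => /eqP; rewrite oner_eq0.
Qed.

HB.instance Definition _ := GRing.Zmodule_isNzRing.Build env
  env_mulA env_mul1 env_mulr1 env_mulDl env_mulDr env_one_neq0.

Fact env_scaleAl (a : K) (x y : env) : a *: (x * y) = a *: x * y.
Proof.
have -> : a *: x = pr (a *: rp x) by rewrite prZ prK.
have -> : a *: (x * y) = pr (a *: (rp x * rp y)) by rewrite prZ.
by rewrite scalerAl; apply: etrans (prM _ _) _; rewrite (prK y).
Qed.
HB.instance Definition _ := GRing.Lmodule_isLalgebra.Build K env env_scaleAl.

Fact env_scaleAr (a : K) (x y : env) : a *: (x * y) = x * (a *: y).
Proof.
have -> : a *: y = pr (a *: rp y) by rewrite prZ prK.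
have -> : a *: (x * y) = pr (a *: (rp x * rp y)) by rewrite prZ.
by rewrite scaleAr; apply: etrans (prM _ _) _; rewrite (prK x).
Qed.
HB.instance Definition _ := GRing.Lalgebra_isAlgebra.Build K env env_scaleAr.

Definition env_inj (x : L) : env := pr (free_gen x).

Lemma env_inj_linear : linear env_inj.
Proof.
move=> a x y; rewrite /env_inj -prZ -prD; apply/lprojP; apply: lspan_gen.
exists 1, 1, (free_gen (a *: x + y) - (a *: free_gen x + free_gen y)).
by rewrite mul1r mulr1; split=> //; apply: env_gen_lin.
Qed.
HB.instance Definition _ := GRing.isLinear.Build K L env _ env_inj
  env_inj_linear.

Lemma env_inj_lie x y :
  env_inj (lie x y) = env_inj x * env_inj y - env_inj y * env_inj x.
Proof.
rewrite -[env_inj x * env_inj y]prM -[env_inj y * env_inj x]prM.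
rewrite -[RHS](raddfB pr); apply/esym/lprojP; apply: lspan_gen.
exists 1, 1, (free_gen x * free_gen y - free_gen y * free_gen x
             - free_gen (lie x y)).
by rewrite mul1r mulr1; split=> //; apply: env_gen_lie.
Qed.

End EnvelopingAlgebra.

Definition derived (K : fieldType) (L : lieAlgType K) : L -> Prop :=
  lspan (fun z => exists x y, z = lie x y).

Lemma submodule_lspan (R : pzRingType) (V : lmodType R) (S : V -> Prop) :
  submodule (lspan S).
Proof. by split=> [|a x y]; [apply: lspan0|apply: lspanZD]. Qed.

Section KacMoody.
Variable R : realType.
Local Notation C := R[i].

(* The intrinsic form of g(A) = g~(A)/r, for a realization (h, roots, coroots)
   of a generalized Cartan matrix A: the relations and generation say that g is
   a quotient of g~(A), and [km_inc_inj] and [km_ideal] say that the kernel is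
   the largest ideal r of g~(A) that meets h trivially. *)
Record kac_moody := KacMoody {
  km_alg :> lieAlgType C;
  km_size : nat;
  km_gcm : 'M[int]_km_size;
  km_cartan : vectType C;
  km_inc : {linear km_cartan -> km_alg};
  km_coroot : 'I_km_size -> km_cartan;
  km_root : 'I_km_size -> 'Hom(km_cartan, C^o);
  km_e : 'I_km_size -> km_alg;
  km_f : 'I_km_size -> km_alg;
  km_gcm_diag : forall i, km_gcm i i = 2;
  km_gcm_offdiag : forall i j, i != j -> km_gcm i j <= 0;
  km_gcm_zero : forall i j, km_gcm i j = 0 -> km_gcm j i = 0;
  km_coroot_free : free (codom km_coroot);
  km_root_free : free (codom km_root);
  km_pairing : forall i j, km_root j (km_coroot i) = (km_gcm i j)%:~R :> C;
  km_dim : (\dim {:km_cartan} + \rank (map_mx intr km_gcm : 'M[C]_km_size)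
            = km_size.*2)%N;
  km_inc_inj : injective km_inc;
  km_lie_hh : forall h k, lie (km_inc h) (km_inc k) = 0;
  km_lie_ef : forall i j,
    lie (km_e i) (km_f j) = if i == j then km_inc (km_coroot i) else 0;
  km_lie_he : forall h i,
    lie (km_inc h) (km_e i) = (km_root i h : C) *: km_e i;
  km_lie_hf : forall h i,
    lie (km_inc h) (km_f i) = - ((km_root i h : C) *: km_f i);
  km_generated : forall S : subalgebra km_alg,
    (forall h, km_inc h \in S) -> (forall i, km_e i \in S) ->
    (forall i, km_f i \in S) -> forall x, x \in S;
  km_ideal : forall J : subspace km_alg,
    (forall x y, y \in J -> lie x y \in J) ->
    (forall h, km_inc h \in J -> h = 0) -> forall x, x \in J -> x = 0 }.

Arguments km_e : clear implicits.
Arguments km_f : clear implicits.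
Arguments km_inc : clear implicits.

Variable g : kac_moody.
Local Notation h := (km_cartan g).
Local Notation inc := (km_inc g).

Definition nplus (x : g) : Prop :=
  forall S : subalgebra g, (forall i, km_e g i \in S) -> x \in S.

Fact hprime_submodule : submodule (fun x : h => derived (inc x)).
Proof.
split=> [|a x y]; first by rewrite linear0; apply: lspan0.
by rewrite linearP; apply: lspanZD.
Qed.
Definition hprime : subspace h := subspace_of hprime_submodule.

(* the complement h'' of h' in h *)
Record cartan_complement := CartanComplement {
  hsecond :> {vspace h};
  hsecond_sum : forall x, exists y z,
    [/\ y \in hprime, z \in hsecond & x = y + z];
  hsecond_direct : forall x, x \in hprime -> x \in hsecond -> x = 0 }.

Variables (h2 : cartan_complement) (n : nat).

Section InternalSum.
Variable P : g -> Prop.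
Hypothesis sP : submodule P.

(* (P (x) A) + h'' inside g (x) A *)
Definition tensor_plus (x : loop n g) : Prop :=
  exists y k, [/\ forall m, P (tcoef m y), k \in (h2 : {vspace h})
                & x = y + tmon (inc k) 0].

Fact tensor_plus_submodule : submodule tensor_plus.
Proof.
case: sP => P0 PD; split=> [|a _ _ [y [k [Py hk ->]]] [z [l [Pz hl ->]]]].
  exists 0, 0; split=> [m||]; rewrite ?loop0E ?mem0v //.
  by rewrite linear0 add0r; apply/esym; apply: monalgU0.
exists (a *: y + z), (a *: k + l); split=> [m||].
- by rewrite loopDE loopZE; apply: PD.
- by rewrite memvD ?memvZ.
- by rewrite linearP tmonP scalerDr addrACA.
Qed.
End InternalSum.

Lemma derived_loop_lie (x y : loop n g) m : derived (tcoef m (lie x y)).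
Proof.
have [d0 dD] := submodule_lspan (fun z : g => exists x y, z = lie x y).
have dA u v : @derived C g u -> @derived C g v -> derived (u + v).
  by rewrite -{2}[u]scale1r; apply: dD.
rewrite -[lie x y]/(conv lie x y) /conv.
rewrite raddf_sum /=; apply: big_ind => // k _.
rewrite raddf_sum /=; apply: big_ind => // l _.
rewrite tmonE; case: eqP => _; rewrite ?mulr1n ?mulr0n //.
by apply: lspan_gen; exists (x@_k), (y@_l).
Qed.

Let dsub := submodule_lspan (fun z : g => exists x y, z = lie x y).

(* g_A = (g' (x) A) + h'' as a subalgebra of g (x) A *)
Definition gA_space : subspace (loop n g) :=
  subspace_of (tensor_plus_submodule dsub).

Fact gA_lie x y : x \in gA_space -> y \in gA_space -> lie x y \in gA_space.
Proof.
move=> _ _; apply/subspace_ofP; exists (lie x y), 0.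
split; [exact: derived_loop_lie|exact: mem0v|].
by rewrite linear0 /tmon monalgU0 addr0.
Qed.
Definition gA_subalgebra : subalgebra (loop n g) := Subalgebra gA_lie.
Definition gA := subalgebra_type gA_subalgebra.

Fact cartan_gA_mem (x : h) : tmon (inc x) 0 \in gA_space.
Proof.
have [y [z [hy hz ->]]] := hsecond_sum h2 x.
apply/subspace_ofP; exists (tmon (inc y) 0), z; split=> // [m|].
  rewrite tmonE; case: eqP => _; rewrite ?mulr1n ?mulr0n; last exact: lspan0.
  by apply/subspace_ofP: hy.
by rewrite linearD; apply: raddfD.
Qed.
(* the restriction to h of the embedding of g in g_A *)
Definition cartan_gA (x : h) : gA := Sub_ (cartan_gA_mem x).

Definition hprime_image (x : g) : Prop := exists2 y, y \in hprime & x = inc y.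
Fact hprime_image_submodule : submodule hprime_image.
Proof.
split=> [|a _ _ [x hx ->] [y hy ->]].
  by exists 0; rewrite ?linear0 ?rpred0.
by exists (a *: x + y); rewrite ?linearP // rpredD ?rpredZ.
Qed.

Definition hA : subspace (loop n g) :=
  subspace_of (tensor_plus_submodule hprime_image_submodule).

Fact hA_tens_mem (x : hprime) m : tmon (inc (val x)) m \in hA.
Proof.
apply/subspace_ofP; exists (tmon (inc (val x)) m), 0.
split; last by rewrite linear0 /tmon monalgU0 addr0.
  move=> l; rewrite tmonE; exists (val x *+ (m == l)).
    by rewrite rpredMn // (valP x).
  by rewrite raddfMn.
exact: mem0v.
Qed.
Definition hA_tens (x : hprime) m : hA := Sub_ (hA_tens_mem x m).

Fact hA_second_mem (k : h) : k \in hsecond h2 -> tmon (inc k) 0 \in hA.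
Proof.
move=> hk; apply/subspace_ofP; exists 0, k; split=> //; last by rewrite add0r.
by move=> m; rewrite loop0E; exists 0; rewrite ?linear0 ?rpred0.
Qed.
Definition hA_second (k : h) (hk : k \in hsecond h2) : hA :=
  Sub_ (hA_second_mem hk).

(* h' (x) A *)
Definition hprimeA_mem (x : loop n g) : Prop :=
  forall m, hprime_image (tcoef m x).
Fact hprimeA_submodule : submodule hprimeA_mem.
Proof.
have [i0 iD] := hprime_image_submodule.
split=> [m|a x y hx hy m]; first by rewrite loop0E.
by rewrite loopDE loopZE; apply: iD.
Qed.
Definition hprimeA_space : subspace (loop n g) :=
  subspace_of hprimeA_submodule.
Fact hprimeA_lie x y : x \in hprimeA_space -> y \in hprimeA_space ->
  lie x y \in hprimeA_space.
Proof.
move=> /subspace_ofP hx /subspace_ofP hy.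
suff -> : lie x y = 0 by rewrite rpred0.
rewrite -[lie x y]/(conv lie x y) /conv.
rewrite big1 // => k _; rewrite big1 // => l _.
have [a _ xa] := hx k; have [b _ yb] := hy l.
by rewrite /tcoef in xa yb; rewrite xa yb km_lie_hh; apply: monalgU0.
Qed.
Definition hprimeA := subalgebra_type (Subalgebra hprimeA_lie).

Fact hprimeA_tens_mem (x : hprime) m : tmon (inc (val x)) m \in hprimeA_space.
Proof.
apply/subspace_ofP => l; rewrite tmonE; exists (val x *+ (m == l)).
  by rewrite rpredMn // (valP x).
by rewrite raddfMn.
Qed.
Definition hprimeA_tens (x : hprime) m : hprimeA :=
  Sub_ (hprimeA_tens_mem x m).

Local Notation U := (env gA).

Section HighestWeight.
Variable psi : {linear hA -> C^o}.

(* U(g_A) (x)_U(b) C_psi, b = (N+ (x) A) + h_A, as the quotient of U(g_A) by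
   the left ideal generated by the x - psi(x), x in b. *)
Definition verma_gen (z : U^o) : Prop :=
  exists (x : gA) (p : loop n g) (y : hA),
  [/\ forall m, nplus (tcoef m p), val x = p + val y
    & z = env_inj x - (psi y : C)%:A].

Definition verma : lmodType U := lquot verma_gen.

Definition irreducible_quotient (V : lmodType U) : Prop :=
  [/\ exists pi : {linear verma -> V}, forall v, exists u, pi u = v,
      exists v : V, v != 0
    & forall S : V -> Prop, submodule S ->
        (forall v, S v -> v = 0) \/ (forall v, S v)].

Definition A_psi (a : laurent n C) : Prop :=
  exists2 theta : {lrmorphism env hprimeA -> laurent n C},
    forall x m, theta (env_inj (hprimeA_tens x m))
                = (psi (hA_tens x m) : C) *: tmon (1 : C^o) m
  & exists u, theta u = a.

End HighestWeight.

Local Notation weight := 'Hom(h, C^o).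

Definition weight_space (V : lmodType U) (mu : weight) (v : V) : Prop :=
  forall x : h, env_inj (cartan_gA x) *: v = ((mu x : C)%:A : U) *: v.

Definition has_dim (V : lmodType U) (S : V -> Prop) (d : nat) : Prop :=
  exists v : 'I_d -> V,
  [/\ forall i, S (v i),
      forall c : 'I_d -> C, \sum_i ((c i)%:A : U) *: v i = 0 ->
        forall i, c i = 0
    & forall x, S x -> exists c : 'I_d -> C, x = \sum_i ((c i)%:A : U) *: v i].

(* A formal sum of the e^mu is the function of its coefficients. Note that every
   weight space must be finite dimensional. *)
Definition is_character (V : lmodType U) (ch : weight -> nat) : Prop :=
  forall mu, has_dim (@weight_space V mu) (ch mu).

(* Product of formal sums of the e^mu. The sum is over the (finite, for
   characters of highest weight modules) support of its summand. *)
Definition char_mul (f f' : weight -> nat) (mu : weight) : nat :=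
  (\big[addn/0]_(nu \in [set: weight]%classic) (f nu * f' (mu - nu)%R))%N.
Definition char_one (mu : weight) : nat := (mu == 0).
Definition char_exp (f : weight -> nat) (d : nat) : weight -> nat :=
  iter d (char_mul f) char_one.

End KacMoody.

Section ExpPolynomials.
Variables (R : realType) (n : nat).
Local Notation C := R[i].

Definition torus (lambda : {ffun 'I_n -> C}) : Prop :=
  forall i, lambda i != 0.

Definition exp_fun (lambda : {ffun 'I_n -> C}) (m : {ffun 'I_n -> int}) : C :=
  \prod_i lambda i ^ m i.

(* sum_j p_j exp(lambda_j), as a function on Z^n *)
Definition exp_poly d (p : 'I_d -> mpoly.mpoly n C)
    (lambda : 'I_d -> {ffun 'I_n -> C}) (m : {ffun 'I_n -> int}) : C :=
  \sum_j mpoly.meval (fun i => (m i)%:~R) (p j) * exp_fun (lambda j) m.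

Definition exp_polynomial (f : {ffun 'I_n -> int} -> C) : Prop :=
  exists d p (lambda : 'I_d -> {ffun 'I_n -> C}),
    (forall j, torus (lambda j)) /\ f =1 exp_poly p lambda.

Variables (r : 'I_n -> nat) (xi : 'I_n -> C).

(* Gammabar, the sum of the Z/r_i, with residues represented by 0 .. r_i - 1 *)
Definition Gammabar := {dffun forall i : 'I_n, 'I_(r i)}.

Definition Gamma_act (k : Gammabar) (lambda : {ffun 'I_n -> C}) :
    {ffun 'I_n -> C} :=
  [ffun i => xi i ^+ k i * lambda i].

Definition orbit_representatives (B : {ffun 'I_n -> C} -> Prop) : Prop :=
  (forall mu, B mu -> torus mu) /\
  (forall lambda, torus lambda ->
     exists! mu, B mu /\ exists k, mu = Gamma_act k lambda).

(* P_R applied to sum_j p_j exp(lambda_j), with T_k(p exp lambda)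
   = p exp(k . lambda) *)
Definition P_R d (p : 'I_d -> mpoly.mpoly n C)
    (lambda : 'I_d -> {ffun 'I_n -> C}) (m : {ffun 'I_n -> int}) : C :=
  \sum_(k : Gammabar) exp_poly p (fun j => Gamma_act k (lambda j)) m.

Variables (g : kac_moody R) (h2 : cartan_complement g).
Implicit Types psi Phi : {linear hA h2 n -> C^o}.

Definition psi_ psi (x : hprime g) (m : {ffun 'I_n -> int}) : C :=
  psi (hA_tens h2 x m).

(* Phi is the map associated with psi: Phi_h is a combination of the exp lambda
   with lambda in B, and psi_h = P_R Phi_h. *)
Definition associated (B : {ffun 'I_n -> C} -> Prop) psi Phi : Prop :=
  (forall x, exists d p (lambda : 'I_d -> {ffun 'I_n -> C}),
     [/\ forall j, B (lambda j), psi_ Phi x =1 exp_poly p lambda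
       & psi_ psi x =1 P_R p lambda]) /\
  (forall y (hy : y \in hsecond h2),
     Phi (hA_second n hy) = (\prod_i r i)%:R^-1 * (psi (hA_second n hy) : C)).

(* C[t_1^{+- r_1}, .., t_n^{+- r_n}] *)
Definition laurent_pow : laurent n C -> Prop :=
  lspan (fun a => exists k : {ffun 'I_n -> int},
    a = tmon (1 : C^o) [ffun i => (r i)%:Z * k i]).

End ExpPolynomials.

(* Main.v *)
From HB Require Import structures.
Require Import Defs.
From mathcomp Require Import all_boot all_order all_algebra finmap.
From mathcomp Require Import boolp classical_sets functions fsbigop.
From mathcomp Require Import reals complex.
From mathcomp Require mpoly.
From mathcomp Require Import monalg.

Set Implicit Arguments.
Unset Strict Implicit.
Unset Printing Implicit Defensive.

Import Order.TTheory GRing.Theory Num.Theory.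

Local Open Scope ring_scope.

(** The map [psi] is the sum over [k] in Gammabar of the maps [Phi_k], where
    [Phi_k] is [Phi] composed with the automorphism [t^m |-> zeta_k(m) t^m] of
    [A], [zeta_k(m)] being the product of the [xi_i ^ (k_i m_i)]. The module
    [V(Phi_k)] is [V(Phi)] pulled back along this automorphism, which fixes the
    Cartan subalgebra, so all the [V(Phi_k)] have the character of [V(Phi)], and
    it suffices to show that [V(psi)] is the tensor product of the [V(Phi_k)].

    This holds because the [Phi_k] are supported at disjoint sets of points of
    the torus. The restriction of [Phi] to one coroot is a sum of terms
    [p exp(lambda)] with [lambda] in [B], so that of [Phi_k] is a sum of terms
    [p exp(k . lambda)]; as [B] meets every orbit once and the orbits are free,
    the points for distinct [k] are distinct. Since [p exp(mu)] is killed by a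
    power of each [t_i - mu_i], Bezout's identity yields, for two disjoint
    supports, an element of [A] congruent to 1 modulo the ideal that annihilates
    the first highest weight and to 0 modulo the ideal that annihilates the
    second ([Ann_comaximal]). These ideals act by zero on the irreducible modules
    ([annihilatorP]), so inside the current algebra one can act on one tensor
    factor at a time. A singular vector of the tensor product is then a
    multiple of the tensor product of the highest weight vectors, and this vector
    generates: the tensor product is irreducible ([tensor]). It has the highest
    weight [psi], and an irreducible highest weight module is determined by its
    highest weight ([hwmod_unique]).

    Throughout, a module is seen through the operators [e_i (x) a], [f_i (x) a],
    [[e_i, f_i] (x) a] and [h (x) 1] only ([hwmod]). They generate [g_A]
    ([gA_generated]), hence have the same submodules as the enveloping algebra,
    and the commutators of a raising with a lowering operator, of a coroot with
    either, and of the Cartan subalgebra with either carry the arguments above.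
    The tensor product is taken for two factors at a time, and the character of
    the iterated product is the iterated product of characters
    ([tensor_hasdim], [iterate_tensor]). Weight spaces are finite dimensional
    since [Phi (h (x) t^(m + l))] is a finite sum of products of a function of
    [m] and a function of [l], whence a bound on the codimension of the
    annihilating ideal ([separable_codim], [hw_finite]). *)

(** * Linear algebra *)

Section LinearAlgebra.
Variables (K : fieldType) (V : lmodType K).
Implicit Types (S P Q : V -> Prop).

Lemma lspan_sub S P :
  (forall x, S x -> P x) -> P 0 ->
  (forall a x y, P x -> P y -> P (a *: x + y)) ->
  forall x, lspan S x -> P x.
Proof. by move=> SP P0 PD x; elim=> // a y z Sy _ Pz; apply: PD => //; apply: SP. Qed.

Lemma lspan_mono S P x : (forall x, S x -> P x) -> lspan S x -> lspan P x.
Proof.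
move=> SP; apply: lspan_sub => [y /SP|| *].
- exact: lspan_gen.
- exact: lspan0.
- exact: lspanZD.
Qed.

Lemma lspan_idem S x : lspan (lspan S) x -> lspan S x.
Proof.
by apply: lspan_sub => // [|*]; [exact: lspan0|exact: lspanZD].
Qed.

Lemma lspan_sum (J : finType) S (c : J -> K) (b : J -> V) :
  (forall j, S (b j)) -> lspan S (\sum_j c j *: b j).
Proof.
move=> Sb; elim/big_ind: _ => [|x y|j _]; first exact: lspan0.
- exact: lspanD.
- by apply: lspanZ; apply: lspan_gen.
Qed.

Definition is_basis (J : finType) S (b : J -> V) :=
  [/\ forall j, S (b j),
      forall c : J -> K, \sum_j c j *: b j = 0 -> forall j, c j = 0
    & forall x, S x -> exists c : J -> K, x = \sum_j c j *: b j].

Definition hasdim S d := exists b : 'I_d -> V, is_basis S b.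

Lemma basis_hasdim (J : finType) S (b : J -> V) : is_basis S b -> hasdim S #|J|.
Proof.
case=> Sb bfree bspan; exists (b \o enum_val); split=> [j|c c0 j|x Sx] /=.
- exact: Sb.
- rewrite -[j]enum_valK; apply: (bfree (c \o enum_rank)).
  rewrite (reindex (@enum_val J predT)) /=; last exact: onW_bij (enum_val_bij J).
  by rewrite -[RHS]c0; apply: eq_bigr => k _; rewrite enum_valK.
- have [c ->] := bspan x Sx; exists (c \o enum_val).
  rewrite (reindex (@enum_val J predT)) //=; exact: onW_bij (enum_val_bij J).
Qed.

Lemma lspan_range (J : finType) (b : J -> V) x :
  lspan (fun y => exists j, y = b j) x -> exists c : J -> K, x = \sum_j c j *: b j.
Proof.
elim=> [|a _ z [j ->] _ [c ->]].
  by exists (fun=> 0); rewrite big1 // => j _; rewrite scale0r.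
exists (fun k => a *+ (k == j) + c k).
under [RHS]eq_bigr do rewrite scalerDl.
rewrite big_split /=; congr (_ + _).
rewrite (bigD1 j) //= eqxx mulr1n big1 ?addr0 //.
by move=> k /negPf ->; rewrite mulr0n scale0r.
Qed.

Lemma lspan_seqP (s : seq V) x : lspan (fun y => y \in s) x <->
  exists c : 'I_(size s) -> K, x = \sum_i c i *: s`_i.
Proof.
split=> [lx|[c ->]]; last by apply: lspan_sum => j; apply: mem_nth.
apply: (lspan_range (b := fun i : 'I_(size s) => s`_i)); apply: lspan_mono lx => y ys.
have iy : (index y s < size s)%N by rewrite index_mem.
by exists (Ordinal iy); rewrite nth_index.
Qed.

(** Induction on the length: a nontrivial linear relation allows one to drop a
    generator. *)
Lemma hasdim_span S (s : seq V) :
  (forall x, x \in s -> S x) -> (forall x, S x -> lspan (fun y => y \in s) x) ->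
  exists d, hasdim S d.
Proof.
move: {2}(size s) (leqnn (size s)) => k; elim: k s => [|k IH] s sk Ss sS.
  exists 0%N, (fun=> 0); split=> [[]//|_ _ []//|x /sS].
  move: sk; rewrite leqn0 size_eq0 => /eqP -> /lspan_seqP [c ->].
  by exists c; rewrite !big_ord0.
have [[c [c0 [i ci]]]|ind] := pselect (exists c : 'I_(size s) -> K,
    \sum_i c i *: s`_i = 0 /\ exists i, c i != 0); last first.
  exists (size s), (fun i => s`_i); split=> [i|c c0 i|x /sS/lspan_seqP //].
    exact/Ss/mem_nth.
  by apply/eqP; apply: contrapT => /negP ci; apply: ind; exists c; split=> //; exists i.
pose s' := take i s ++ drop i.+1 s.
have s's y : y \in s' -> y \in s.
  by rewrite mem_cat => /orP[/mem_take|/mem_drop].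
have s'j (j : 'I_(size s)) : j != i -> s`_j \in s'.
  move=> ji; rewrite mem_cat; have := ji; rewrite -val_eqE /= neq_ltn.
  case/orP=> [lt|gt].
    by rewrite -(nth_take _ lt) mem_nth // size_take ltn_ord.
  apply/orP; right.
  have -> : nat_of_ord j = (i.+1 + (j - i.+1))%N by rewrite subnKC.
  rewrite -nth_drop mem_nth // size_drop ltn_sub2r //.
  exact: leq_ltn_trans gt _.
apply: (IH s').
- by rewrite size_cat size_take size_drop ltn_ord -ltnS -addSn subnKC.
- by move=> x /s's /Ss.
- move=> x /sS; apply: lspan_sub => [y ys||*]; last exact: lspanZD.
    have si : lspan (fun y => y \in s') s`_i.
      have -> : s`_i = \sum_(j | j != i) (- (c i)^-1 * c j) *: s`_j.
        move: c0; rewrite (bigD1 i) //= => /eqP; rewrite addrC addr_eq0 => /eqP ci0.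
        under eq_bigr do rewrite -scalerA.
        by rewrite -scaler_sumr ci0 scalerN scaleNr opprK scalerA mulVf ?scale1r.
      elim/big_ind: _ => [|*|j ji]; [exact: lspan0|exact: lspanD|].
      by apply: lspanZ; apply: lspan_gen; apply: s'j.
    have iy : (index y s < size s)%N by rewrite index_mem.
    have [e|ne] := eqVneq (Ordinal iy) i.
      by rewrite -(nth_index 0 ys) -[index _ _]/(nat_of_ord (Ordinal iy)) e.
    by rewrite -(nth_index 0 ys) -[index _ _]/(nat_of_ord (Ordinal iy));
      apply: lspan_gen; apply: s'j.
  exact: lspan0.
Qed.

(** Induction on the number of forms: a further form either vanishes on the
    common kernel of the previous ones or costs one more representative. *)
Lemma finite_codim (J : finType) (c : J -> {linear V -> K^o}) :
  exists bs : seq V, forall x, exists y,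
    lspan (fun z => z \in bs) y /\ forall j, c j (x - y) = 0.
Proof.
suff [bs bsP] : exists bs : seq V, forall x, exists y,
    lspan (fun z => z \in bs) y /\ forall j, j \in enum J -> c j (x - y) = 0.
  exists bs => x; have [y [ys yP]] := bsP x.
  by exists y; split=> // j; apply: yP; rewrite mem_enum.
elim: (enum J) => [|k s [bs IH]].
  by exists nil => x; exists 0; split; [exact: lspan0|].
have [[a0 [a0s ca0]]|ker] :=
    pselect (exists a0, (forall j, j \in s -> c j a0 = 0) /\ c k a0 != 0).
  (* correct the representative by the multiple of [a0] that the new form asks
     for; this does not affect the other forms *)
  exists (a0 :: bs) => x; have [y [ys yP]] := IH x.
  exists ((c k (x - y) / c k a0) *: a0 + y); split.
    apply: lspanZD; first by apply: lspan_gen; rewrite mem_head.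
    by apply: lspan_mono ys => z zb; rewrite inE zb orbT.
  have -> : x - (c k (x - y) / c k a0 *: a0 + y) = - (c k (x - y) / c k a0) *: a0 + (x - y).
    by rewrite opprD addrCA scaleNr.
  move=> j; rewrite inE linearP => /predU1P[->|js].
    by rewrite -[_ *: _]/(_ * _ : K) mulNr divfK // addNr.
  by rewrite (yP _ js) (a0s _ js) scaler0 addr0.
exists bs => x; have [y [ys yP]] := IH x; exists y; split=> // j.
rewrite inE => /predU1P[->|/yP //].
by apply/eqP; apply: contrapT => /negP cxy; apply: ker; exists (x - y).
Qed.

End LinearAlgebra.

(** * Weights *)

Section Weights.
Variables (K : fieldType) (hh : vectType K).
Local Notation weight := 'Hom(hh, K^o).

Definition wt_space (V : lmodType K) (D : hh -> V -> V) (mu : weight) (x : V) :=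
  forall d, D d x = (mu d : K) *: x.

Variables (V : lmodType K) (D : hh -> {linear V -> V}).
Local Notation wt := (wt_space D).

Lemma wt0 mu : wt mu 0.
Proof. by move=> d; rewrite linear0 scaler0. Qed.

Lemma wtZD mu a x y : wt mu x -> wt mu y -> wt mu (a *: x + y).
Proof.
by move=> wx wy d; rewrite linearP wx wy scalerDr !scalerA mulrC.
Qed.

Lemma wt_sum (J : finType) mu (c : J -> K) (b : J -> V) :
  (forall j, wt mu (b j)) -> wt mu (\sum_j c j *: b j).
Proof.
move=> wb; elim/big_ind: _ => [|x y wx wy|j _]; first exact: wt0.
  by rewrite -[x]scale1r; apply: wtZD.
by rewrite -[_ *: _]addr0; apply: wtZD (wb j) (wt0 _).
Qed.

(** For a [d] that tells [nu j] from [mu], the operator [D d - nu j d] removes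
    the term of index [j] and rescales [y] by a nonzero constant. *)
Lemma wt_indep (J : eqType) (s : seq J) (mu : weight) (nu : J -> weight)
    (x : J -> V) y :
  wt mu y -> (forall j, j \in s -> wt (nu j) (x j)) ->
  (forall j, j \in s -> nu j != mu) -> y = \sum_(j <- s) x j -> y = 0.
Proof.
elim: s x y => [|j s IH] x y wy wx nmu; first by rewrite big_nil.
rewrite big_cons => ey.
have [d nd] : exists d, nu j d != mu d.
  apply: contrapT => ne; have /eqP := nmu j (mem_head _ _); apply.
  apply/lfunP => d; apply/eqP; apply: contrapT => /negP nd.
  by apply: ne; exists d.
have c0 : (mu d : K) - nu j d != 0 by rewrite subr_eq0 eq_sym.
have e : ((mu d : K) - nu j d) *: y = \sum_(l <- s) ((nu l d : K) - nu j d) *: x l.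
  rewrite scalerBl -wy {1}ey linearD wx ?mem_head // ey scalerDr.
  rewrite [X in X - _]addrC opprD addrA addrK linear_sum scaler_sumr -sumrB.
  rewrite 2!big_seq; apply: eq_bigr => l ls.
  by rewrite wx ?inE ?ls ?orbT // scalerBl.
apply: (scalerI c0); rewrite scaler0.
apply: (IH (fun l => ((nu l d : K) - nu j d) *: x l)) => [||l ls|//].
- by rewrite -[_ *: y]addr0; apply: wtZD wy (wt0 _).
- move=> l ls; rewrite -[_ *: _]addr0; apply: wtZD (wt0 _).
  by apply: wx; rewrite inE ls orbT.
- by apply: nmu; rewrite inE ls orbT.
Qed.

(** Vectors of distinct weights are independent, so the terms of the wrong weight
    in an expression of a weight vector can be dropped. *)
Lemma wt_proj (P : V -> Prop) mu x :
  (forall y, P y -> exists nu, wt nu y) -> lspan P x -> wt mu x ->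
  lspan (fun y => P y /\ wt mu y) x.
Proof.
move=> Pw Px wx.
suff [y [s [ys [nu [ex wn nn]]]]] : exists y (s : seq (weight * V)),
    lspan (fun y => P y /\ wt mu y) y /\ exists nu : weight * V -> weight,
    [/\ x = y + \sum_(j <- s) j.2, forall j, j \in s -> wt (nu j) j.2
      & forall j, j \in s -> nu j != mu].
  have wy : wt mu y.
    elim: ys => [|a u v [_ wu] _ wv]; [exact: wt0|exact: wtZD].
  suff -> : x = y by [].
  apply/eqP; rewrite -subr_eq0; apply/eqP.
  apply: (wt_indep (mu := mu) (s := s) (nu := nu) (x := snd)) => //.
    by rewrite -[x - y]addrC -scaleN1r; apply: wtZD.
  by rewrite ex addrAC subrr add0r.
elim: Px {wx} => [|a u v Pu _ [y [s [ys [nu [ev wn nn]]]]]].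
  exists 0, nil; split; first exact: lspan0.
  by exists fst; split; rewrite ?big_nil ?addr0.
have [wu|nwu] := pselect (wt mu u).
  exists (a *: u + y), s; split; first exact: lspan_cons.
  by exists nu; split=> //; rewrite ev addrA.
have [k wk] := Pw _ Pu.
have kmu : k != mu by apply/eqP => e; apply: nwu; rewrite -e.
exists y, ((k, a *: u) :: s); split=> //.
exists (fun j => if j.2 == a *: u then k else nu j); split.
- by rewrite big_cons ev /= addrCA.
- move=> j; rewrite inE; case: ifP => [/eqP -> _|/eqP ne].
    by rewrite -[_ *: _]addr0; apply: wtZD (wt0 _).
  by case/orP=> [/eqP e|/wn //]; case: ne; rewrite e.
- move=> j; rewrite inE; case: ifP => [//|/eqP ne].
  by case/orP=> [/eqP e|/nn //]; case: ne; rewrite e.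
Qed.

Lemma wt_direct (J : finType) (nu : J -> weight) (x : J -> V) :
  injective nu -> (forall j, wt (nu j) (x j)) -> \sum_j x j = 0 ->
  forall j, x j = 0.
Proof.
move=> inj wx s0 j.
apply: (wt_indep (mu := nu j) (s := [seq k <- enum J | k != j]) (nu := nu)
  (x := fun k => - x k)) => //.
- by move=> k _; rewrite -scaleN1r -[_ *: _]addr0; apply: wtZD (wt0 _).
- by move=> k; rewrite mem_filter => /andP[kj _]; rewrite (inj_eq inj).
- rewrite big_filter big_enum_cond sumrN; apply/eqP; rewrite -addr_eq0.
  by apply/eqP; rewrite -[RHS]s0 [RHS](bigD1 j).
Qed.

Lemma wt_uniq mu nu x : wt mu x -> wt nu x -> x != 0 -> mu = nu.
Proof.
move=> wm wn x0; apply/lfunP => d; apply/eqP; apply: contrapT => /negP ne.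
have /eqP := wm d; rewrite wn -subr_eq0 -scalerBl scaler_eq0 (negPf x0) orbF.
by rewrite subr_eq0 eq_sym; apply/negP.
Qed.

End Weights.

Section HighestWeightModules.
Variables (K : numFieldType) (A : comAlgType K) (N : nat) (hh : vectType K).
Variables (alpha : 'I_N -> 'Hom(hh, K^o)) (cm : 'I_N -> 'I_N -> K).
Local Notation weight := 'Hom(hh, K^o).

Section FSpan.
Variables (V : lmodType K) (F : 'I_N -> A -> V -> V).

Inductive fspan (P : V -> Prop) : V -> Prop :=
| fspan_base x : P x -> fspan P x
| fspan0 : fspan P 0
| fspan_lin k x y : fspan P x -> fspan P y -> fspan P (k *: x + y)
| fspan_F i a x : fspan P x -> fspan P (F i a x).

(** The filtration by the number of lowering operators; the raising operators
    lower it by one, so that inductions can run on it. *)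
Inductive ffil (v : V) : nat -> V -> Prop :=
| ffil_base s : ffil v s v
| ffil0 s : ffil v s 0
| ffil_lin s k x y : ffil v s x -> ffil v s y -> ffil v s (k *: x + y)
| ffil_F s i a x : ffil v s x -> ffil v s.+1 (F i a x).

Lemma ffil_le v s t x : (s <= t)%N -> ffil v s x -> ffil v t x.
Proof.
move=> st fx; elim: fx t st => {s x} [s|s|s k x y _ IHx _ IHy|s i a x _ IH] t st.
- exact: ffil_base.
- exact: ffil0.
- by apply: ffil_lin; [apply: IHx|apply: IHy].
- by case: t st => // t st; apply: ffil_F; apply: IH.
Qed.

Lemma fspan_ffil v x : fspan (eq v) x -> exists s, ffil v s x.
Proof.
elim=> {x} [x <-||k x y _ [s fx] _ [t fy]|i a x _ [s fx]].
- by exists 0%N; apply: ffil_base.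
- by exists 0%N; apply: ffil0.
- exists (maxn s t); apply: ffil_lin; [apply: ffil_le fx|apply: ffil_le fy].
    exact: leq_maxl.
  exact: leq_maxr.
- by exists s.+1; apply: ffil_F.
Qed.

End FSpan.

(** Irreducible highest weight modules, reduced to the operators [e_i (x) a],
    [f_i (x) a], [[e_i, f_i] (x) a] and [h (x) 1] and to the consequences of
    irreducibility that matter: the module is generated by the lowering operators
    from the highest weight vector, and it has no other singular vectors. The
    form [hweps], which kills what has been lowered, is the projection to the
    highest weight line. *)
Record hwmod (phi : 'I_N -> A -> K) (La : weight) := HWMod {
  hwcar :> lmodType K;
  hwE : 'I_N -> A -> {linear hwcar -> hwcar};
  hwF : 'I_N -> A -> {linear hwcar -> hwcar};
  hwH : 'I_N -> A -> {linear hwcar -> hwcar};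
  hwD : hh -> {linear hwcar -> hwcar};
  hwv : hwcar;
  hweps : {linear hwcar -> K^o};
  hwElin : forall i k a b x,
    hwE i (k *: a + b) x = k *: hwE i a x + hwE i b x;
  hwFlin : forall i k a b x,
    hwF i (k *: a + b) x = k *: hwF i a x + hwF i b x;
  hwEF : forall i j a b x, hwE i a (hwF j b x) =
    hwF j b (hwE i a x) + (if i == j then hwH i (a * b) x else 0);
  hwHF : forall i j a b x, hwH i a (hwF j b x) =
    hwF j b (hwH i a x) - cm i j *: hwF j (a * b) x;
  hwDF : forall d j b x, hwD d (hwF j b x) =
    hwF j b (hwD d x) - (alpha j d : K) *: hwF j b x;
  hwEv : forall i a, hwE i a hwv = 0;
  hwHv : forall i a, hwH i a hwv = phi i a *: hwv;
  hwDv : forall d, hwD d hwv = (La d : K) *: hwv;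
  hwepsv : hweps hwv = 1;
  hwepsF : forall i a x, hweps (hwF i a x) = 0;
  hwgen : forall x, fspan hwF (eq hwv) x;
  hwsing : forall x, (forall i a, hwE i a x = 0) -> x = (hweps x : K) *: hwv }.

(** The largest ideal of [A] on which the highest weight vanishes. *)
Definition annihilator (phi : 'I_N -> A -> K) (a : A) :=
  forall i b, phi i (a * b) = 0.

Section Theory.
Variables (phi : 'I_N -> A -> K) (La : weight) (M : hwmod phi La).
Local Notation E := (hwE M).
Local Notation F := (hwF M).
Local Notation H := (hwH M).
Local Notation D := (hwD M).
Local Notation v := (hwv M).
Local Notation eps := (hweps M).
Local Notation fil := (ffil F v).

Lemma hwF0 i x : F i 0 x = 0.
Proof. by have := hwFlin i (-1) 0 0 x; rewrite scaler0 addr0 scaleN1r addNr. Qed.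
Lemma hwE0 i x : E i 0 x = 0.
Proof. by have := hwElin i (-1) 0 0 x; rewrite scaler0 addr0 scaleN1r addNr. Qed.
Lemma hwFD i a b x : F i (a + b) x = F i a x + F i b x.
Proof. by rewrite -[a]scale1r hwFlin !scale1r. Qed.
Lemma hwED i a b x : E i (a + b) x = E i a x + E i b x.
Proof. by rewrite -[a]scale1r hwElin !scale1r. Qed.

(** The coroots preserve the filtration: the commutator of one with a lowering
    operator is a single lowering operator. *)
Lemma ffil_H s x i a : fil s x -> fil s (H i a x).
Proof.
move=> fx; elim: fx i a => {s x} [s|s|s k x y _ IHx _ IHy|s j b x fx IH] i a.
- by rewrite hwHv -[_ *: _]addr0; apply: ffil_lin; [exact: ffil_base|exact: ffil0].
- by rewrite linear0; apply: ffil0.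
- by rewrite linearP; apply: ffil_lin.
- by rewrite hwHF addrC -scaleNr; apply: ffil_lin; apply: ffil_F.
Qed.

Lemma ffil_E s x i a : fil s x ->
  if s is t.+1 then fil t (E i a x) else E i a x = 0.
Proof.
move=> fx; elim: fx i a => {s x} [s|s|s k x y _ IHx _ IHy|s j b x fx IH] i a.
- by rewrite hwEv; case: s => // s; apply: ffil0.
- by rewrite linear0; case: s => // s; apply: ffil0.
- rewrite linearP; case: s IHx IHy => [->|s IHx IHy]; last exact: ffil_lin.
  by move=> ->; rewrite scaler0 addr0.
- rewrite hwEF -[F j b _]scale1r; apply: ffil_lin.
    case: s {fx} IH => [->|s IH]; first by rewrite linear0; apply: ffil0.
    exact: ffil_F.
  by case: eqP => _; [exact: ffil_H|exact: ffil0].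
Qed.

(** Induction along the filtration: a vector that the raising operators kill is
    the multiple of the highest weight vector given by its own component. *)
Lemma hw_separation x :
  (forall w : seq ('I_N * A), eps (foldl (fun y p => E p.1 p.2 y) x w) = 0) ->
  x = 0.
Proof.
have [s] := fspan_ffil (hwgen x); elim: s x => [|s IH] x fx x0.
  rewrite (hwsing (x := x)) => [|i a]; last exact: ffil_E fx.
  by rewrite (x0 nil) scale0r.
rewrite (hwsing (x := x)) => [|i a]; first by rewrite (x0 nil) scale0r.
by apply: IH (ffil_E _ _ fx) _ => w; apply: (x0 ((i, a) :: w)).
Qed.

Lemma hw_forms x : (forall l : {linear M -> K^o}, l x = 0) -> x = 0.
Proof.
move=> x0; apply: hw_separation => w.
suff [l ll] : exists l : {linear M -> K^o},
    forall y, eps (foldl (fun y p => E p.1 p.2 y) y w) = l y by rewrite ll.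
elim: w => [|p w [l lw]]; first by exists eps.
by exists (l \o E p.1 p.2) => y /=; rewrite lw.
Qed.

(** Induction along the filtration. On a given step, coroots and raising
    operators with coefficient [a] commute to operators of the same kind on lower
    steps; then [F i a x] is singular and has no highest weight component. *)
Lemma annihilatorP a x : annihilator phi a ->
  [/\ forall i, E i a x = 0, forall i, F i a x = 0 & forall i, H i a x = 0].
Proof.
suff ann s y : fil s y -> forall b i, annihilator phi b ->
    [/\ E i b y = 0, F i b y = 0 & H i b y = 0].
  move=> aI; have [s fx] := fspan_ffil (hwgen x).
  by split=> i; case: (ann s x fx a i aI).
have annM b c : annihilator phi b -> annihilator phi (b * c).
  by move=> bI i d; rewrite -mulrA bI.
have annMl b c : annihilator phi b -> annihilator phi (c * b).
  by move=> bI; rewrite mulrC; apply: annM.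
elim: s y => [|s IH] y fy.
  have EH b i : annihilator phi b -> E i b y = 0 /\ H i b y = 0.
    move=> bI; split; first exact: ffil_E fy.
    move: {1 2}0%N fy (erefl 0%N) => s fy; elim: fy => {s y} // [s _|s _|s k x' y _ IHx _ IHy s0].
    - by rewrite hwHv -[b]mulr1 bI scale0r.
    - exact: linear0.
    - by rewrite linearP IHx // IHy // scaler0 addr0.
  move=> b i bI; have [Eb Hb] := EH b i bI; split=> //.
  rewrite (hwsing (x := F i b y)) ?hwepsF ?scale0r // => j c.
  rewrite hwEF (ffil_E _ _ fy) linear0 add0r.
  by case: eqP => // _; case: (EH (c * b) j (annMl _ _ bI)).
have EH b i : annihilator phi b -> E i b y = 0 /\ H i b y = 0.
  move=> bI; move: {1 2}s.+1 fy (erefl s.+1) => t fy.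
  elim: fy => {t y} [t _|t _|t k y z _ IHy _ IHz ts|t j c y fy _ ts].
  - by rewrite hwEv hwHv -[b]mulr1 bI scale0r.
  - by rewrite !linear0.
  - rewrite !linearP; have [-> ->] := IHy ts; have [-> ->] := IHz ts.
    by rewrite !scaler0 addr0.
  - case: ts fy => -> fy; have [Eb Fb Hb] := IH y fy b i bI.
    have [_ _ Hbc] := IH y fy (b * c) i (annM _ _ bI).
    have [_ Fbc _] := IH y fy (b * c) j (annM _ _ bI).
    by rewrite hwEF hwHF Eb Hb Fbc Hbc scaler0 subr0 !linear0 if_same addr0.
move=> b i bI; have [Eb Hb] := EH b i bI; split=> //.
rewrite (hwsing (x := F i b y)) ?hwepsF ?scale0r // => j c.
have [_ Fb _] := IH _ (ffil_E j c fy) b i bI.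
rewrite hwEF Fb add0r.
by case: eqP => // _; case: (EH (c * b) j (annMl _ _ bI)).
Qed.

End Theory.

Section Uniqueness.
Variables (phi : 'I_N -> A -> K) (La : weight) (M1 M2 : hwmod phi La).

(** The submodule generated by [(v1, v2)] in the product of the two modules. *)
Inductive hwrel : M1 -> M2 -> Prop :=
| hwrel_v : hwrel (hwv M1) (hwv M2)
| hwrel0 : hwrel 0 0
| hwrel_lin k x1 y1 x2 y2 : hwrel x1 x2 -> hwrel y1 y2 ->
    hwrel (k *: x1 + y1) (k *: x2 + y2)
| hwrel_F i a x1 x2 : hwrel x1 x2 -> hwrel (hwF M1 i a x1) (hwF M2 i a x2).

Lemma hwrel_add x1 y1 x2 y2 : hwrel x1 x2 -> hwrel y1 y2 -> hwrel (x1 + y1) (x2 + y2).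
Proof. by move=> rx ry; have := hwrel_lin 1 rx ry; rewrite !scale1r. Qed.
Lemma hwrel_scale k x1 x2 : hwrel x1 x2 -> hwrel (k *: x1) (k *: x2).
Proof. by move=> rx; have := hwrel_lin k rx hwrel0; rewrite !addr0. Qed.

Lemma hwrel_hwH i a x1 x2 : hwrel x1 x2 -> hwrel (hwH M1 i a x1) (hwH M2 i a x2).
Proof.
elim=> {x1 x2} [||k x1 y1 x2 y2 _ IHx _ IHy|j b x1 x2 r IH].
- by rewrite !hwHv; apply: hwrel_scale hwrel_v.
- by rewrite !linear0; apply: hwrel0.
- by rewrite !linearP; apply: hwrel_lin.
- rewrite !hwHF -!scaleNr; apply: hwrel_add; first exact: hwrel_F.
  by apply: hwrel_scale; apply: hwrel_F.
Qed.

Lemma hwrel_hwE i a x1 x2 : hwrel x1 x2 -> hwrel (hwE M1 i a x1) (hwE M2 i a x2).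
Proof.
elim=> {x1 x2} [||k x1 y1 x2 y2 _ IHx _ IHy|j b x1 x2 r IH].
- by rewrite !hwEv; apply: hwrel0.
- by rewrite !linear0; apply: hwrel0.
- by rewrite !linearP; apply: hwrel_lin.
- rewrite !hwEF; apply: hwrel_add; first exact: hwrel_F.
  by case: eqP => _; [exact: hwrel_hwH|exact: hwrel0].
Qed.

Lemma hwrel_hwD d x1 x2 : hwrel x1 x2 -> hwrel (hwD M1 d x1) (hwD M2 d x2).
Proof.
elim=> {x1 x2} [||k x1 y1 x2 y2 _ IHx _ IHy|j b x1 x2 r IH].
- by rewrite !hwDv; apply: hwrel_scale hwrel_v.
- by rewrite !linear0; apply: hwrel0.
- by rewrite !linearP; apply: hwrel_lin.
- rewrite !hwDF -!scaleNr; apply: hwrel_add; first exact: hwrel_F.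
  by apply: hwrel_scale; apply: hwrel_F.
Qed.

Lemma hwrel_eps x1 x2 : hwrel x1 x2 -> hweps M1 x1 = hweps M2 x2.
Proof.
elim=> {x1 x2} [||k x1 y1 x2 y2 _ IHx _ IHy|j b x1 x2 r IH].
- by rewrite !hwepsv.
- by rewrite !linear0.
- by rewrite !linearP /= IHx IHy.
- by rewrite !hwepsF.
Qed.

(** The two components of a pair have the same highest weight components after
    any raising operators, and these determine them. *)
Lemma hwrel_inj x1 x2 : hwrel x1 x2 -> x1 = 0 <-> x2 = 0.
Proof.
have key w y1 y2 : hwrel y1 y2 ->
    hweps M1 (foldl (fun y p => hwE M1 p.1 p.2 y) y1 w) =
    hweps M2 (foldl (fun y p => hwE M2 p.1 p.2 y) y2 w).
  elim: w y1 y2 => [|p w IH] y1 y2 r /=; first exact: hwrel_eps.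
  by apply: IH; apply: hwrel_hwE.
have foldE0 phi' La' (M : hwmod phi' La') w :
    hweps M (foldl (fun y p => hwE M p.1 p.2 y) 0 w) = 0.
  by elim: w => [|p w IH] /=; rewrite ?linear0.
move=> r; split=> e; apply: hw_separation => w.
  by rewrite -(key w _ _ r) e foldE0.
by rewrite (key w _ _ r) e foldE0.
Qed.

Lemma hwrel_total1 x1 : exists x2, hwrel x1 x2.
Proof.
elim: (hwgen x1) => {x1} [_ <-||k x y _ [x' rx] _ [y' ry]|i a x _ [x' rx]].
- by exists (hwv M2); apply: hwrel_v.
- by exists 0; apply: hwrel0.
- by exists (k *: x' + y'); apply: hwrel_lin.
- by exists (hwF M2 i a x'); apply: hwrel_F.
Qed.

Lemma hwrel_total2 x2 : exists x1, hwrel x1 x2.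
Proof.
elim: (hwgen x2) => {x2} [_ <-||k x y _ [x' rx] _ [y' ry]|i a x _ [x' rx]].
- by exists (hwv M1); apply: hwrel_v.
- by exists 0; apply: hwrel0.
- by exists (k *: x' + y'); apply: hwrel_lin.
- by exists (hwF M1 i a x'); apply: hwrel_F.
Qed.

Lemma hwrel_sub x1 y1 x2 y2 : hwrel x1 x2 -> hwrel y1 y2 -> hwrel (x1 - y1) (x2 - y2).
Proof. by move=> rx ry; rewrite -!scaleN1r; apply: hwrel_add => //; apply: hwrel_scale. Qed.

Lemma hwrel_wt mu x1 x2 : hwrel x1 x2 ->
  wt_space (hwD M1) mu x1 <-> wt_space (hwD M2) mu x2.
Proof.
move=> r; have rd d := hwrel_sub (hwrel_hwD d r) (hwrel_scale (mu d) r).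
by split=> w d; apply/eqP; rewrite -subr_eq0; apply/eqP;
  apply: (hwrel_inj (rd d)).1 || apply: (hwrel_inj (rd d)).2; rewrite w subrr.
Qed.

Lemma hwrel_sum (J : finType) (c : J -> K) b1 b2 : (forall j, hwrel (b1 j) (b2 j)) ->
  hwrel (\sum_j c j *: b1 j) (\sum_j c j *: b2 j).
Proof.
move=> r; elim/big_ind2: _ => [|*|j _]; [exact: hwrel0|exact: hwrel_add|exact: hwrel_scale].
Qed.

(** The submodule generated by [(v1, v2)] is the graph of an isomorphism. *)
Theorem hwmod_unique mu d : hasdim (wt_space (hwD M1) mu) d ->
  hasdim (wt_space (hwD M2) mu) d.
Proof.
case=> b1 [wb bf bs]; have [b2 rb] := choice (fun j => hwrel_total1 (b1 j)).
exists b2; split=> [j|c c0|x2 wx].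
- exact/(hwrel_wt _ (rb j)).
- by apply: bf; apply/(hwrel_inj (hwrel_sum c rb)).
- have [x1 rx] := hwrel_total2 x2.
  have [c ec] := bs x1 ((hwrel_wt mu rx).2 wx); exists c.
  apply/eqP; rewrite -subr_eq0; apply/eqP.
  by apply/(hwrel_inj (hwrel_sub rx (hwrel_sum c rb))); rewrite ec subrr.
Qed.

End Uniqueness.
End HighestWeightModules.

(** * Tensor products of highest weight modules *)

Definition comaximal (A : pzRingType) (P Q : A -> Prop) := exists e, P (1 - e) /\ Q e.

Section TensorProduct.
Variables (K : numFieldType) (A : comAlgType K) (N : nat) (hh : vectType K).
Variables (alpha : 'I_N -> 'Hom(hh, K^o)) (cm : 'I_N -> 'I_N -> K).
Local Notation weight := 'Hom(hh, K^o).
Variables (phi1 phi2 : 'I_N -> A -> K) (La1 La2 : weight).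
Variables (M1 : hwmod alpha cm phi1 La1) (M2 : hwmod alpha cm phi2 La2).

Local Notation forms := ({linear M1 -> K^o} * {linear M2 -> K^o})%type.

(** A tensor is encoded by the function that it defines on pairs of linear
    forms. This is faithful since linear forms separate the vectors of either
    factor ([hw_forms]). *)
Definition pure (x : M1) (y : M2) : forms -> K^o := fun l => l.1 x * l.2 y.

Definition tensor_space : subspace (forms -> K^o) :=
  subspace_of (submodule_lspan (fun w => exists x y, w = pure x y)).
Local Notation T := (subspace_type tensor_space).

Fact pure_mem x y : pure x y \in tensor_space.
Proof. by apply/subspace_ofP; apply: lspan_gen; exists x, y. Qed.
Definition pureT x y : T := Sub_ (pure_mem x y).

Lemma tensor_ext (w w' : T) : (forall l, val w l = val w' l) -> w = w'.
Proof. by move=> e; apply: val_inj; apply/funext. Qed.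

Lemma tensor_ind (P : T -> Prop) : P 0 ->
  (forall a x y w, P w -> P (a *: pureT x y + w)) -> forall w, P w.
Proof.
move=> P0 PD [w wT]; have /subspace_ofP := wT.
move=> lw; elim: lw wT => [|a z u [x [y ->]] lu IH] wT.
  by rewrite (_ : Sub_ wT = 0) //; apply: val_inj.
have uT : u \in tensor_space by apply/subspace_ofP.
rewrite (_ : Sub_ wT = a *: pureT x y + Sub_ uT); first exact/PD/IH.
exact: val_inj.
Qed.

Lemma tensor_span w : lspan (fun w => exists x y, w = pureT x y) w.
Proof.
elim/tensor_ind: w => [|a x y w]; [exact: lspan0|apply: lspan_cons].
by exists x, y.
Qed.

Lemma pureDl a x x' y : pureT (a *: x + x') y = a *: pureT x y + pureT x' y.
Proof. by apply: tensor_ext => l; rewrite /= /pure linearP mulrDl -scalerAl. Qed.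
Lemma pureDr a x y y' : pureT x (a *: y + y') = a *: pureT x y + pureT x y'.
Proof. by apply: tensor_ext => l; rewrite /= /pure linearP mulrDr -scalerAr. Qed.
Lemma pure0l y : pureT 0 y = 0.
Proof. by apply: tensor_ext => l; rewrite /= /pure linear0 mul0r. Qed.
Lemma pure0r x : pureT x 0 = 0.
Proof. by apply: tensor_ext => l; rewrite /= /pure linear0 mulr0. Qed.

Section Operators.
Variables (X1 : {linear M1 -> M1}) (X2 : {linear M2 -> M2}).

(** [X1 (x) 1 + 1 (x) X2]. *)
Definition leibniz_fun (w : forms -> K^o) : forms -> K^o := fun l =>
  w ((l.1 \o X1 : {linear M1 -> K^o}), l.2) +
  w (l.1, (l.2 \o X2 : {linear M2 -> K^o})).

Fact leibniz_mem (w : T) : leibniz_fun (val w) \in tensor_space.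
Proof.
elim/tensor_ind: w => [|a x y w IH].
  rewrite (_ : leibniz_fun _ = 0) ?rpred0 //; apply/funext => l.
  by rewrite /leibniz_fun /= addr0.
rewrite (_ : leibniz_fun _ = a *: (pure (X1 x) y + pure x (X2 y)) + leibniz_fun (val w)).
  by rewrite rpredD // rpredZ // rpredD // pure_mem.
by apply/funext => l; rewrite /leibniz_fun /= /pure /= [RHS]/(_ + _) /= scalerDr addrACA.
Qed.
Definition leibniz (w : T) : T := Sub_ (leibniz_mem w).

Fact leibniz_linear : linear leibniz.
Proof.
move=> a u w; apply: tensor_ext => l.
by rewrite /= /leibniz_fun /= [RHS]/(_ + _) scalerDr addrACA.
Qed.
HB.instance Definition _ := GRing.isLinear.Build K T T _ leibniz leibniz_linear.

Lemma leibniz_pure x y : leibniz (pureT x y) = pureT (X1 x) y + pureT x (X2 y).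
Proof. exact: tensor_ext. Qed.

End Operators.

(** The commutation relations pass to the tensor product since [X1 (x) 1]
    commutes with [1 (x) Y2]. *)
Lemma leibniz_comm (X1 Y1 : {linear M1 -> M1}) (X2 Y2 : {linear M2 -> M2})
    (Z1 : M1 -> M1) (Z2 : M2 -> M2) (G : T -> T) :
  (forall x, X1 (Y1 x) = Y1 (X1 x) + Z1 x) ->
  (forall y, X2 (Y2 y) = Y2 (X2 y) + Z2 y) ->
  linear G -> (forall x y, G (pureT x y) = pureT (Z1 x) y + pureT x (Z2 y)) ->
  forall w, leibniz X1 X2 (leibniz Y1 Y2 w) = leibniz Y1 Y2 (leibniz X1 X2 w) + G w.
Proof.
move=> c1 c2 GL Gp; elim/tensor_ind => [|a x y w IH].
  have G0 : G 0 = 0.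
    by have := GL (-1) 0 0; rewrite scaler0 addr0 scaleN1r addNr.
  by rewrite !linear0 G0 addr0.
have D1 u u' z : pureT (u + u') z = pureT u z + pureT u' z.
  by have := pureDl 1 u u' z; rewrite !scale1r.
have D2 u z z' : pureT u (z + z') = pureT u z + pureT u z'.
  by have := pureDr 1 u z z'; rewrite !scale1r.
have totD (X : {linear M1 -> M1}) (X' : {linear M2 -> M2}) u u' :
  leibniz X X' (u + u') = leibniz X X' u + leibniz X X' u' by exact: linearD.
rewrite GL !leibniz_linear IH addrACA; congr (_ + _); rewrite -scalerDr; congr (_ *: _).
rewrite !leibniz_pure !totD !leibniz_pure Gp c1 c2 D1 D2.
have AC (V : zmodType) (p q r s t u : V) :
    p + t + q + (r + (s + u)) = p + r + (q + s) + (t + u).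
  by rewrite -!addrA (addrCA t q) (addrCA t r) (addrCA t s) (addrCA q r).
exact: AC.
Qed.

(** Contracting a tensor with a form on one factor leaves a vector of the other
    one. *)
Lemma slice1 (w : T) l2 : exists x, forall l1, val w (l1, l2) = l1 x.
Proof.
elim/tensor_ind: w => [|a x y w [z IH]]; first by exists 0 => l1; rewrite linear0.
exists ((a * l2 y) *: x + z) => l1.
rewrite (linearP l1) -(IH l1) /=; congr (_ + _).
by rewrite -[LHS]/(a * (l1 x * l2 y)) -[RHS]/(a * l2 y * l1 x) -mulrA (mulrC (l1 x)).
Qed.

Lemma slice2 (w : T) l1 : exists y, forall l2, val w (l1, l2) = l2 y.
Proof.
elim/tensor_ind: w => [|a x y w [z IH]]; first by exists 0 => l2; rewrite linear0.
exists ((a * l1 x) *: y + z) => l2.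
rewrite (linearP l2) -(IH l2) /=; congr (_ + _).
by rewrite -[LHS]/(a * (l1 x * l2 y)) -[RHS]/(a * l1 x * l2 y) mulrA.
Qed.

Definition tE i a : {linear T -> T} := leibniz (hwE M1 i a) (hwE M2 i a).
Definition tF i a : {linear T -> T} := leibniz (hwF M1 i a) (hwF M2 i a).
Definition tH i a : {linear T -> T} := leibniz (hwH M1 i a) (hwH M2 i a).
Definition tD d : {linear T -> T} := leibniz (hwD M1 d) (hwD M2 d).

Lemma tE_pure i a x y : tE i a (pureT x y) = pureT (hwE M1 i a x) y + pureT x (hwE M2 i a y).
Proof. exact: leibniz_pure. Qed.
Lemma tF_pure i a x y : tF i a (pureT x y) = pureT (hwF M1 i a x) y + pureT x (hwF M2 i a y).
Proof. exact: leibniz_pure. Qed.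
Lemma tH_pure i a x y : tH i a (pureT x y) = pureT (hwH M1 i a x) y + pureT x (hwH M2 i a y).
Proof. exact: leibniz_pure. Qed.
Lemma tD_pure d x y : tD d (pureT x y) = pureT (hwD M1 d x) y + pureT x (hwD M2 d y).
Proof. exact: leibniz_pure. Qed.

Definition tv := pureT (hwv M1) (hwv M2).

Definition evalT (l : forms) (w : T) : K^o := val w l.
Fact evalT_linear l : linear (evalT l).
Proof. by []. Qed.
HB.instance Definition _ l := GRing.isLinear.Build K T K^o _ (evalT l) (evalT_linear l).
Definition teps : {linear T -> K^o} := evalT (hweps M1, hweps M2).

Lemma tensor_eq_linear (G G' : T -> T) : linear G -> linear G' ->
  (forall x y, G (pureT x y) = G' (pureT x y)) -> forall w, G w = G' w.
Proof.
move=> GL GL' e; elim/tensor_ind => [|a x y w IH]; last by rewrite GL GL' e IH.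
have l0 (f : T -> T) : linear f -> f 0 = 0.
  by move=> fL; have := fL (-1) 0 0; rewrite scaler0 addr0 scaleN1r addNr.
by rewrite !l0.
Qed.

Fact tElin i k a b w : tE i (k *: a + b) w = k *: tE i a w + tE i b w.
Proof.
apply: (tensor_eq_linear (G' := fun w => k *: tE i a w + tE i b w)) w => [||x y].
- exact: linearP.
- by move=> c u z; rewrite (linearP (tE i a)) (linearP (tE i b)) !scalerDr !scalerA mulrC addrACA.
- by rewrite !tE_pure !hwElin pureDl pureDr scalerDr addrACA.
Qed.

Fact tFlin i k a b w : tF i (k *: a + b) w = k *: tF i a w + tF i b w.
Proof.
apply: (tensor_eq_linear (G' := fun w => k *: tF i a w + tF i b w)) w => [||x y].
- exact: linearP.
- by move=> c u z; rewrite (linearP (tF i a)) (linearP (tF i b)) !scalerDr !scalerA mulrC addrACA.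
- by rewrite !tF_pure !hwFlin pureDl pureDr scalerDr addrACA.
Qed.

Fact tEF i j a b w : tE i a (tF j b w) =
  tF j b (tE i a w) + (if i == j then tH i (a * b) w else 0).
Proof.
apply: (leibniz_comm (Z1 := fun x => if i == j then hwH M1 i (a * b) x else 0)
  (Z2 := fun y => if i == j then hwH M2 i (a * b) y else 0)
  (G := fun w => if i == j then tH i (a * b) w else 0)) => [x|y||x y].
- exact: hwEF.
- exact: hwEF.
- by case: eqP => _ c u z; rewrite ?linearP // scaler0 addr0.
- by case: eqP => _; rewrite ?tH_pure // pure0l pure0r addr0.
Qed.

Lemma leibniz_scale (k : K) (Y1 : M1 -> M1) (Y2 : M2 -> M2) x y :
  k *: (pureT (Y1 x) y + pureT x (Y2 y)) =
  pureT (k *: Y1 x) y + pureT x (k *: Y2 y).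
Proof.
rewrite -[k *: Y1 x]addr0 -[k *: Y2 y]addr0 pureDl pureDr pure0l pure0r.
by rewrite !addr0 scalerDr.
Qed.

Fact tHF i j a b w : tH i a (tF j b w) =
  tF j b (tH i a w) - cm i j *: tF j (a * b) w.
Proof.
rewrite -scaleNr.
apply: (leibniz_comm (Z1 := fun x => - cm i j *: hwF M1 j (a * b) x)
  (Z2 := fun y => - cm i j *: hwF M2 j (a * b) y)
  (G := fun w => - cm i j *: tF j (a * b) w)) => [x|y||x y].
- by rewrite hwHF scaleNr.
- by rewrite hwHF scaleNr.
- by move=> c u z; rewrite (linearP (tF j _)) scalerDr !scalerA mulrC.
- by rewrite tF_pure leibniz_scale.
Qed.

Fact tDF d j b w : tD d (tF j b w) = tF j b (tD d w) - (alpha j d : K) *: tF j b w.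
Proof.
rewrite -scaleNr.
apply: (leibniz_comm (Z1 := fun x => - (alpha j d : K) *: hwF M1 j b x)
  (Z2 := fun y => - (alpha j d : K) *: hwF M2 j b y)
  (G := fun w => - (alpha j d : K) *: tF j b w)) => [x|y||x y].
- by rewrite hwDF scaleNr.
- by rewrite hwDF scaleNr.
- by move=> c u z; rewrite (linearP (tF j _)) scalerDr !scalerA mulrC.
- by rewrite tF_pure leibniz_scale.
Qed.

Fact tEv i a : tE i a tv = 0.
Proof. by rewrite tE_pure !hwEv pure0l pure0r addr0. Qed.

Lemma pureZl k x y : pureT (k *: x) y = k *: pureT x y.
Proof. by rewrite -[k *: x]addr0 pureDl pure0l addr0. Qed.
Lemma pureZr k x y : pureT x (k *: y) = k *: pureT x y.
Proof. by rewrite -[k *: y]addr0 pureDr pure0r addr0. Qed.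

Fact tHv i a : tH i a tv = (phi1 i a + phi2 i a) *: tv.
Proof. by rewrite tH_pure !hwHv pureZl pureZr scalerDl. Qed.
Fact tDv d : tD d tv = ((La1 + La2) d : K) *: tv.
Proof. by rewrite tD_pure !hwDv pureZl pureZr lfunE /= scalerDl. Qed.
Fact tepsv : teps tv = 1.
Proof.
rewrite -[LHS]/((hweps M1 (hwv M1) : K) * hweps M2 (hwv M2)).
by rewrite !hwepsv mulr1.
Qed.
Fact tepsF i a w : teps (tF i a w) = 0.
Proof.
rewrite -[LHS]/(leibniz_fun (hwF M1 i a) (hwF M2 i a) (val w) (hweps M1, hweps M2)) /leibniz_fun /=.
have [x ->] := slice1 w (hweps M2); have [y ->] := slice2 w (hweps M1).
by rewrite /= !hwepsF addr0.
Qed.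

(** The witness of comaximality acts by zero on [M2] and its complement to 1 by
    zero on [M1], so that multiplying coefficients by it singles out a factor. *)
Hypothesis co : comaximal (annihilator phi1) (annihilator phi2).

Lemma annihilatorM (phi : 'I_N -> A -> K) (a e : A) : annihilator phi e ->
  annihilator phi (a * e).
Proof. by move=> h i b; rewrite mulrAC mulrC. Qed.

Let splitA (a e : A) : a = a * e + a * (1 - e).
Proof. by rewrite mulrBr mulr1 addrC subrK. Qed.

Lemma slotF1 i a : exists c, forall x y, tF i c (pureT x y) = pureT (hwF M1 i a x) y.
Proof.
have [e [e1 e2]] := co; exists (a * e) => x y; rewrite tF_pure.
have [_ Fe _] := annihilatorP y (annihilatorM a e2).
have [_ Fe' _] := annihilatorP x (annihilatorM a e1).
by rewrite Fe pure0r addr0 {2}(splitA a e) hwFD Fe' addr0.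
Qed.

Lemma slotF2 i a : exists c, forall x y, tF i c (pureT x y) = pureT x (hwF M2 i a y).
Proof.
have [e [e1 e2]] := co; exists (a * (1 - e)) => x y; rewrite tF_pure.
have [_ Fe _] := annihilatorP y (annihilatorM a e2).
have [_ Fe' _] := annihilatorP x (annihilatorM a e1).
by rewrite Fe' pure0l add0r {2}(splitA a e) hwFD Fe add0r.
Qed.

Fact tgen w : fspan tF (eq tv) w.
Proof.
elim/tensor_ind: w => [|a x y w IH]; [exact: fspan0|apply: fspan_lin => //].
elim: (hwgen y) => {y w IH} [_ <-||k y z _ IHy _ IHz|i b y _ IHy].
- elim: (hwgen x) => {x} [_ <-||k x z _ IHx _ IHz|i b x _ IHx].
  + exact: fspan_base.
  + by rewrite pure0l; apply: fspan0.
  + by rewrite pureDl; apply: fspan_lin.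
  + by have [c <-] := slotF1 i b; apply: fspan_F.
- by rewrite pure0r; apply: fspan0.
- by rewrite pureDr; apply: fspan_lin.
- by have [c <-] := slotF2 i b; apply: fspan_F.
Qed.

(** Both slices of a vector killed by the raising operators of each factor
    separately are singular, hence multiples of the highest weight vectors. *)
Fact tsing w : (forall i a, tE i a w = 0) -> w = (teps w : K) *: tv.
Proof.
move=> w0; have [e [e1 e2]] := co.
have w0l i a (l1 : {linear M1 -> K^o}) (l2 : {linear M2 -> K^o}) :
    val w ((l1 \o hwE M1 i a : {linear M1 -> K^o}), l2) +
    val w (l1, (l2 \o hwE M2 i a : {linear M2 -> K^o})) = 0.
  exact: (congr1 (fun w : T => val w (l1, l2)) (w0 i a)).
have s1 l1 l2 : val w (l1, l2) = (val w (hweps M1, l2) : K) * l1 (hwv M1).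
  have [x xw] := slice1 w l2; rewrite !xw.
  have Ex i a : hwE M1 i a x = 0.
    apply: hw_forms => l; have := w0l i (a * e) l l2; rewrite xw.
    have [y ->] := slice2 w l => /=.
    have [-> _ _] := annihilatorP y (annihilatorM a e2).
    rewrite linear0 addr0 [in X in _ -> X](splitA a e) hwED.
    by have [-> _ _] := annihilatorP x (annihilatorM a e1); rewrite addr0.
  by rewrite {1}(hwsing Ex) linearZ.
have s2 l1 l2 : val w (l1, l2) = (val w (l1, hweps M2) : K) * l2 (hwv M2).
  have [y yw] := slice2 w l1; rewrite !yw.
  have Ey i a : hwE M2 i a y = 0.
    apply: hw_forms => l; have := w0l i (a * (1 - e)) l1 l; rewrite yw.
    have [x ->] := slice1 w l => /=.
    have [-> _ _] := annihilatorP x (annihilatorM a e1).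
    rewrite linear0 add0r [in X in _ -> X](splitA a e) hwED.
    by have [-> _ _] := annihilatorP y (annihilatorM a e2); rewrite add0r.
  by rewrite {1}(hwsing Ey) linearZ.
apply: tensor_ext => -[l1 l2] /=; rewrite s1 s2 -mulrA [RHS]/(_ * (_ * _)).
by rewrite (mulrC (l2 _)).
Qed.

(** Highest weights supported at disjoint points of the spectrum of [A] have an
    irreducible tensor product. *)
Definition tensor : hwmod alpha cm (fun i a => phi1 i a + phi2 i a) (La1 + La2) :=
  HWMod tElin tFlin tEF tHF tDF tEv tHv tDv tepsv tepsF tgen tsing.

End TensorProduct.

(** * Weight spaces are finite dimensional *)

Section Characters.
Variables (K : numFieldType) (A : comAlgType K) (N : nat) (hh : vectType K).
Variables (alpha : 'I_N -> 'Hom(hh, K^o)) (cm : 'I_N -> 'I_N -> K).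
Local Notation weight := 'Hom(hh, K^o).
Hypothesis alpha_free : free (codom alpha).

Definition rootsum (s : seq 'I_N) : weight := \sum_(j <- s) alpha j.

Lemma rootsum_count s : rootsum s = \sum_j alpha j *+ count_mem j s.
Proof.
elim: s => [|k s IH]; first by rewrite /rootsum big_nil big1.
rewrite /rootsum big_cons -/(rootsum s) IH /=.
under [RHS]eq_bigr do rewrite mulrnDr.
rewrite big_split /=; congr (_ + _).
rewrite (bigD1 k) //= eqxx mulr1n big1 ?addr0 // => j jk.
by rewrite eq_sym (negPf jk).
Qed.

(** The multiplicities are recovered from the sum since the simple roots are
    independent and the characteristic is zero. *)
Lemma rootsum_inj s t : rootsum s = rootsum t -> perm_eq s t.
Proof.
move=> e; apply/permP => p.
suff cnt j : count_mem j s = count_mem j t.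
  by apply/permP/allP => j _; rewrite /= cnt.
have /freeP fr : free (mktuple alpha) by [].
have := fr (fun j => (count_mem j s)%:R - (count_mem j t)%:R).
have -> : \sum_(k < N) ((count_mem k s)%:R - (count_mem k t)%:R) *:
    (mktuple alpha)`_k = 0.
  under eq_bigr do rewrite scalerBl !scaler_nat -tnth_nth tnth_mktuple.
  by rewrite sumrB -!rootsum_count e subrr.
by move=> /(_ erefl j) /eqP; rewrite subr_eq0 eqr_nat => /eqP.
Qed.

Section Weights.
Variables (phi : 'I_N -> A -> K) (La : weight) (M : hwmod alpha cm phi La).
Local Notation F := (hwF M).
Local Notation v := (hwv M).
Local Notation wt := (wt_space (hwD M)).

Section Words.
Variables (J : Type) (b : J -> A).

Definition Fword (w : seq ('I_N * J)) : M :=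
  foldr (fun p z => F p.1 (b p.2) z) v w.

Lemma Fword_wt w : wt (La - rootsum (map fst w)) (Fword w).
Proof.
elim: w => [|[j a] w IH] d /=.
  by rewrite hwDv /rootsum big_nil subr0.
rewrite hwDF IH linearZ /= -scalerBl /rootsum big_cons opprD addrCA.
rewrite [X in X *: _ = _ ](_ : _ = ((- alpha j + (La - rootsum (map fst w))) d : K)) //.
by rewrite [RHS]add_lfunE opp_lfunE [RHS]addrC.
Qed.

Hypothesis spans : forall a, exists c,
  lspan (fun y => exists j, y = b j) c /\ annihilator phi (a - c).

(** A coefficient can be replaced by its remainder modulo the annihilator, which
    is a combination of the [b j]. *)
Lemma Fword_span x : lspan (fun y => exists w, y = Fword w) x.
Proof.
elim: (hwgen x) => {x} [_ <-||k x y _ lx _ ly|i a x _ lx].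
- by apply: lspan_gen; exists nil.
- exact: lspan0.
- exact: lspanZD.
have [c [lc ann]] := spans a.
have [_ Fx _] := annihilatorP x ann.
rewrite -[a](subrK c) hwFD Fx add0r {a ann Fx}.
elim: lc => [|k _ z [j ->] _ IH]; first by rewrite hwF0; apply: lspan0.
rewrite hwFlin; apply: lspanZD => // {IH z}.
elim: lx => [|l _ z [w ->] _ IH]; first by rewrite linear0; apply: lspan0.
by rewrite linearP; apply: lspan_cons IH; exists ((i, j) :: w).
Qed.

Lemma Fword_wt_span mu x : wt mu x ->
  lspan (fun y => (exists w, y = Fword w) /\ wt mu y) x.
Proof.
apply: wt_proj (Fword_span x) => y [w ->].
by exists (La - rootsum (map fst w)); apply: Fword_wt.
Qed.

End Words.

Lemma hwv_neq0 : v != 0.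
Proof.
by apply/eqP => v0; have := hwepsv M; rewrite v0 linear0 => /esym/eqP; rewrite oner_eq0.
Qed.

Lemma annihilator0 : annihilator phi 0.
Proof.
move=> i b; rewrite mul0r; have := hwEF i i 0 1 v.
rewrite !hwE0 eqxx linear0 mul0r add0r hwHv => /esym/eqP.
by rewrite scaler_eq0 (negPf hwv_neq0) orbF => /eqP.
Qed.

Let allA a : exists c : A,
  lspan (fun y => exists j, y = id j) c /\ annihilator phi (a - c).
Proof.
exists a; split; first by apply: lspan_gen; exists a.
by rewrite subrr; apply: annihilator0.
Qed.

Lemma hw_weights x : lspan (fun y => exists nu, wt nu y) x.
Proof.
apply: lspan_mono (Fword_span allA x) => y [w ->].
by exists (La - rootsum (map fst w)); apply: Fword_wt.
Qed.

Lemma hw_support mu x : wt mu x -> x != 0 -> exists s, mu = La - rootsum s.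
Proof.
move=> wx x0; apply: contrapT => ne; case/negP: x0; apply/eqP.
elim: (Fword_wt_span allA wx) => [//|a y z [[w ->] wy] _ ->].
rewrite addr0; have [->|/eqP y0] := eqVneq (Fword id w) 0; first by rewrite scaler0.
case: ne; exists (map fst w); apply: wt_uniq wy (Fword_wt id w) _; exact/eqP.
Qed.

Lemma rootsum_size mu : exists k, forall s, mu = La - rootsum s -> size s = k.
Proof.
have [[s es]|ne] := pselect (exists s, mu = La - rootsum s); last first.
  by exists 0%N => s es; case: ne; exists s.
exists (size s) => t et; apply/perm_size/rootsum_inj/oppr_inj/(addrI La).
by rewrite -es -et.
Qed.

(** With coefficients from a finite list, there are finitely many words in the
    lowering operators of the length that the weight prescribes. *)
Lemma hw_finite (bs : seq A) mu :
  (forall a, exists c, lspan (fun y => y \in bs) c /\ annihilator phi (a - c)) ->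
  exists d, hasdim (wt mu) d.
Proof.
move=> fin; have [k ek] := rootsum_size mu.
pose b (j : 'I_(size bs)) := bs`_j.
have spans a : exists c, lspan (fun y => exists j, y = b j) c /\ annihilator phi (a - c).
  have [c [lc ac]] := fin a; exists c; split=> //.
  apply: lspan_mono lc => y yb; have iy : (index y bs < size bs)%N by rewrite index_mem.
  by exists (Ordinal iy); rewrite /b nth_index.
pose s := [seq y <- [seq Fword b (val t) | t <- enum {: k.-tuple ('I_N * 'I_(size bs))}]
  | `[< wt mu y >]].
apply: (hasdim_span (s := s)) => [x|x wx].
  by rewrite mem_filter => /andP[/asboolP].
elim: (Fword_wt_span spans wx) => [|a y z [[w ->] wy] _ lz]; first exact: lspan0.
have [->|y0] := eqVneq (Fword b w) 0; first by rewrite scaler0 add0r.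
apply: lspan_cons lz; rewrite mem_filter; apply/andP; split; first exact/asboolP.
have sw : size w == k.
  by rewrite -(size_map fst); apply/eqP/ek/(wt_uniq wy (Fword_wt b w) y0).
by apply/mapP; exists (Tuple sw); rewrite // mem_enum.
Qed.

End Weights.
End Characters.

(** * The character of a tensor product *)

Section TensorCharacter.
Variables (K : numFieldType) (A : comAlgType K) (N : nat) (hh : vectType K).
Variables (alpha : 'I_N -> 'Hom(hh, K^o)) (cm : 'I_N -> 'I_N -> K).
Local Notation weight := 'Hom(hh, K^o).
Hypothesis alpha_free : free (codom alpha).
Variables (phi1 phi2 : 'I_N -> A -> K) (La1 La2 : weight).
Variables (M1 : hwmod alpha cm phi1 La1) (M2 : hwmod alpha cm phi2 La2).
Hypothesis co : comaximal (annihilator phi1) (annihilator phi2).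
Local Notation M12 := (tensor M1 M2 co).
Local Notation wt1 := (wt_space (hwD M1)).
Local Notation wt2 := (wt_space (hwD M2)).
Local Notation wt12 := (wt_space (hwD M12)).

Lemma pure_wt mu nu x y : wt1 mu x -> wt2 nu y -> wt12 (mu + nu) (pureT x y).
Proof.
move=> wx wy d; rewrite [LHS]tD_pure wx wy pureZl pureZr -scalerDl.
by rewrite add_lfunE.
Qed.

Lemma pure_span (P1 : M1 -> Prop) (P2 : M2 -> Prop) x y :
  lspan P1 x -> lspan P2 y ->
  lspan (fun w => exists u z, [/\ P1 u, P2 z & w = pureT u z]) (pureT x y).
Proof.
move=> lx; elim: lx y => [|a u x' Pu _ IH] y ly; first by rewrite pure0l; apply: lspan0.
rewrite pureDl; apply: lspanZD; last exact: IH.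
elim: ly => [|b z y' Pz _ IHy]; first by rewrite pure0r; apply: lspan0.
by rewrite pureDr; apply: lspan_cons IHy; exists u, z.
Qed.

Lemma hasdim_neq0 (V : lmodType K) (S : V -> Prop) d x :
  hasdim S d -> S x -> x != 0 -> d != 0%N.
Proof.
move=> [b [_ _ bs]] Sx; apply: contraNneq => d0; move: b bs; rewrite {}d0 => b bs.
by have [c ->] := bs x Sx; rewrite big_ord0.
Qed.

Variables (d1 d2 : weight -> nat).
Hypothesis dim1 : forall mu, hasdim (wt1 mu) (d1 mu).
Hypothesis dim2 : forall mu, hasdim (wt2 mu) (d2 mu).

Lemma hasdim_support (phi : 'I_N -> A -> K) La (M : hwmod alpha cm phi La) mu d :
  hasdim (wt_space (hwD M) mu) d -> d != 0%N -> exists s, mu = La - rootsum alpha s.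
Proof.
case: d => // d [b [wb bf _]] _; apply: hw_support (wb ord0) _.
apply/eqP => b0; suff /bf /(_ ord0) /eqP : \sum_(i < d.+1) ((i == ord0)%:R : K) *: b i = 0.
  by rewrite eqxx oner_eq0.
rewrite (bigD1 ord0) //= b0 scaler0 add0r big1 // => j /negPf ->.
by rewrite scale0r.
Qed.

(** Finitely many weights contribute to a coefficient of the product: each lies
    below [La1] at a depth bounded by that of [mu] below [La1 + La2]. *)
Lemma char_support (mu : weight) : exists s : seq weight, uniq s /\
  forall nu, (d1 nu * d2 (mu - nu)%R)%N != 0%N -> nu \in s.
Proof.
have [k ek] := rootsum_size alpha_free (La1 + La2) mu.
exists (undup [seq La1 - rootsum alpha (val t) | t <- enum {: k.-bseq 'I_N}]).
split=> [|nu]; first exact: undup_uniq.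
rewrite muln_eq0 negb_or => /andP[n1 n2]; rewrite mem_undup.
have [s1 e1] := hasdim_support (dim1 nu) n1.
have [s2 e2] := hasdim_support (dim2 _) n2.
have sk : (size s1 <= k)%N.
  rewrite -(ek (s1 ++ s2)) ?size_cat ?leq_addr // /rootsum big_cat /=.
  by rewrite opprD addrACA -/(rootsum alpha s1) -e1 -/(rootsum alpha s2) -e2 addrC subrK.
by apply/mapP; exists (Bseq sk); rewrite ?mem_enum.
Qed.

(** The tensor products of the vectors of weight bases form a weight basis. *)
Theorem tensor_hasdim mu : hasdim (wt12 mu)
  (\big[addn/0]_(nu \in [set: weight]%classic) (d1 nu * d2 (mu - nu)%R))%N.
Proof.
have [s [us sP]] := char_support mu.
pose b1 nu := projT1 (cid (dim1 nu)); pose b2 nu := projT1 (cid (dim2 nu)).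
have bas1 nu : is_basis (wt1 nu) (b1 nu) := projT2 (cid (dim1 nu)).
have bas2 nu : is_basis (wt2 nu) (b2 nu) := projT2 (cid (dim2 nu)).
pose sn (k : 'I_(size s)) := s`_k.
pose JT k := ('I_(d1 (sn k)) * 'I_(d2 (mu - sn k)))%type.
pose J := {k : 'I_(size s) & JT k}.
have -> : (\big[addn/0]_(nu \in [set: weight]%classic) (d1 nu * d2 (mu - nu)%R))%N
    = #|{: J}|.
  rewrite card_tagged sumnE big_map big_enum /=.
  rewrite -(fsbig_widen [set` s] setT) //; last first.
    move=> nu [_ /= ns]; apply/eqP; apply: contrapT => /negP n0.
    exact: ns (sP _ n0).
  rewrite -fsbig_seq // (big_nth 0) big_mkord; apply: eq_bigr => k _.
  by rewrite card_prod !card_ord.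
(* the basis vectors of weight [nu] and [mu - nu], for the finitely many relevant
   [nu] *)
pose b (j : J) : M12 := pureT (b1 _ (tagged j).1) (b2 _ (tagged j).2).
apply: (basis_hasdim (b := b)); split=> [[k [j1 j2]]|c c0|w ww].
- have [[w1 _ _] [w2 _ _]] := (bas1 (sn k), bas2 (mu - sn k)).
  by have := pure_wt (w1 j1) (w2 j2); rewrite (addrC (sn k)) subrK.
- suff all0 k j1 j2 : c (existT JT k (j1, j2)) = 0.
    move=> [k [j1 j2]]; exact (all0 k j1 j2).
  have sinj : injective sn.
    move=> p q; rewrite /sn => /eqP; rewrite nth_uniq // => /eqP; exact: val_inj.
  pose cc k p := c (existT JT k p).
  (* contract the relation with a form on the second factor *)
  have y0 (l2 : {linear M2 -> K^o}) : \sum_k \sum_(i1 < d1 (sn k))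
     (\sum_(i2 < d2 (mu - sn k)) cc k (i1, i2) * l2 (b2 _ i2)) *: b1 _ i1 = 0.
    apply: hw_forms => l1.
    transitivity (\sum_j evalT (l1, l2) (c j *: b j));
      last by rewrite -linear_sum c0 linear0.
    rewrite linear_sum (eq_bigr (fun k => \sum_p cc k p * (l1 (b1 _ p.1) * l2 (b2 _ p.2)))).
      rewrite (sig_big_dep (fun=> true) (fun _ _ => true)
        (fun k (p : JT k) => cc k p * (l1 (b1 _ p.1) * l2 (b2 _ p.2)))) /=.
      by apply: eq_bigr => -[k' p] _.
    move=> k' _; rewrite linear_sum.
    transitivity (\sum_i1 \sum_i2 cc k' (i1, i2) * (l1 (b1 _ i1) * l2 (b2 _ i2)));
      last by rewrite pair_bigA; apply: eq_bigr => -[].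
    apply: eq_bigr => i1 _; rewrite linearZ [LHS]mulr_suml.
    by apply: eq_bigr => i2 _; rewrite -mulrA (mulrC (l2 _)).
  have z0 (l2 : {linear M2 -> K^o}) : \sum_(i2 < d2 (mu - sn k)) cc k (j1, i2) * l2 (b2 _ i2) = 0.
    have [_ f1 _] := bas1 (sn k).
    apply: (f1 (fun i1 => \sum_(i2 < d2 (mu - sn k)) cc k (i1, i2) * l2 (b2 _ i2))).
    apply: (wt_direct (D := hwD M1) (nu := sn) _ _ (y0 l2)) => // q.
    by apply: wt_sum => p; case: (bas1 (sn q)).
  have [_ f2 _] := bas2 (mu - sn k); apply: (f2 (fun i2 => cc k (j1, i2))).
  apply: hw_forms => l2; rewrite -[RHS](z0 l2) linear_sum.
  by apply: eq_bigr => i _; rewrite linearZ.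
- apply: lspan_range.
  have lw : lspan (fun w : M12 => exists u z, [/\ exists nu, wt1 nu u,
      exists nu, wt2 nu z & w = pureT u z]) w.
    apply: lspan_idem; apply: lspan_mono (tensor_span w) => _ [x [y ->]].
    by apply: pure_span; apply: hw_weights.
  have {}lw := wt_proj (D := hwD M12) _ lw ww.
  apply: lspan_idem; apply: lspan_mono (lw _) => [_ [[u [z [[nu wu] [ka wz] ->]]] wuz]|];
    last by move=> _ [u [z [[nu wu] [ka wz] ->]]]; exists (nu + ka); apply: pure_wt.
  have [->|p0] := eqVneq (pureT u z : M12) 0; first exact: lspan0.
  have emu := wt_uniq (pure_wt wu wz) wuz p0.
  have u0 : u != 0 by apply: contraNneq p0 => ->; rewrite pure0l.
  have z0 : z != 0 by apply: contraNneq p0 => ->; rewrite pure0r.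
  have eka : ka = mu - nu by rewrite -emu addrC addKr.
  rewrite {}eka in wz.
  have ns : nu \in s.
    apply: sP; rewrite muln_eq0 negb_or.
    by rewrite (hasdim_neq0 (dim1 _) wu u0) (hasdim_neq0 (dim2 _) wz z0).
  have ins : (index nu s < size s)%N by rewrite index_mem.
  pose k : 'I_(size s) := Ordinal ins.
  have enu : nu = sn k by rewrite /sn nth_index.
  rewrite enu in wu wz.
  have lu : lspan (fun x => exists i, x = b1 (sn k) i) u.
    have [_ _ /(_ u wu) [c ->]] := bas1 (sn k); apply: lspan_sum => i; by exists i.
  have lz : lspan (fun x => exists i, x = b2 (mu - sn k) i) z.
    have [_ _ /(_ z wz) [c ->]] := bas2 (mu - sn k); apply: lspan_sum => i; by exists i.
  apply: lspan_mono (pure_span lu lz) => _ [_ [_ [[i ->] [j ->] ->]]].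
  by exists (existT JT k (i, j)).
Qed.
End TensorCharacter.

(** * Iterated tensor products *)

Section Iteration.
Variables (K : numFieldType) (A : comAlgType K) (N : nat) (hh : vectType K).
Variables (alpha : 'I_N -> 'Hom(hh, K^o)) (cm : 'I_N -> 'I_N -> K).
Local Notation weight := 'Hom(hh, K^o).
Local Notation hwmod := (@hwmod K A N hh alpha cm).

Section TrivialModule.
Let Z : {linear K^o -> K^o} := \0.
Let I : {linear K^o -> K^o} := idfun.

Let Zlin (i : 'I_N) k (a b : A) (x : K^o) : Z x = k *: Z x + Z x.
Proof. by rewrite scaler0 addr0. Qed.
Let ZEF (i j : 'I_N) (a b : A) x : Z (Z x) = Z (Z x) + (if i == j then Z x else 0).
Proof. by rewrite if_same addr0. Qed.
Let ZHF (i j : 'I_N) (a b : A) x : Z (Z x) = Z (Z x) - cm i j *: Z x.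
Proof. by rewrite scaler0 subr0. Qed.
Let ZDF (d : hh) (j : 'I_N) (b : A) x : Z (Z x) = Z (Z x) - (alpha j d : K) *: Z x.
Proof. by rewrite scaler0 subr0. Qed.
Let ZHv (i : 'I_N) (a : A) : Z 1 = 0 *: 1.
Proof. by rewrite scale0r. Qed.
Let ZDv d : Z 1 = ((0 : weight) d : K) *: 1.
Proof. by rewrite zero_lfunE scale0r. Qed.
Let ZF (i : 'I_N) (a : A) x : I (Z x) = 0.
Proof. by []. Qed.
Let Zgen x : fspan (fun (i : 'I_N) (a : A) => Z) (eq 1) x.
Proof.
rewrite -[x]addr0 -[x]mulr1; apply: fspan_lin; last exact: fspan0.
exact: fspan_base.
Qed.
Let Zsing x : ('I_N -> A -> Z x = 0) -> x = (I x : K) *: 1.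
Proof. by move=> _; rewrite /= [RHS]mulr1. Qed.

Definition trivial_hwmod : hwmod (fun _ _ => 0) 0 :=
  @HWMod K A N hh alpha cm (fun _ _ => 0) 0 K^o (fun _ _ => Z) (fun _ _ => Z) (fun _ _ => Z)
    (fun _ => Z) 1 I Zlin Zlin ZEF ZHF ZDF (fun _ _ => erefl) ZHv ZDv erefl ZF Zgen Zsing.

Lemma trivial_hasdim mu : hasdim (wt_space (hwD trivial_hwmod) mu) (mu == 0).
Proof.
have [->|mu0] := eqVneq mu 0.
  exists (fun=> 1); split=> [i d|c|x _].
  - by rewrite /= zero_lfunE scale0r.
  - by rewrite big_ord1 /= [_ *: _]mulr1 => c0 i; rewrite ord1.
  - by exists (fun=> x); rewrite big_ord1 [RHS]mulr1.
exists (fun=> 0); split=> [[]//|_ _ []//|x wx].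
exists (fun=> 0); rewrite big_ord0; apply/eqP.
apply: contrapT => /negP x0; case/eqP: mu0; apply/lfunP => d.
have /esym/eqP := wx d; rewrite scaler_eq0 (negPf x0) orbF => /eqP.
by rewrite zero_lfunE.
Qed.

End TrivialModule.

Section Twist.
Variables (phi : 'I_N -> A -> K) (La : weight) (M : hwmod phi La).
Variables (tau sigma : A -> A).
Hypothesis tau_lin : linear tau.
Hypothesis tau_mul : {morph tau : a b / a * b}.
Hypothesis tauK : cancel sigma tau.

Let wE i a := hwE M i (tau a).
Let wF i a := hwF M i (tau a).
Let wH i a := hwH M i (tau a).

Let wElin i k a b x : wE i (k *: a + b) x = k *: wE i a x + wE i b x.
Proof. by rewrite /wE tau_lin hwElin. Qed.
Let wFlin i k a b x : wF i (k *: a + b) x = k *: wF i a x + wF i b x.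
Proof. by rewrite /wF tau_lin hwFlin. Qed.
Let wEF i j a b x : wE i a (wF j b x) =
  wF j b (wE i a x) + (if i == j then wH i (a * b) x else 0).
Proof. by rewrite /wE /wF /wH tau_mul hwEF. Qed.
Let wHF i j a b x : wH i a (wF j b x) = wF j b (wH i a x) - cm i j *: wF j (a * b) x.
Proof. by rewrite /wF /wH tau_mul hwHF. Qed.
Let wDF d j b x : hwD M d (wF j b x) = wF j b (hwD M d x) - (alpha j d : K) *: wF j b x.
Proof. exact: hwDF. Qed.
Let wgen x : fspan wF (eq (hwv M)) x.
Proof.
elim: (hwgen x) => {x} [x vx||k x y _ IHx _ IHy|i a x _ IH].
- exact: fspan_base.
- exact: fspan0.
- exact: fspan_lin.
- by rewrite -(tauK a); apply: (fspan_F (F := wF)).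
Qed.
Let wsing x : (forall i a, wE i a x = 0) -> x = (hweps M x : K) *: hwv M.
Proof.
by move=> x0; apply: hwsing => i a; rewrite -(tauK a); apply: x0.
Qed.

(** The pull-back along an automorphism of [A]; the action of the Cartan
    subalgebra, hence the character, does not change. *)
Definition twist : hwmod (fun i a => phi i (tau a)) La :=
  HWMod wElin wFlin wEF wHF wDF (fun i a => hwEv M i (tau a))
    (fun i a => hwHv M i (tau a)) (hwDv M) (hwepsv M)
    (fun i a x => hwepsF i (tau a) x) wgen wsing.

End Twist.

Hypothesis alpha_free : free (codom alpha).

Section Comaximal.
Implicit Types P Q : A -> Prop.

Definition ideal P := (forall a b, P a -> P b -> P (a + b)) /\ forall a b, P a -> P (b * a).

Lemma comaximal_sym P Q : comaximal P Q -> comaximal Q P.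
Proof. by case=> e [e1 e2]; exists (1 - e); rewrite opprB addrC subrK. Qed.

Lemma comaximal_sub P P' Q Q' : (forall a, P a -> P' a) -> (forall a, Q a -> Q' a) ->
  comaximal P Q -> comaximal P' Q'.
Proof. by move=> PP' QQ' [e [/PP' e1 /QQ' e2]]; exists e. Qed.

Lemma comaximal_setT P : P 0 -> comaximal P (fun=> True).
Proof. by exists 1; rewrite subrr. Qed.

(** The product of witnesses is a witness. *)
Lemma comaximalI P Q Q' : ideal P -> ideal Q -> ideal Q' ->
  comaximal P Q -> comaximal P Q' -> comaximal P (fun a => Q a /\ Q' a).
Proof.
move=> [PD PM] [_ QM] [_ QM'] [e [Pe Qe]] [e' [Pe' Qe']]; exists (e * e').
split; last by split; [rewrite mulrC; apply: QM|apply: QM'].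
have -> : 1 - e * e' = e * (1 - e') + (1 - e).
  by rewrite mulrBr mulr1 [RHS]addrC addrA subrK.
by apply: PD => //; apply: PM.
Qed.

Lemma comaximal_all (J : finType) (Q : J -> A -> Prop) P :
  ideal P -> P 0 -> (forall j, ideal (Q j)) -> (forall j, comaximal P (Q j)) ->
  comaximal P (fun a => forall j, Q j a).
Proof.
move=> iP P0 iQ cQ.
suff: comaximal P (fun a => forall j, j \in enum J -> Q j a).
  by apply: comaximal_sub => // a Qa j; apply: Qa; rewrite mem_enum.
elim: (enum J) => [|j s IH]; first exact: comaximal_sub (comaximal_setT P0).
have iI : ideal (fun a => forall j, j \in s -> Q j a).
  by split=> [a b Pa Pb|a b Pa] k ks; case: (iQ k) => QD QM;
    [apply: QD; [apply: Pa|apply: Pb]|apply: QM; apply: Pa].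
apply: comaximal_sub (comaximalI iP (iQ j) iI (cQ j) IH) => // a [Qa Ia] k.
by rewrite inE => /predU1P[->|/Ia].
Qed.

Lemma comaximal_all2 (I J : finType) (P : I -> A -> Prop) (Q : J -> A -> Prop) :
  (forall i, ideal (P i)) -> (forall i, P i 0) ->
  (forall j, ideal (Q j)) -> (forall j, Q j 0) ->
  (forall i j, comaximal (P i) (Q j)) ->
  comaximal (fun a => forall i, P i a) (fun a => forall j, Q j a).
Proof.
move=> iP P0 iQ Q0 PQ.
have iPI : ideal (fun a => forall i, P i a).
  by split=> [a b Pa Pb|a b Pa] i; case: (iP i) => PD PM; [apply: PD|apply: PM].
apply: comaximal_all => // j; apply: comaximal_sym.
by apply: comaximal_all => // i; apply: comaximal_sym.
Qed.

End Comaximal.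
(** The product of formal characters. *)
Definition gchar_mul (d1 d2 : weight -> nat) (mu : weight) : nat :=
  (\big[addn/0]_(nu \in [set: weight]%classic) (d1 nu * d2 (mu - nu)%R))%N.

Lemma annihilator_ideal (phi : 'I_N -> A -> K) : (forall i, {morph phi i : a b / a + b}) ->
  ideal (annihilator phi).
Proof.
move=> phiD; split=> [a b Pa Pb|a b Pa] i c; first by rewrite mulrDl phiD Pa Pb addr0.
by rewrite mulrAC mulrC Pa.
Qed.

(** The tensor product of the first factors has a highest weight that vanishes on
    the intersection of their annihilators, and this intersection is still
    comaximal with the annihilator of the next factor. *)
Lemma iterate_tensor (G : eqType) (phi : G -> 'I_N -> A -> K) (La : weight)
    (M : forall k, hwmod (phi k) La) (d : weight -> nat) :
  (forall k i, {morph phi k i : a b / a + b}) ->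
  (forall k mu, hasdim (wt_space (hwD (M k)) mu) (d mu)) ->
  (forall k l, k != l -> comaximal (annihilator (phi k)) (annihilator (phi l))) ->
  forall s : seq G, uniq s ->
  exists Ms : hwmod (fun i a => \sum_(k <- s) phi k i a) (La *+ size s),
    forall mu, hasdim (wt_space (hwD Ms) mu)
      (iter (size s) (gchar_mul d) (fun mu => mu == 0 : nat) mu).
Proof.
move=> phiD dimM co; elim=> [|k s IH] /=.
  move=> _; rewrite (_ : (fun i a => _) = (fun _ _ => 0)).
    by exists trivial_hwmod; apply: trivial_hasdim.
  by apply/funext => i; apply/funext => a; rewrite big_nil.
case/andP=> ks /IH [Ms dimMs].
have cos : comaximal (annihilator (phi k)) (annihilator (fun i a => \sum_(k <- s) phi k i a)).
  elim: s ks {IH Ms dimMs} => [_|l s IH].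
    apply: comaximal_sub (comaximal_setT (annihilator0 (M k))) => // a _ i b.
    by rewrite big_nil.
  rewrite inE negb_or => /andP[kl ks].
  have iS : ideal (annihilator (fun i a => \sum_(k <- s) phi k i a)).
    apply: annihilator_ideal => i a b; rewrite -big_split.
    by apply: eq_bigr => j _; apply: phiD.
  apply: comaximal_sub (comaximalI (annihilator_ideal (phiD k))
    (annihilator_ideal (phiD l)) iS (co k l kl) (IH ks)) => // a [al as_] i b.
  by rewrite big_cons al as_ addr0.
rewrite (_ : (fun i a => _) = (fun i a => phi k i a + \sum_(k <- s) phi k i a)); last first.
  by apply/funext => i; apply/funext => a; rewrite big_cons.
rewrite mulrS; exists (tensor (M k) Ms cos) => mu.
exact: tensor_hasdim.
Qed.

End Iteration.

(** * Irreducible modules without the enveloping algebra *)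

Section Irreducible.
Variables (K : numFieldType) (A : comAlgType K) (N : nat) (hh : vectType K).
Variables (alpha : 'I_N -> 'Hom(hh, K^o)) (cm : 'I_N -> 'I_N -> K).
Local Notation weight := 'Hom(hh, K^o).
Hypothesis alpha_free : free (codom alpha).
Variables (phi : 'I_N -> A -> K) (La : weight) (V : lmodType K).
Variables (E F H : 'I_N -> A -> {linear V -> V}) (D : hh -> {linear V -> V}) (v : V).
Hypothesis Elin : forall i k a b x, E i (k *: a + b) x = k *: E i a x + E i b x.
Hypothesis Flin : forall i k a b x, F i (k *: a + b) x = k *: F i a x + F i b x.
Hypothesis EF : forall i j a b x, E i a (F j b x) =
  F j b (E i a x) + (if i == j then H i (a * b) x else 0).
Hypothesis HF : forall i j a b x, H i a (F j b x) =
  F j b (H i a x) - cm i j *: F j (a * b) x.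
Hypothesis DF : forall d j b x, D d (F j b x) =
  F j b (D d x) - (alpha j d : K) *: F j b x.
Hypothesis HE : forall i j a b x, H i a (E j b x) =
  E j b (H i a x) + cm i j *: E j (a * b) x.
Hypothesis DE : forall d j b x, D d (E j b x) =
  E j b (D d x) + (alpha j d : K) *: E j b x.
Hypothesis Ev : forall i a, E i a v = 0.
Hypothesis Hv : forall i a, H i a v = phi i a *: v.
Hypothesis Dv : forall d, D d v = (La d : K) *: v.
Hypothesis v_neq0 : v != 0.
Hypothesis irr : forall S : V -> Prop, submodule S ->
  (forall i a x, S x -> S (E i a x)) -> (forall i a x, S x -> S (F i a x)) ->
  (forall d x, S x -> S (D d x)) -> (forall x, S x -> x = 0) \/ (forall x, S x).

Section FSpanClosed.
Variable P : V -> Prop.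
Local Notation FP := (fspan F P).

Lemma fspanZ k x : FP x -> FP (k *: x).
Proof. by move=> fx; rewrite -[_ *: _]addr0; apply: fspan_lin fx (fspan0 _ _). Qed.
Lemma fspanD x y : FP x -> FP y -> FP (x + y).
Proof. by rewrite -{2}[x]scale1r; apply: fspan_lin. Qed.
Lemma fspanB x y : FP x -> FP y -> FP (x - y).
Proof. by move=> fx fy; rewrite -scaleN1r; apply: fspanD => //; apply: fspanZ. Qed.

Hypothesis PE : forall i a x, P x -> FP (E i a x).
Hypothesis PH : forall i a x, P x -> FP (H i a x).
Hypothesis PD : forall d x, P x -> FP (D d x).

(** What is generated from [P] by lowering operators alone is stable under all
    operators as soon as these map [P] into it. *)
Lemma fspan_H i a x : FP x -> FP (H i a x).
Proof.
move=> fx; elim: fx i a => {x} [x Px||k x y _ IHx _ IHy|j b x fx IH] i a.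
- exact: PH.
- by rewrite linear0; apply: fspan0.
- by rewrite linearP; apply: fspan_lin.
- by rewrite HF; apply: fspanB; [|apply: fspanZ]; apply: (fspan_F (F := F)).
Qed.

Lemma fspan_E i a x : FP x -> FP (E i a x).
Proof.
move=> fx; elim: fx i a => {x} [x Px||k x y _ IHx _ IHy|j b x fx IH] i a.
- exact: PE.
- by rewrite linear0; apply: fspan0.
- by rewrite linearP; apply: fspan_lin.
- rewrite EF; apply: fspanD; first exact: (fspan_F (F := F)).
  by case: eqP => _; [apply: fspan_H|apply: fspan0].
Qed.

Lemma fspan_D d x : FP x -> FP (D d x).
Proof.
move=> fx; elim: fx d => {x} [x Px||k x y _ IHx _ IHy|j b x fx IH] d.
- exact: PD.
- by rewrite linear0; apply: fspan0.
- by rewrite linearP; apply: fspan_lin.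
- by rewrite DF; apply: fspanB; [|apply: fspanZ]; apply: (fspan_F (F := F)).
Qed.

Lemma fspan_irr : (forall x, FP x -> x = 0) \/ (forall x, FP x).
Proof.
apply: irr => [|i a x|i a x|d x].
- by split=> [|k x y]; [exact: fspan0|exact: fspan_lin].
- exact: fspan_E.
- exact: (fspan_F (F := F)).
- exact: fspan_D.
Qed.

End FSpanClosed.

Lemma irr_gen x : fspan F (eq v) x.
Proof.
have [|||v0|] := @fspan_irr (eq v) => [i a _ <-|i a _ <-|d _ <-||//].
- by rewrite Ev; apply: fspan0.
- by rewrite Hv; apply: fspanZ; apply: fspan_base.
- by rewrite Dv; apply: fspanZ; apply: fspan_base.
- by move: v_neq0; rewrite (v0 v) ?eqxx //; apply: fspan_base.
Qed.

(** The complement of the highest weight line: the sum of the other weight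
    spaces. *)
Definition lowered := lspan (fun x => exists i a y, x = F i a y).

Lemma loweredF i a x : lowered (F i a x).
Proof. by apply: lspan_gen; exists i, a, x. Qed.

Lemma irr_weights x : lspan (fun y => exists s, wt_space D (La - rootsum alpha s) y) x.
Proof.
elim: (irr_gen x) => {x} [_ <-||k x y _ IHx _ IHy|i a x _ IH].
- by apply: lspan_gen; exists nil => d; rewrite Dv /rootsum big_nil subr0.
- exact: lspan0.
- exact: lspanZD.
elim: IH => [|k y z [s wy] _ IH]; first by rewrite linear0; apply: lspan0.
rewrite linearP; apply: lspan_cons IH; exists (i :: s) => d.
rewrite DF wy linearZ -scalerBl /rootsum big_cons -/(rootsum alpha s).
by rewrite opprD addrCA !add_lfunE !opp_lfunE /= addrC.
Qed.

Lemma lowered_weights x : lowered x ->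
  lspan (fun y => exists i s, wt_space D (La - rootsum alpha (i :: s)) y) x.
Proof.
apply: lspan_sub => [_ [i [a [y ->]]]|*|*]; [|exact: lspan0|exact: lspanZD].
elim: (irr_weights y) => [|k {}y z [s wy] _ IH]; first by rewrite linear0; apply: lspan0.
rewrite linearP; apply: lspan_cons IH; exists i, s => d.
rewrite DF wy linearZ -scalerBl /rootsum big_cons -/(rootsum alpha s).
by rewrite opprD addrCA !add_lfunE !opp_lfunE /= addrC.
Qed.

(** The weights of lowered vectors differ from [La] by a nonempty sum of simple
    roots, which is not zero. *)
Lemma lowered_v k : lowered (k *: v) -> k = 0.
Proof.
move=> lv; apply/eqP; have [//|k0] := eqVneq k 0.
have wv : wt_space D La v by [].
have {}lv : lowered v.
  by have := lspanZ k^-1 lv; rewrite scalerA mulVf // scale1r.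
case/eqP: v_neq0; have {}lv := lowered_weights lv.
have /wt_proj/(_ lv wv) {}lv : forall y, (exists i s,
    wt_space D (La - rootsum alpha (i :: s)) y) -> exists nu, wt_space D nu y.
  by move=> y [i [s wy]]; exists (La - rootsum alpha (i :: s)).
apply: (lspan_sub (P := fun x => x = 0)) lv => //.
- move=> y [[i [s wy]] wLa]; apply/eqP; apply: contrapT => /negP y0.
  have := wt_uniq wLa wy y0 => /eqP; rewrite -subr_eq0 opprB addrCA subrr addr0.
  have -> : 0 = rootsum alpha [::] by rewrite /rootsum big_nil.
  by move=> /eqP /(rootsum_inj alpha_free) /perm_size.
- by move=> a x y -> ->; rewrite scaler0 addr0.
Qed.

Lemma eps_exists x : exists k, lowered (x - k *: v).
Proof.
elim: (irr_gen x) => {x} [_ <-||k x y _ [kx lx] _ [ky ly]|i a x _ _].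
- by exists 1; rewrite scale1r subrr; apply: lspan0.
- by exists 0; rewrite scale0r subrr; apply: lspan0.
- exists (k * kx + ky); rewrite scalerDl opprD addrACA -scalerA -scalerBr.
  exact: lspanZD.
- by exists 0; rewrite scale0r subr0; apply: loweredF.
Qed.

Definition irr_eps_fun (x : V) : K^o := projT1 (cid (eps_exists x)).

Lemma irr_epsP x k : lowered (x - k *: v) -> irr_eps_fun x = k.
Proof.
move=> lk; apply/eqP; rewrite -subr_eq0; apply/eqP/lowered_v.
have := lspanB lk (projT2 (cid (eps_exists x))).
by rewrite opprB addrC addrA subrK -scalerBl.
Qed.

Lemma irr_epsK x : lowered (x - (irr_eps_fun x : K) *: v).
Proof. exact: projT2 (cid (eps_exists x)). Qed.

Fact irr_eps_linear : linear irr_eps_fun.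
Proof.
move=> k x y; apply: irr_epsP.
rewrite scalerDl opprD addrACA -scalerA -scalerBr.
by apply: lspanZD; apply: irr_epsK.
Qed.
HB.instance Definition _ := GRing.isLinear.Build K V K^o _ irr_eps_fun irr_eps_linear.
Definition irr_eps : {linear V -> K^o} := irr_eps_fun.

Lemma irr_epsv : irr_eps v = 1.
Proof. by apply: irr_epsP; rewrite scale1r subrr; apply: lspan0. Qed.
Lemma irr_epsF i a x : irr_eps (F i a x) = 0.
Proof. by apply: irr_epsP; rewrite scale0r subr0; apply: loweredF. Qed.

Lemma lowered_stable (G : {linear V -> V}) : (forall i a y, lowered (G (F i a y))) ->
  forall x, lowered x -> lowered (G x).
Proof.
move=> GF x; elim=> [|k _ z [i [a [y ->]]] _ IH]; first by rewrite linear0; apply: lspan0.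
by rewrite linearP; exact: lspanZD (GF i a y) IH.
Qed.

(** The singular vectors without highest weight component are stable under the
    coroots and the Cartan subalgebra, so they generate by lowering a submodule
    that avoids the highest weight line; it vanishes by irreducibility. *)
Lemma irr_sing x : (forall i a, E i a x = 0) -> x = (irr_eps x : K) *: v.
Proof.
pose P y := lowered y /\ forall i a, E i a y = 0.
have PH i a y : P y -> P (H i a y).
  move=> [ly Ey]; split=> [|j b].
    apply: lowered_stable ly => j b z; rewrite HF.
    by apply: lspanB; [|apply: lspanZ]; apply: loweredF.
  by have := HE i j a b y; rewrite !Ey scaler0 addr0 linear0 => <-.
have PD d y : P y -> P (D d y).
  move=> [ly Ey]; split=> [|j b].
    apply: lowered_stable ly => j b z; rewrite DF.
    by apply: lspanB; [|apply: lspanZ]; apply: loweredF.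
  by have := DE d j b y; rewrite !Ey scaler0 addr0 linear0 => <-.
have [|||P0|Pall] := @fspan_irr P => [i a y [_ Ey]|i a y Py|d y Py|Ex|].
- by rewrite Ey; apply: fspan0.
- by apply/fspan_base/PH.
- by apply/fspan_base/PD.
- apply/eqP; rewrite -subr_eq0; apply/eqP/P0/fspan_base; split; first exact: irr_epsK.
  by move=> i a; rewrite linearB linearZ /= Ex Ev scaler0 subrr.
suff lv : lowered (1 *: v) by have /eqP := lowered_v lv; rewrite oner_eq0.
rewrite scale1r; elim: (Pall v) => {x} [y [] //||k y z _ ly _ lz|i a y _ _].
- exact: lspan0.
- exact: lspanZD.
- exact: loweredF.
Qed.

Definition irr_hwmod : hwmod alpha cm phi La :=
  HWMod Elin Flin EF HF DF Ev Hv Dv irr_epsv irr_epsF irr_gen irr_sing.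

End Irreducible.

(** * Generation of the enveloping algebra *)

Lemma mul5A (R : pzRingType) (a u t w b : R) : a * (u * t * w) * b = a * u * t * (w * b).
Proof. by rewrite !mulrA. Qed.
Lemma mulB2 (R : pzRingType) (a a' b b' : R) :
  a' * b' - a * b = a' * (b' - b) * 1 + 1 * (a' - a) * b.
Proof. by rewrite mulr1 mul1r mulrBr mulrBl addrA subrK. Qed.

Lemma malg_scaleU (R : fieldType) (T : choiceType) (c : R) (m : T) :
  << c *g m >> = c *: << m >> :> {malg R[T]}.
Proof. by apply/malgP => k; rewrite mcoeffZ !mcoeffU mulr_natr. Qed.

Section EnvelopingAlgebra.
Variables (K : fieldType) (L : lieAlgType K).
Local Notation free_alg := {malg K[word L]}.
Local Notation pr := (@lproj K free_alg (@env_rel K L)).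

Let malg_scaleAr (c : K) (f g : free_alg) : c *: (f * g) = f * (c *: g).
Proof.
apply/malgP => k; rewrite -!mul_malgC.
have C (h : free_alg) : c%:MP * h = h * c%:MP.
  rewrite !malgM_def fgmulUg fgmulgU; apply: eq_bigr => m _.
  by rewrite mul1m mulm1 mulrC.
by rewrite mulrA C -mulrA.
Qed.

Lemma env_rel_ideal (a b z : free_alg) :
  lspan (@env_rel K L) z -> lspan (@env_rel K L) (a * z * b).
Proof.
elim=> [|c x y [u [w [t [gt ->]]]] _ IH]; first by rewrite mulr0 mul0r; apply: lspan0.
rewrite mulrDr mulrDl -malg_scaleAr -scalerAl; apply: lspan_cons IH.
exists (a * u), (w * b), t; split; first exact: gt.
exact: mul5A.
Qed.

(** Products of representatives represent products since the relations span a
    two-sided ideal. *)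
Lemma env_projM (a b : free_alg) : pr (a * b) = (pr a : env L) * (pr b : env L).
Proof.
apply/esym/lprojP; set a' := lrepr _; set b' := lrepr _.
have -> : a' * b' - a * b = a' * (b' - b) * 1 + 1 * (a' - a) * b.
  exact: mulB2.
by apply: lspanD; apply: env_rel_ideal; apply: lreprP.
Qed.

(** The enveloping algebra is spanned by the products of elements of the Lie
    algebra. *)
Lemma env_ind (P : env L -> Prop) : P 0 -> P 1 ->
  (forall a u w, P u -> P w -> P (a *: u + w)) ->
  (forall x u, P u -> P (env_inj x * u)) -> forall u, P u.
Proof.
move=> P0 P1 PD PM u; rewrite -[u]lreprK; move: (lrepr u) => f {u}.
have Pm (m : word L) : P (pr << m >>).
  case: m => s; elim: s => [|x s IH].
    have -> : << (FMonom [::] : word L) >> = 1 :> free_alg.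
      by rewrite -[FMonom [::]](fmoneE L).
    exact: P1.
  have -> : << (FMonom (x :: s) : word L) >> = free_gen x * << (FMonom s : word L) >> :> free_alg.
    rewrite malgM_def fgmulUU mulr1; congr << _ *g _ >>.
    by rewrite -[RHS]/(fmmul (fmu x) (FMonom s)) fmmulE fmuE.
  rewrite env_projM; exact: PM.
rewrite [f]monalgE; elim: (X in \sum_(_ <- X) _) => [|m s IH].
  by rewrite big_nil linear0.
rewrite big_cons.
rewrite malg_scaleU (@linearP K free_alg (env L) _ pr).
exact: PD (Pm m) IH.
Qed.

End EnvelopingAlgebra.

(** * Generators of the current algebra *)

Section Tensor.
Variables (n : nat) (K : fieldType).
Local Notation A := (laurent n K).

Section Tens.
Variable V : lmodType K.
Let b (x : V) (c : K^o) : V := (c : K) *: x.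
Let bDl a x y z : b (a *: x + y) z = a *: b x z + b y z.
Proof. by rewrite /b scalerDr !scalerA mulrC. Qed.
Let bDr a (x y : K^o) z : b z (a *: x + y) = a *: b z x + b z y.
Proof. by rewrite /b scalerDl scalerA. Qed.

(** [x (x) a]. *)
Definition tens (x : V) (a : A) : loop n V := conv b (tmon x 0) a.

Lemma tens_tmon x (c : K) m : tens x (tmon (c : K^o) m) = tmon (c *: x) m.
Proof. by rewrite /tens (conv_tmon bDl bDr) add0r. Qed.
Lemma tensPr x k a a' : tens x (k *: a + a') = k *: tens x a + tens x a'.
Proof. exact: convDr. Qed.
Lemma tensPl k x y a : tens (k *: x + y) a = k *: tens x a + tens y a.
Proof. by rewrite /tens tmonP (convDl bDl bDr). Qed.
Lemma tensDr x a a' : tens x (a + a') = tens x a + tens x a'.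
Proof. by have := tensPr x 1 a a'; rewrite (scale1r a) (scale1r (tens x a)). Qed.
Lemma tens0l a : tens 0 a = 0.
Proof. by rewrite /tens /tmon monalgU0; apply: conv0l. Qed.
Lemma tensZl k x a : tens (k *: x) a = k *: tens x a.
Proof. by have := tensPl k x 0 a; rewrite tens0l !addr0. Qed.

Lemma tcoef_tens x a m : tcoef m (tens x a) = (tcoef m a : K) *: x.
Proof.
move: a; apply: loop_eq_add => [f g|f g|c k].
- by rewrite tensDr loopDE.
- by rewrite loopDE scalerDl.
- by rewrite tens_tmon !tmonE scalerMnl.
Qed.

Lemma tens1 x : tens x 1 = tmon x 0.
Proof. by rewrite -[1]/(laurent_one n K) /laurent_one tens_tmon scale1r. Qed.

End Tens.

Lemma lie_tens (L : lieAlgType K) (x y : L) (a b : A) :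
  lie (tens x a) (tens y b) = tens (lie x y) (a * b) :> loop n L.
Proof.
have lieDl' (u v w : loop n L) : lie (u + v) w = lie u w + lie v w.
  by have := lieDl 1 u v w; rewrite (scale1r u) (scale1r (lie u w)).
have lieDr' (u v w : loop n L) : lie w (u + v) = lie w u + lie w v.
  by have := lieDr 1 u v w; rewrite (scale1r u) (scale1r (lie w u)).
have lieZl k (u w : L) : lie (k *: u) w = k *: lie u w.
  have := lieDl k u 0 w; have := lieDl (-1) 0 0 w.
  by rewrite scaler0 addr0 scaleN1r addNr => ->; rewrite !addr0.
have lieZr k (u w : L) : lie w (k *: u) = k *: lie w u.
  have := lieDr k u 0 w; have := lieDr (-1) 0 0 w.
  by rewrite scaler0 addr0 scaleN1r addNr => ->; rewrite !addr0.
move: a; apply: loop_eq_add => [f g|f g|c k].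
- by rewrite tensDr lieDl'.
- by rewrite mulrDl tensDr.
move: b; apply: loop_eq_add => [f g|f g|d l].
- by rewrite tensDr lieDr'.
- by rewrite mulrDr tensDr.
rewrite !tens_tmon.
have -> : (tmon (c : K^o) k : A) * tmon (d : K^o) l = tmon (c * d : K^o) (k + l).
  exact: laurent_mul_tmon.
rewrite tens_tmon -[LHS]/(loop_lie (tmon ((c : K) *: x) k) (tmon ((d : K) *: y) l)) loop_lie_tmon.
by rewrite lieZl lieZr scalerA.
Qed.

End Tensor.

Section CurrentAlgebra.
Variable R : realType.
Local Notation C := R[i].
Variables (g : kac_moody R) (h2 : cartan_complement g) (n : nat).
Local Notation h := (km_cartan g).
Local Notation inc := (@km_inc R g).
Local Notation A := (laurent n C).
Local Notation gA := (gA h2 n).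
Local Notation U := (env gA).
Local Notation N := (km_size g).
Local Notation e := (@km_e R g).
Local Notation f := (@km_f R g).
Local Notation coroot := (@km_coroot R g).
Local Notation root := (@km_root R g).

Lemma root_coroot i : (root i (coroot i) : C) = 2.
Proof. by rewrite km_pairing km_gcm_diag. Qed.

(** [alpha_i] takes the value 2 at its coroot, so [e_i] is half of a bracket. *)
Lemma e_derived i : derived (e i).
Proof.
have -> : e i = 2^-1 *: lie (inc (coroot i)) (e i).
  rewrite km_lie_he root_coroot scalerA mulVf ?scale1r //.
  by rewrite pnatr_eq0.
by apply/lspanZ/lspan_gen; exists (inc (coroot i)), (e i).
Qed.

Lemma f_derived i : derived (f i).
Proof.
have -> : f i = (- 2^-1) *: lie (inc (coroot i)) (f i).
  rewrite km_lie_hf root_coroot scalerN scaleNr opprK scalerA mulVf ?scale1r //.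
  by rewrite pnatr_eq0.
by apply/lspanZ/lspan_gen; exists (inc (coroot i)), (f i).
Qed.

Lemma coroot_derived i : derived (inc (coroot i)).
Proof.
apply: lspan_gen; exists (e i), (f i).
by rewrite km_lie_ef eqxx.
Qed.

Lemma tens_gA (x : g) (a : A) : derived x -> tens x a \in gA_space h2 n.
Proof.
move=> dx; apply/subspace_ofP; exists (tens x a), 0; split; last 1 first.
- by rewrite linear0 /tmon monalgU0 addr0.
- by move=> m; rewrite tcoef_tens; apply: lspanZ.
- exact: mem0v.
Qed.

Definition gA_e i a : gA := Sub_ (tens_gA a (e_derived i)).
Definition gA_f i a : gA := Sub_ (tens_gA a (f_derived i)).
Definition gA_h i a : gA := Sub_ (tens_gA a (coroot_derived i)).
Local Notation gA_d := (@cartan_gA R g h2 n).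

Lemma gA_val_inj (x y : gA) : val x = val y -> x = y.
Proof. exact: val_inj. Qed.

Lemma val_gA_d d : val (gA_d d) = tens (inc d) 1.
Proof. by rewrite tens1. Qed.

Lemma gA_val_lie (x y : gA) : val (lie x y) = lie (val x) (val y).
Proof. by []. Qed.

Lemma gA_ef i j a b : lie (gA_e i a) (gA_f j b) = if i == j then gA_h i (a * b) else 0.
Proof.
apply: gA_val_inj; rewrite gA_val_lie [LHS]lie_tens km_lie_ef.
by case: eqP => [->|] //; rewrite tens0l.
Qed.

Lemma gA_hf i j a b :
  lie (gA_h i a) (gA_f j b) = - (root j (coroot i) : C) *: gA_f j (a * b).
Proof.
apply: gA_val_inj; rewrite gA_val_lie [LHS]lie_tens km_lie_hf.
by rewrite -scaleNr tensZl.
Qed.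

Lemma gA_he i j a b :
  lie (gA_h i a) (gA_e j b) = (root j (coroot i) : C) *: gA_e j (a * b).
Proof.
by apply: gA_val_inj; rewrite gA_val_lie [LHS]lie_tens km_lie_he tensZl.
Qed.

Lemma gA_df d j b : lie (gA_d d) (gA_f j b) = - (root j d : C) *: gA_f j b.
Proof.
apply: gA_val_inj; rewrite gA_val_lie val_gA_d [LHS]lie_tens km_lie_hf mul1r.
by rewrite -scaleNr tensZl.
Qed.

Lemma gA_de d j b : lie (gA_d d) (gA_e j b) = (root j d : C) *: gA_e j b.
Proof.
apply: gA_val_inj; rewrite gA_val_lie val_gA_d [LHS]lie_tens km_lie_he mul1r.
by rewrite tensZl.
Qed.

Lemma gA_eP i k a b : gA_e i (k *: a + b) = k *: gA_e i a + gA_e i b.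
Proof. by apply: gA_val_inj; apply: tensPr. Qed.
Lemma gA_fP i k a b : gA_f i (k *: a + b) = k *: gA_f i a + gA_f i b.
Proof. by apply: gA_val_inj; apply: tensPr. Qed.

(** Let [G] be the space of the [x] in [g] with [x (x) A] in the subalgebra
    generated by these elements. The brackets of two elements of [h + G] lie in
    [G], so [h + G] is a subalgebra of [g]; it contains the generators of [g],
    and therefore [G] contains the derived algebra of [g]. *)
Lemma gA_generated (P : gA -> Prop) : submodule P ->
  (forall x y, P x -> P y -> P (lie x y)) ->
  (forall i a, P (gA_e i a)) -> (forall i a, P (gA_f i a)) ->
  (forall d, P (gA_d d)) -> forall x, P x.
Proof.
move=> [P0 PD] PL Pe Pf Pd.
pose Q (z : loop n g) := exists w : gA, val w = z /\ P w.
have Q0 : Q 0 by exists 0.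
have QD c y z : Q y -> Q z -> Q (c *: y + z).
  by move=> [w [<- Pw]] [u [<- Pu]]; exists (c *: w + u); split; [|exact: PD].
have QL y z : Q y -> Q z -> Q (lie y z).
  by move=> [w [<- Pw]] [u [<- Pu]]; exists (lie w u); split; [|exact: PL].
have Qd d : Q (tmon (inc d) 0) by exists (gA_d d).
pose G x := forall m, Q (tmon x m).
have GD c y z : G y -> G z -> G (c *: y + z).
  by move=> Gy Gz m; rewrite tmonP; apply: QD.
have G0 : G 0 by move=> m; rewrite /tmon monalgU0.
have Ge i : G (e i).
  by move=> m; exists (gA_e i (tmon (1 : C^o) m)); rewrite /= tens_tmon scale1r.
have Gf i : G (f i).
  by move=> m; exists (gA_f i (tmon (1 : C^o) m)); rewrite /= tens_tmon scale1r.
have GL x y : G x -> G y -> G (lie x y).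
  move=> Gx Gy m; rewrite -[m]add0r -loop_lie_tmon; exact: QL (Gx 0) (Gy m).
have GdL d y : G y -> G (lie (inc d) y).
  move=> Gy m; rewrite -[m]add0r -loop_lie_tmon; exact: QL (Qd d) (Gy m).
have lieN (x y : g) : lie y x = - lie x y.
  have D1 (u v w : g) : lie (u + v) w = lie u w + lie v w.
    by have := lieDl 1 u v w; rewrite !scale1r.
  have D2 (u v w : g) : lie w (u + v) = lie w u + lie w v.
    by have := lieDr 1 u v w; rewrite !scale1r.
  have := liexx (x + y); rewrite D1 !D2 !liexx add0r addr0 addrC => /eqP.
  by rewrite addr_eq0 => /eqP.
pose G2 x := exists d y, x = inc d + y /\ G y.
have sG2 : submodule G2.
  split; first by exists 0, 0; rewrite linear0 addr0.
  move=> c _ _ [d [y [-> Gy]]] [d' [y' [-> Gy']]].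
  exists (c *: d + d'), (c *: y + y'); split; last exact: GD.
  by rewrite linearP scalerDr addrACA.
have G2L x y : G2 x -> G2 y -> G (lie x y).
  move=> [d [u [-> Gu]]] [d' [u' [-> Gu']]].
  have D1 (a b c : g) : lie (a + b) c = lie a c + lie b c.
    by have := lieDl 1 a b c; rewrite !scale1r.
  have D2 (a b c : g) : lie c (a + b) = lie c a + lie c b.
    by have := lieDr 1 a b c; rewrite !scale1r.
  have GDD a b : G a -> G b -> G (a + b) by rewrite -{2}[a]scale1r; apply: GD.
  rewrite D1 !D2 km_lie_hh add0r; apply: (GDD _ _); first exact: GdL.
  apply: (GDD _ _); last exact: GL.
  rewrite (lieN (inc d')) -scaleN1r -[_ *: _]addr0; apply: GD G0.
  exact: GdL.
have GG2 x : G x -> G2 x by exists 0, x; rewrite linear0 add0r.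
have SG x y : x \in subspace_of sG2 -> y \in subspace_of sG2 ->
    lie x y \in subspace_of sG2.
  by move=> /subspace_ofP Gx /subspace_ofP Gy; apply/subspace_ofP/GG2/G2L.
have allG2 x : G2 x.
  apply/(subspace_ofP sG2); apply: (@km_generated R g (Subalgebra SG)) => [d|i|i].
  - by apply/subspace_ofP; exists d, 0; rewrite addr0.
  - exact/subspace_ofP/GG2.
  - exact/subspace_ofP/GG2.
have Gder x : derived x -> G x.
  apply: lspan_sub => // _ [y [z ->]]; exact: G2L.
move=> x; suff [w [wx Pw]] : Q (val x) by rewrite -(gA_val_inj wx).
have /subspace_ofP [y [k [dy _ ->]]] := valP x.
rewrite -[y]scale1r; apply: (QD _ _ _) => //; rewrite [y]monalgE.
elim: (X in \sum_(_ <- X) _) => [|m s IH]; first by rewrite big_nil.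
by have := QD 1 _ _ (Gder _ (dy m) m) IH; rewrite big_cons (scale1r (tmon _ m)).
Qed.

End CurrentAlgebra.

(** * From the enveloping algebra to operators *)

Section LaurentForms.
Variables (n : nat) (K : fieldType).
Local Notation A := (laurent n K).
Local Notation Zn := {ffun 'I_n -> int}.

(** The linear form on Laurent polynomials with value [f m] at [t^m]. *)
Definition lev (f : Zn -> K) (a : A) : K^o := \sum_(m <- msupp a) (a@_m : K) * f m.

Lemma levEw f (d : {fset Zn}) (a : A) : (msupp a `<=` d)%fset ->
  lev f a = \sum_(m <- d) (a@_m : K) * f m.
Proof.
move=> ad; rewrite /lev (big_fset_incl _ ad) //= => m _ /mcoeff_outdom ->.
by rewrite mul0r.
Qed.

Fact lev_linear f : linear (lev f).
Proof.
move=> c a b; rewrite (levEw _ (msuppP_le c a b)).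
rewrite (levEw _ (fsubsetUl (msupp a) (msupp b))).
rewrite (levEw _ (fsubsetUr (msupp a) (msupp b))).
rewrite scaler_sumr -big_split; apply: eq_bigr => m _ /=.
rewrite -[(_ + _)@_m]/(tcoef m (c *: (a : loop n K^o) + b)) loopDE loopZE /tcoef.
by rewrite mulrDl -mulrA.
Qed.
HB.instance Definition _ f := GRing.isLinear.Build K A K^o _ (lev f) (lev_linear f).

Lemma lev_tmon f (c : K) m : lev f (tmon (c : K^o) m) = c * f m.
Proof. by rewrite (levEw _ msuppU_le) big_seq_fset1 mcoeffUU. Qed.

Lemma lev_ext (F : A -> K) f : linear (F : A -> K^o) ->
  (forall c m, F (tmon (c : K^o) m) = c * f m) -> F =1 lev f.
Proof.
move=> FL Ft; apply: loop_eq_add => [a b|a b|c m].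
- by have := FL 1 a b; rewrite (scale1r a) (scale1r (F a : K^o)).
- exact: linearD.
- by rewrite Ft lev_tmon.
Qed.

End LaurentForms.

Section AlgebraScalars.
Variables (K : comNzRingType) (E : algType K).
Lemma in_algM (a b : K) : (a%:A : E) * b%:A = (a * b)%:A.
Proof. by rewrite -scalerAl mul1r scalerA. Qed.
Lemma in_algMl (a : K) (u : E) : a%:A * u = a *: u.
Proof. by rewrite -scalerAl mul1r. Qed.
Lemma in_algC (a : K) (u : E) : u * a%:A = a%:A * u.
Proof. by rewrite -scalerAl mul1r -scalerAr mulr1. Qed.
Variable V : lmodType E.
Lemma scale_in_alg (a : K) (u : E) (x : V) : u *: (a%:A *: x) = a%:A *: (u *: x).
Proof. by rewrite !scalerA in_algC. Qed.
Lemma scaleZ_in_alg (a : K) (u : E) (x : V) : (a *: u) *: x = a%:A *: (u *: x).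
Proof. by rewrite scalerA in_algMl. Qed.
Lemma scale_commutator (u w : E) (x : V) :
  u *: (w *: x) = w *: (u *: x) + (u * w - w * u) *: x.
Proof. by rewrite scalerBl !scalerA addrC subrK. Qed.
End AlgebraScalars.

Section RestrictScalars.
Variable R : realType.
Local Notation C := R[i].
Variables (g : kac_moody R) (h2 : cartan_complement g) (n : nat).
Local Notation h := (km_cartan g).
Local Notation inc := (@km_inc R g).
Local Notation A := (laurent n C).
Local Notation gA := (gA h2 n).
Local Notation U := (env gA).
Local Notation N := (km_size g).
Local Notation coroot := (@km_coroot R g).
Local Notation root := (@km_root R g).
Local Notation weight := 'Hom(h, C^o).

Section Module.
Variable V : lmodType U.

Definition restrict_scalars : Type := V.
HB.instance Definition _ := GRing.Zmodule.on restrict_scalars.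
Definition resc_scale (c : C) (x : restrict_scalars) : restrict_scalars := (c%:A : U) *: (x : V).
Fact resc_scaleA a b x : resc_scale a (resc_scale b x) = resc_scale (a * b) x.
Proof.
exact: etrans (scalerA _ _ (x : V)) (congr1 (fun u : U => u *: (x : V)) (in_algM U a b)).
Qed.
Fact resc_scale1 : left_id 1 resc_scale.
Proof. by move=> x; rewrite /resc_scale scale1r (scale1r (x : V)). Qed.
Fact resc_scaleDr : right_distributive resc_scale +%R.
Proof. by move=> a x y; apply: scalerDr. Qed.
Fact resc_scaleDl x : {morph resc_scale^~ x : a b / a + b}.
Proof. by move=> a b; rewrite /resc_scale scalerDl (scalerDl (x : V)). Qed.
HB.instance Definition _ := GRing.Zmodule_isLmodule.Build C restrict_scalars
  resc_scaleA resc_scale1 resc_scaleDr resc_scaleDl.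

Lemma restrict_scalarsZ c (x : restrict_scalars) : c *: x = (c%:A : U) *: (x : V) :> V.
Proof. by []. Qed.

Definition op (z : gA) (x : restrict_scalars) : restrict_scalars := env_inj z *: (x : V).
Fact op_linear z : linear (op z).
Proof.
move=> c x y; apply: etrans (scalerDr (env_inj z) (c%:A *: (x : V)) (y : V)) _.
by congr (_ + _); apply: scale_in_alg.
Qed.
HB.instance Definition _ z :=
  GRing.isLinear.Build C restrict_scalars restrict_scalars _ (op z) (op_linear z).

Lemma opP c z w x : op (c *: z + w) x = c *: op z x + op w x.
Proof.
rewrite /op linearP; apply: etrans (scalerDl (x : V) _ _) _; congr (_ + _).
exact: scaleZ_in_alg.
Qed.

Lemma op0 x : op 0 x = 0.
Proof. by rewrite /op linear0 (scale0r (x : V)). Qed.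
Lemma opZ c z x : op (c *: z) x = c *: op z x.
Proof. by have := opP c z 0 x; rewrite op0 !addr0. Qed.

Lemma op_lie z w x : op z (op w x) = op w (op z x) + op (lie z w) x.
Proof.
rewrite /op env_inj_lie; exact: scale_commutator.
Qed.

(** Stability passes to [g_A], which these elements generate as a Lie algebra, and
    from there to the enveloping algebra. *)
Lemma op_submodule (S : restrict_scalars -> Prop) : submodule S ->
  (forall i a x, S x -> S (op (gA_e h2 i a) x)) ->
  (forall i a x, S x -> S (op (gA_f h2 i a) x)) ->
  (forall d x, S x -> S (op (cartan_gA h2 n d) x)) ->
  submodule (S : V -> Prop).
Proof.
move=> [S0 SD] Se Sf Sd; split=> //.
have Sop z x : S x -> S (op z x).
  move: z x; apply: (gA_generated (P := fun z => forall x, S x -> S (op z x))) => //.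
    by split=> [x Sx|c z w Sz Sw x Sx]; rewrite ?op0 ?opP //; apply: SD; [apply: Sz|apply: Sw].
  move=> z w Sz Sw x Sx.
  have -> : op (lie z w) x = (-1) *: op w (op z x) + op z (op w x).
    by rewrite (op_lie z w) scaleN1r addKr.
  by apply: SD; [apply/Sw/Sz|apply/Sz/Sw].
suff SU u x : S x -> S (u *: (x : V)).
  move=> u x y Sx Sy; have := SD 1 (u *: (x : V)) y (SU u x Sx) Sy.
  by rewrite (scale1r (u *: (x : V) : restrict_scalars)).
move: u x; apply: env_ind => [x _|x Sx|c u w Su Sw x Sx|z u Su x Sx].
- by rewrite scale0r.
- by rewrite scale1r.
- rewrite scalerDl.
  by rewrite scaleZ_in_alg; apply: SD; [apply: Su|apply: Sw].
- by rewrite -scalerA; apply/Sop/Su.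
Qed.

End Module.

End RestrictScalars.

(** * Irreducible quotients of Verma modules *)

Section IrreducibleQuotient.
Variable R : realType.
Local Notation C := R[i].
Variables (g : kac_moody R) (h2 : cartan_complement g) (n : nat).
Local Notation h := (km_cartan g).
Local Notation inc := (@km_inc R g).
Local Notation A := (laurent n C).
Local Notation gA := (gA h2 n).
Local Notation hA := (hA h2 n).
Local Notation U := (env gA).
Local Notation N := (km_size g).
Local Notation coroot := (@km_coroot R g).
Local Notation root := (@km_root R g).
Local Notation weight := 'Hom(h, C^o).

Lemma hA_d_mem d : tmon (inc d) 0 \in hA.
Proof.
have [y [z [hy hz ->]]] := hsecond_sum h2 d.
rewrite linearD (_ : tmon _ _ = tmon (inc y) 0 + tmon (inc z) 0); last exact: raddfD.
by apply: rpredD; [exact: (hA_tens_mem h2 (Sub_ hy) 0)|exact: hA_second_mem].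
Qed.
Definition hA_d d : hA := Sub_ (hA_d_mem d).

Lemma coroot_hprime i : coroot i \in hprime g.
Proof. by apply/subspace_ofP; apply: coroot_derived. Qed.
Definition coroot' i : hprime g := Sub_ (coroot_hprime i).

Lemma hA_coroot_mem i a : tens (inc (coroot i)) a \in hA.
Proof.
apply/subspace_ofP; exists (tens (inc (coroot i)) a), 0; split; last 1 first.
- by rewrite linear0 /tmon monalgU0 addr0.
- move=> m; rewrite tcoef_tens -linearZ; exists ((tcoef m a : C) *: coroot i) => //.
  by rewrite rpredZ // coroot_hprime.
- exact: mem0v.
Qed.
Definition hA_coroot i a : hA := Sub_ (hA_coroot_mem i a).

Section Weight.
Variable psi : {linear hA -> C^o}.

(** The restriction of the highest weight to the coroots. *)
Definition phi_of i : A -> C := lev (psi_ psi (coroot' i)).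

Lemma psi_coroot i a : psi (hA_coroot i a) = phi_of i a.
Proof.
apply: (lev_ext (F := fun a => psi (hA_coroot i a) : C)) => [k b b'|c m].
  rewrite -linearP; congr (psi _); apply: val_inj; exact: tensPr.
have -> : hA_coroot i (tmon c m) = (c : C) *: hA_tens h2 (coroot' i) m.
  apply: val_inj; rewrite /= tens_tmon.
  have := tmonP (c : C) (inc (coroot i)) 0 m.
  by rewrite addr0 => ->; rewrite {2}/tmon monalgU0 addr0.
by rewrite linearZ.
Qed.

Definition La_fun (d : h) : C^o := psi (hA_d d).
Fact La_linear : linear La_fun.
Proof.
move=> k x y; rewrite /La_fun -linearP; congr (psi _); apply: val_inj => /=.
by rewrite linearP; apply: tmonP.
Qed.
HB.instance Definition _ := GRing.isLinear.Build C h C^o _ La_fun La_linear.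
Definition La_of : weight := linfun La_fun.

Lemma La_ofE d : La_of d = psi (hA_d d).
Proof. exact: lfunE. Qed.

Variable V : lmodType U.
Hypothesis irrV : irreducible_quotient psi V.

(** The image of the canonical generator of the Verma module. *)
Lemma highest_weight_vector : exists v : restrict_scalars V, [/\ v != 0,
  forall i a, op (gA_e h2 i a) v = 0,
  forall i a, op (gA_h h2 i a) v = phi_of i a *: v
  & forall d, op (cartan_gA h2 n d) v = (La_of d : C) *: v].
Proof.
case: irrV => -[pi pi_surj] [w w0] _.
pose v : V := pi (lproj _ (1 : U^o)).
have vx (u : U) : pi (lproj _ (u : U^o)) = u *: v.
  by rewrite /v -linearZ -linearZ /=; congr (pi (lproj _ _)); rewrite [RHS]mulr1.
have act x p y : (forall m, nplus (tcoef m p)) -> val x = p + val y ->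
    op (V := V) x v = (psi y : C) *: (v : restrict_scalars V).
  move=> pP e; apply/eqP; rewrite -subr_eq0; apply/eqP.
  rewrite restrict_scalarsZ /op -[_ - _]/(env_inj x *: v - ((psi y : C)%:A : U) *: v).
  rewrite -scalerBl -vx (_ : lproj _ _ = 0) ?linear0 //.
  apply/lprojP; rewrite subr0; apply: lspan_gen; exists x, p, y; split=> //.
exists v; split.
- apply: contraNneq w0 => v0; have [u <-] := pi_surj w.
  by rewrite -[u]lreprK vx; apply/eqP; have := scaler0 V (lrepr u); rewrite -v0.
- move=> i a; rewrite (act _ (tens (@km_e R g i) a) 0); first by rewrite linear0 scale0r.
    move=> m; rewrite tcoef_tens => S Se; rewrite rpredZ //; exact: Se.
  by rewrite /= addr0.
- move=> i a; rewrite (act _ 0 (hA_coroot i a)) ?psi_coroot //=; last by rewrite add0r.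
  by move=> m; rewrite loop0E => S _; apply: rpred0.
- move=> d; rewrite (act _ 0 (hA_d d)) ?La_ofE //=; last by rewrite add0r.
  by move=> m; rewrite loop0E => S _; apply: rpred0.
Qed.

Definition irr_v := projT1 (cid highest_weight_vector).

Let opE i a : {linear restrict_scalars V -> restrict_scalars V} := op (gA_e h2 i a).
Let opF i a : {linear restrict_scalars V -> restrict_scalars V} := op (gA_f h2 i a).
Let opH i a : {linear restrict_scalars V -> restrict_scalars V} := op (gA_h h2 i a).
Let opD d : {linear restrict_scalars V -> restrict_scalars V} := op (cartan_gA h2 n d).
Let cm i j : C := root j (coroot i).

Fact irr_vP : [/\ irr_v != 0,
  forall i a, opE i a irr_v = 0,
  forall i a, opH i a irr_v = phi_of i a *: irr_v
  & forall d, opD d irr_v = (La_of d : C) *: irr_v].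
Proof. exact: projT2 (cid highest_weight_vector). Qed.
Fact irr_v_neq0 : irr_v != 0. Proof. by case: irr_vP. Qed.
Fact irr_vE i a : opE i a irr_v = 0. Proof. have [_ vE _ _] := irr_vP; exact: vE. Qed.
Fact irr_vH i a : opH i a irr_v = phi_of i a *: irr_v.
Proof. have [_ _ vH _] := irr_vP; exact: vH. Qed.
Fact irr_vD d : opD d irr_v = (La_of d : C) *: irr_v.
Proof. have [_ _ _ vD] := irr_vP; exact: vD. Qed.

Fact opElin i k a b x : opE i (k *: a + b) x = k *: opE i a x + opE i b x.
Proof. by rewrite /opE /= gA_eP opP. Qed.
Fact opFlin i k a b x : opF i (k *: a + b) x = k *: opF i a x + opF i b x.
Proof. by rewrite /opF /= gA_fP opP. Qed.
Fact opEF i j a b x : opE i a (opF j b x) =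
  opF j b (opE i a x) + (if i == j then opH i (a * b) x else 0).
Proof. by rewrite [LHS]op_lie gA_ef; case: eqP; rewrite ?op0. Qed.
Fact opHF i j a b x : opH i a (opF j b x) =
  opF j b (opH i a x) - cm i j *: opF j (a * b) x.
Proof. by rewrite [LHS]op_lie gA_hf opZ scaleNr. Qed.
Fact opDF d j b x : opD d (opF j b x) =
  opF j b (opD d x) - (root j d : C) *: opF j b x.
Proof. by rewrite [LHS]op_lie gA_df opZ scaleNr. Qed.
Fact opHE i j a b x : opH i a (opE j b x) =
  opE j b (opH i a x) + cm i j *: opE j (a * b) x.
Proof. by rewrite [LHS]op_lie gA_he opZ. Qed.
Fact opDE d j b x : opD d (opE j b x) =
  opE j b (opD d x) + (root j d : C) *: opE j b x.
Proof. by rewrite [LHS]op_lie gA_de opZ. Qed.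
Fact op_irr (S : restrict_scalars V -> Prop) : submodule S ->
  (forall i a x, S x -> S (opE i a x)) -> (forall i a x, S x -> S (opF i a x)) ->
  (forall d x, S x -> S (opD d x)) -> (forall x, S x -> x = 0) \/ (forall x, S x).
Proof.
by move=> sS SE SF SD; have [_ _ irr] := irrV; exact: irr (op_submodule sS SE SF SD).
Qed.

(** The operators on this module are those of [V], so weight spaces and their
    dimensions are literally those of [V]. *)
Definition irr_quotient_hwmod : hwmod root cm phi_of La_of :=
  irr_hwmod (@km_root_free R g) opElin opFlin opEF opHF opDF opHE opDE irr_vE irr_vH irr_vD
    irr_v_neq0 op_irr.

Lemma has_dimE mu d :
  has_dim (weight_space (V := V) mu) d <-> hasdim (wt_space (hwD irr_quotient_hwmod) mu) d.
Proof. by []. Qed.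

End Weight.
End IrreducibleQuotient.

(** * Exp-polynomial functions and ideals of Laurent polynomials *)

Section LaurentAnnihilators.
Variables (n : nat) (K : numFieldType).
Local Notation A := (laurent n K).
Local Notation Zn := {ffun 'I_n -> int}.
Local Notation "''t^' m" := (tmon (1 : K^o) m : A) (at level 8, m at level 2, format "''t^' m").

Definition shift (l : Zn) (f : Zn -> K) : Zn -> K := fun m => f (m + l).

Lemma tmon_mul (c d : K) k l :
  (tmon (c : K^o) k : A) * tmon (d : K^o) l = tmon (c * d : K^o) (k + l).
Proof. exact: laurent_mul_tmon. Qed.

Lemma lev_mul_t f (a : A) l : lev f (a * 't^l) = lev (shift l f) a.
Proof.
move: a; apply: loop_eq_add => [a b|a b|c m].
- by rewrite mulrDl linearD.
- exact: linearD.
- by rewrite tmon_mul !lev_tmon mulr1.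
Qed.

(** The largest ideal of [A] in the kernel of [lev f]. *)
Definition Ann (f : Zn -> K) (a : A) := forall b, lev f (a * b) = 0.

Lemma Ann_shift f a : (forall l, lev (shift l f) a = 0) -> Ann f a.
Proof.
move=> fa; apply: loop_eq_add => [b c|b c|c l]; last first.
- have -> : tmon c l = (c : K) *: ('t^l) :> A.
    by apply: loop_ext => m; rewrite loopZE !tmonE -scalerMnr [_ *: _]mulr1.
  by rewrite -scalerAr linearZ /= lev_mul_t fa scaler0.
- by rewrite addr0.
- by rewrite mulrDr linearD.
Qed.

Lemma Ann_ideal f : ideal (Ann f).
Proof.
split=> [a b fa fb c|a b fa c]; first by rewrite mulrDl linearD /= fa fb addr0.
by rewrite mulrAC mulrC fa.
Qed.
Lemma Ann0 f : Ann f 0.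
Proof. by move=> b; rewrite mul0r linear0. Qed.

Lemma lev_sum (J : finType) (f : J -> Zn -> K) a :
  lev (fun m => \sum_j f j m) a = \sum_j lev (f j) a.
Proof.
by rewrite /lev exchange_big /=; apply: eq_bigr => m _; rewrite mulr_sumr.
Qed.

Lemma Ann_sum (J : finType) (f : J -> Zn -> K) a :
  (forall j, Ann (f j) a) -> Ann (fun m => \sum_j f j m) a.
Proof.
by move=> fa b; rewrite lev_sum big1 // => j _; apply: fa.
Qed.

Section Difference.
Variable i : 'I_n.
Definition basis_vec : Zn := [ffun j => (j == i)%:R].
Local Notation d := basis_vec.

Definition diff (c : K) (f : Zn -> K^o) : Zn -> K^o := shift d f - c *: f.

Fact diff_linear c : linear (diff c).
Proof.
move=> k f h; apply/funext => m; rewrite /diff /shift /=.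
rewrite -[LHS]/((k *: f (m + d) + h (m + d)) - c *: (k *: f m + h m)).
rewrite -[RHS]/(k *: (f (m + d) - c *: f m) + (h (m + d) - c *: h m)).
by rewrite scalerDr opprD addrACA scalerBr !scalerA mulrC.
Qed.
HB.instance Definition _ c :=
  GRing.isLinear.Build K (Zn -> K^o) (Zn -> K^o) _ (diff c) (diff_linear c).

Definition laurent_var : A := 't^d.

Lemma lev_diff c f a : lev f ((laurent_var - c%:A) * a) = lev (diff c f) a.
Proof.
have -> : lev (diff c f) a = lev (shift d f) a - c * lev f a.
  rewrite /lev mulr_sumr -sumrB; apply: eq_bigr => m _.
  by rewrite -[diff c f m]/(f (m + d) - c * f m) mulrBr mulrCA.
by rewrite mulrBl linearB /= (mulrC laurent_var) lev_mul_t -scalerAl mul1r linearZ.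
Qed.

Lemma lev_diff_iter c k f a : lev f ((laurent_var - c%:A) ^+ k * a) = lev (iter k (diff c) f) a.
Proof.
elim: k f => [|k IH] f; first by rewrite expr0 mul1r.
by rewrite exprS -mulrA lev_diff IH -iterSr.
Qed.

(** On functions, [t_i] acts as the shift by the basis vector of index [i]: these
    are the functions that a power of [t_i - c] kills. *)
Definition nilp c f := exists k, iter k (diff c) f = 0.

Lemma iter_diff_linear c k : linear (iter k (diff c)).
Proof.
elim: k => [//|k IH] a f h; rewrite !iterS IH; exact: linearP.
Qed.
Lemma iter_diff0 c k : iter k (diff c) 0 = 0.
Proof. by elim: k => // k IH; rewrite iterS IH linear0. Qed.

Lemma nilp_ge c f k l : (k <= l)%N -> iter k (diff c) f = 0 -> iter l (diff c) f = 0.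
Proof. by move=> kl fk; rewrite -(subnK kl) iterD fk iter_diff0. Qed.

Lemma nilpD c f h : nilp c f -> nilp c h -> nilp c (f + h).
Proof.
move=> [k fk] [l hl]; exists (maxn k l).
rewrite -[f]scale1r iter_diff_linear (nilp_ge (leq_maxl k l) fk).
by rewrite (nilp_ge (leq_maxr k l) hl) scaler0 addr0.
Qed.

Lemma nilp0 c : nilp c 0.
Proof. by exists 0%N. Qed.

Lemma nilpZ c a f : nilp c f -> nilp c (a *: f).
Proof.
by move=> [k fk]; exists k; rewrite -[a *: f]addr0 iter_diff_linear fk iter_diff0 scaler0 addr0.
Qed.

Lemma shift_iter c k f : iter k (diff c) (shift d f) = shift d (iter k (diff c) f).
Proof. by elim: k => // k IH; rewrite !iterS IH. Qed.

(** The commutator of [t_i - c] with multiplication by [m_j] is zero or the shift,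
    so that multiplication by a coordinate costs one more power. *)
Lemma nilp_coord c j f : nilp c f -> nilp c (fun m => (m j)%:~R * f m).
Proof.
move=> [k fk]; exists k.+1; elim: k f fk => [|k IH] f fk.
  rewrite -[f]/(iter 0 (diff c) f) fk (_ : (fun m => _) = 0) ?iter_diff0 //.
  by apply/funext => m; rewrite [LHS]mulr0.
rewrite iterSr.
have -> : diff c (fun m => (m j)%:~R * f m) =
    (i == j)%:R *: (shift d f : Zn -> K^o) + (fun m => (m j)%:~R * diff c f m : K^o).
  apply/funext => m.
  rewrite -[LHS]/(((m + d) j)%:~R * f (m + d) - c * ((m j)%:~R * f m)).
  rewrite -[RHS]/((i == j)%:R * f (m + d) + (m j)%:~R * (f (m + d) - c * f m)).
  have ej : ((m + d) j)%:~R = (m j)%:~R + (i == j)%:R :> K.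
    by rewrite !ffunE intrD eq_sym; case: (i == j).
  by rewrite ej mulrDl mulrBr (mulrCA c) addrA [X in X - _]addrC.
rewrite iter_diff_linear shift_iter fk IH; last by rewrite -iterSr.
by rewrite addr0 [X in _ *: X](_ : _ = 0) ?scaler0.
Qed.

(** Multiplication by [t_i - c] is adjoint to the difference operator. *)
Lemma Ann_nilp c f : nilp c f -> exists k, Ann f ((laurent_var - c%:A) ^+ k).
Proof.
by move=> [k fk]; exists k => b; rewrite lev_diff_iter fk /lev big1 // => m _; rewrite mulr0.
Qed.

End Difference.

(** Powers of [X - c] and [X - c'] are coprime; substitute [t_i] in Bezout's
    identity. *)
Lemma Ann_comaximal i (c c' : K) f f' : c != c' -> nilp i c f -> nilp i c' f' ->
  comaximal (Ann f) (Ann f').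
Proof.
move=> cc' /Ann_nilp [k fk] /Ann_nilp [l fl].
have /Bezout_eq1_coprimepP [[u w] /= uw] :
    coprimep (('X - c%:P) ^+ k) (('X - c'%:P) ^+ l).
  by rewrite coprimep_expl // coprimep_expr // coprimep_XsubC2 // subr_eq0 eq_sym.
have ev (a : K) m : horner_alg (laurent_var i) (('X - a%:P) ^+ m) = (laurent_var i - a%:A) ^+ m.
  by rewrite rmorphXn rmorphB /= horner_algX horner_algC.
have [_ fM] := Ann_ideal f; have [_ fM'] := Ann_ideal f'.
exists (horner_alg (laurent_var i) (w * ('X - c'%:P) ^+ l)); split; last first.
  by rewrite rmorphM /= ev; apply: fM'.
rewrite -(rmorph1 (horner_alg (laurent_var i))) -uw rmorphD addrK rmorphM /= ev.
exact: fM.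
Qed.

Lemma exp_fun_shift (lam : {ffun 'I_n -> K}) (m l : Zn) : (forall i, lam i != 0) ->
  \prod_i lam i ^ (m + l) i = (\prod_i lam i ^ m i) * \prod_i lam i ^ l i.
Proof.
move=> l0; rewrite -big_split; apply: eq_bigr => i _.
by rewrite ffunE expfzDr.
Qed.

(** Kernels of finite rank. *)
Definition separable (F : Zn -> Zn -> K) :=
  exists (S : finType) (b c : S -> Zn -> K), forall m l, F m l = \sum_s b s m * c s l.

Lemma separableD F G : separable F -> separable G -> separable (fun m l => F m l + G m l).
Proof.
move=> [S [b [c Fbc]]] [T [b' [c' Gbc]]].
exists (S + T)%type, (fun s => match s with inl s => b s | inr t => b' t end),
  (fun s => match s with inl s => c s | inr t => c' t end) => m l.
by rewrite big_sumType Fbc Gbc.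
Qed.

Lemma separableM F G : separable F -> separable G -> separable (fun m l => F m l * G m l).
Proof.
move=> [S [b [c Fbc]]] [T [b' [c' Gbc]]].
exists (S * T)%type, (fun s m => b s.1 m * b' s.2 m), (fun s l => c s.1 l * c' s.2 l) => m l.
rewrite Fbc Gbc mulr_suml.
rewrite -(pair_bigA _ (fun s t => b s m * b' t m * (c s l * c' t l))) /=.
by apply: eq_bigr => s _; rewrite mulr_sumr; apply: eq_bigr => t _; rewrite mulrACA.
Qed.

Lemma separable1 f h : separable (fun m l => f m * h l).
Proof. by exists unit, (fun=> f), (fun=> h) => m l; rewrite big_const card_unit /= addr0. Qed.

Lemma separableC (a : K) : separable (fun _ _ => a).
Proof.
by exists unit, (fun _ _ => a), (fun _ _ => 1) => m l; rewrite big_const card_unit /= mulr1 addr0.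
Qed.

Lemma separable_sum (J : Type) (s : seq J) (F : J -> Zn -> Zn -> K) :
  (forall j, separable (F j)) -> separable (fun m l => \sum_(j <- s) F j m l).
Proof.
move=> Fs; elim: s => [|j s IH].
  by rewrite (_ : (fun _ _ => _) = fun _ _ => 0); [exact: separableC|];
    apply/funext => m; apply/funext => l; rewrite big_nil.
rewrite (_ : (fun _ _ => _) = fun m l => F j m l + \sum_(j <- s) F j m l).
  exact: separableD.
by apply/funext => m; apply/funext => l; rewrite big_cons.
Qed.

Lemma separable_prod (J : Type) (s : seq J) (F : J -> Zn -> Zn -> K) :
  (forall j, separable (F j)) -> separable (fun m l => \prod_(j <- s) F j m l).
Proof.
move=> Fs; elim: s => [|j s IH].
  by rewrite (_ : (fun _ _ => _) = fun _ _ => 1); [exact: separableC|];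
    apply/funext => m; apply/funext => l; rewrite big_nil.
rewrite (_ : (fun _ _ => _) = fun m l => F j m l * \prod_(j <- s) F j m l).
  exact: separableM.
by apply/funext => m; apply/funext => l; rewrite big_cons.
Qed.

(** If the kernel [f (m + l)] is a finite sum of products [b_s m * c_s l], then the
    common kernel of the forms [lev b_s] is contained in the annihilator. *)
Lemma separable_codim (I : finType) (f : I -> Zn -> K) :
  (forall i, separable (fun m l => f i (m + l))) ->
  exists bs : seq A, forall a, exists c,
    lspan (fun y => y \in bs) c /\ forall i, Ann (f i) (a - c).
Proof.
move=> sep; pose S i := projT1 (cid (sep i)).
pose b i : S i -> Zn -> K := projT1 (cid (projT2 (cid (sep i)))).
have bP i : exists c : S i -> Zn -> K, forall m l, f i (m + l) = \sum_s b i s m * c s l.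
  exact: projT2 (cid (projT2 (cid (sep i)))).
have [bs bsP] := finite_codim (fun j : {i : I & S i} =>
  lev (b (tag j) (tagged j)) : {linear A -> K^o}).
exists bs => a; have [y [ys yP]] := bsP a; exists y; split=> // i.
have [c cP] := bP i; apply: Ann_shift => l.
have -> : lev (shift l (f i)) (a - y) = \sum_s lev (b i s) (a - y) * c s l.
  rewrite /lev; under eq_bigr do rewrite /shift cP mulr_sumr.
  rewrite exchange_big; apply: eq_bigr => s _; rewrite mulr_suml.
  by apply: eq_bigr => m _; rewrite mulrA.
rewrite big1 // => s _; have := yP (existT S i s) => /= ->.
by rewrite mul0r.
Qed.

Section ExpPolynomial.
Variables (p : mpoly.mpoly n K) (lam : {ffun 'I_n -> K}).
Hypothesis lam0 : forall i, lam i != 0.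

(** [p exp(lam)]. *)
Definition pexp (m : Zn) : K :=
  mpoly.meval (fun i => (m i)%:~R) p * \prod_i lam i ^ m i.

(** [p (m + l)] expands into a finite sum and [exp(lam)] is multiplicative. *)
Lemma pexp_separable : separable (fun m l => pexp (m + l)).
Proof.
apply: separableM; last first.
  rewrite (_ : (fun _ _ => _) = fun m l : Zn => (\prod_i lam i ^ m i) * \prod_i lam i ^ l i).
    exact: separable1.
  by apply/funext => m; apply/funext => l; apply: exp_fun_shift.
rewrite (_ : (fun _ _ => _) = fun m l : Zn => \sum_(e <- mpoly.msupp p)
  mpoly.mcoeff e p * \prod_i ((m + l) i)%:~R ^+ mpoly.fun_of_multinom e i); last first.
  by apply/funext => m; apply/funext => l; rewrite mpoly.mevalE.
apply: separable_sum => e; apply: separableM; first exact: separableC.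
apply: separable_prod => i; elim: (mpoly.fun_of_multinom e i) => [|k IH].
  rewrite (_ : (fun _ _ => _) = fun _ _ => 1); first exact: separableC.
  by apply/funext => m; apply/funext => l; rewrite expr0.
rewrite (_ : (fun _ _ => _) = fun m l : Zn =>
    ((m i)%:~R * 1 + 1 * (l i)%:~R) * ((m + l) i)%:~R ^+ k).
  apply: separableM => //; apply: separableD; first exact: separable1.
  exact: (separable1 (fun=> 1)).
by apply/funext => m; apply/funext => l; rewrite exprS ffunE intrD mulr1 mul1r.
Qed.

(** [t_i - lam_i] kills [exp(lam)], and every factor [m_j] of a monomial costs one
    more power. *)
Lemma pexp_nilp i : nilp i (lam i) pexp.
Proof.
pose E : Zn -> K^o := fun m => \prod_i lam i ^ m i.
have nE : nilp i (lam i) E.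
  exists 1%N; apply/funext => m /=.
  rewrite -[LHS]/(E (m + basis_vec i) - lam i * E m).
  rewrite [E (_ + _)]exp_fun_shift // -/(E m) mulrC.
  have -> : \prod_j lam j ^ basis_vec i j = lam i.
    rewrite (bigD1 i) //= ffunE eqxx expr1z big1 ?mulr1 // => j /negPf ji.
    by rewrite ffunE ji expr0z.
  by rewrite subrr.
rewrite (_ : pexp = \sum_(e <- mpoly.msupp p) (mpoly.mcoeff e p *:
    (fun m : Zn => \prod_j (m j)%:~R ^+ mpoly.fun_of_multinom e j * E m : K^o)
    : Zn -> K^o)); last first.
  apply/funext => m; rewrite fct_sumE /pexp mpoly.mevalE mulr_suml.
  by apply: eq_bigr => e _; rewrite -mulrA.
elim/big_ind: _ => [|f h|e _]; [exact: nilp0|exact: nilpD|apply: nilpZ].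
elim: (index_enum _) => [|j s IH].
  by rewrite (_ : (fun _ => _) = E) //; apply/funext => m; rewrite big_nil mul1r.
pose G k : Zn -> K^o := fun m => (m j)%:~R ^+ k *
  (\prod_(j <- s) (m j)%:~R ^+ mpoly.fun_of_multinom e j * E m).
rewrite (_ : (fun _ => _) = G (mpoly.fun_of_multinom e j)); last first.
  by apply/funext => m; rewrite big_cons /G mulrA.
elim: (mpoly.fun_of_multinom e j) => [|k IHk].
  by rewrite (_ : G 0%N = fun m => \prod_(j <- s) (m j)%:~R ^+ mpoly.fun_of_multinom e j * E m) //;
    apply/funext => m; rewrite /G mul1r.
rewrite (_ : G k.+1 = fun m => (m j)%:~R * G k m); first exact: nilp_coord.
by apply/funext => m; rewrite /G exprS -mulrA.
Qed.

End ExpPolynomial.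

End LaurentAnnihilators.

(** * The associated map and the character formula *)

Section Rescaling.
Variables (n : nat) (K : numFieldType).
Local Notation A := (laurent n K).
Local Notation Zn := {ffun 'I_n -> int}.

(** The substitution [t^m |-> z(m) t^m], an automorphism when [z] is a character
    of [Z^n]. *)
Definition rescale (z : Zn -> K) (a : A) : A :=
  \sum_(m <- msupp a) tmon (z m * (a@_m : K) : K^o) m.

Lemma rescaleE z a m : tcoef m (rescale z a) = z m * (tcoef m a : K).
Proof.
rewrite /rescale raddf_sum [in RHS](monalgE a) [in RHS]raddf_sum mulr_sumr.
apply: eq_bigr => k _ /=; rewrite tmonE [tcoef _ _]mcoeffU.
by case: eqP => [->|_]; rewrite ?mulr0.
Qed.

Lemma rescale_tmon z (c : K) m : rescale z (tmon (c : K^o) m) = tmon (z m * c : K^o) m.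
Proof.
apply: loop_ext => k; rewrite rescaleE !tmonE.
by case: eqP => [->|_]; rewrite ?mulr0.
Qed.

Lemma rescale_linear z : linear (rescale z).
Proof.
move=> c a b; apply: loop_ext => m.
rewrite rescaleE (loopDE (c *: (a : loop n K^o)) b) (loopZE c (a : loop n K^o)) mulrDr.
rewrite (loopDE (c *: (rescale z a : loop n K^o)) (rescale z b)).
rewrite (loopZE c (rescale z a : loop n K^o)) !rescaleE; congr (_ + _).
by rewrite -[LHS]/(z m * (c * tcoef m a)) mulrCA.
Qed.

Lemma rescaleM z : {morph z : m l / m + l >-> m * l} ->
  {morph rescale z : a b / a * b}.
Proof.
move=> zM a b; have rD c d : rescale z (c + d) = rescale z c + rescale z d.
  by have := rescale_linear z 1 c d; rewrite (scale1r c) (scale1r (rescale z c)).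
move: a; apply: loop_eq_add => [c d|c d|c m].
- by rewrite mulrDl rD.
- by rewrite rD mulrDl.
move: b; apply: loop_eq_add => [b d|b d|d l].
- by rewrite mulrDr rD.
- by rewrite rD mulrDr.
by rewrite tmon_mul !rescale_tmon tmon_mul zM mulrACA.
Qed.

Lemma rescaleK z : (forall m, z m != 0) -> cancel (rescale (fun m => (z m)^-1)) (rescale z).
Proof. by move=> z0 a; apply: loop_ext => m; rewrite !rescaleE mulrA divff ?mul1r. Qed.

Lemma lev_rescale f z a : lev f (rescale z a) = lev (fun m => z m * f m) a.
Proof.
apply: (lev_ext (F := fun a => lev f (rescale z a) : K)) a => [c a b|c m].
  by rewrite rescale_linear linearP.
by rewrite rescale_tmon lev_tmon mulrA (mulrC c).
Qed.

End Rescaling.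

Section Assembly.
Variables (R : realType) (g : kac_moody R) (h2 : cartan_complement g) (n : nat).
Variables (r : 'I_n -> nat) (xi : 'I_n -> R[i]) (B : {ffun 'I_n -> R[i]} -> Prop).
Local Notation C := R[i].
Local Notation A := (laurent n C).
Local Notation Zn := {ffun 'I_n -> int}.
Hypothesis xi_prim : forall i, (r i).-primitive_root (xi i).
Hypothesis B_rep : orbit_representatives r xi B.

Lemma exp_polyE d (p : 'I_d -> mpoly.mpoly n C) (lam : 'I_d -> {ffun 'I_n -> C}) m :
  exp_poly p lam m = \sum_j pexp (p j) (lam j) m.
Proof. by []. Qed.

Lemma xi_neq0 i : xi i != 0.
Proof.
have [ri0 xi1] := (prim_order_gt0 (xi_prim i), prim_expr_order (xi_prim i)).
by apply: contra_eqN xi1 => /eqP ->; rewrite expr0n -leqn0 leqNgt ri0 eq_sym oner_eq0.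
Qed.

(** The character of [Z^n] attached to [k]: multiplication by it is the operator
    [T_k] on exp-polynomial functions. *)
Definition zeta (k : Gammabar r) : Zn -> C := exp_fun [ffun j => xi j ^+ k j].

Lemma zeta_vec_neq0 (k : Gammabar r) j : [ffun j => xi j ^+ k j] j != 0.
Proof. by rewrite ffunE expf_neq0 // xi_neq0. Qed.

Lemma zeta_neq0 k m : zeta k m != 0.
Proof.
rewrite /zeta /exp_fun; apply/prodf_neq0 => j _.
by rewrite expfz_neq0 // zeta_vec_neq0.
Qed.

Lemma zetaD k : {morph zeta k : m l / m + l >-> m * l}.
Proof. by move=> m l; apply: exp_fun_shift; apply: zeta_vec_neq0. Qed.

Lemma zeta_pexp k p lam m : zeta k m * pexp p lam m = pexp p (Gamma_act xi k lam) m.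
Proof.
rewrite /pexp mulrCA -big_split; congr (_ * _); apply: eq_bigr => j _ /=.
by rewrite !ffunE expfzMl.
Qed.

Lemma Gamma_act_torus (k : Gammabar r) lam : torus lam -> torus (@Gamma_act R n r xi k lam).
Proof. by move=> l0 j; rewrite ffunE mulf_neq0 // expf_neq0 // xi_neq0. Qed.

(** Points of [B] in the same orbit coincide, and the orbits are free since the
    roots of unity are primitive. *)
Lemma Gamma_act_inj (k l : Gammabar r) lam mu : B lam -> B mu ->
  Gamma_act xi k lam = Gamma_act xi l mu -> k = l.
Proof.
have [Bt Bu] := B_rep => Bl Bm e.
have r0 j : (0 < r j)%N := prim_order_gt0 (xi_prim j).
have lt_mod j a : (a %% r j < r j)%N by rewrite ltn_mod.
have elm : lam = mu.
  have [nu [_ nuP]] := Bu lam (Bt _ Bl); rewrite -(nuP lam); last first.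
    split=> //; exists [ffun j => Ordinal (lt_mod j 0%N)].
    by apply/ffunP => j; rewrite !ffunE /= mod0n mul1r.
  (* [mu] is obtained from [lam] by the action of [k - l] *)
  apply: nuP; split=> //; exists [ffun j => Ordinal (lt_mod j (k j + (r j - l j))%N)].
  apply/ffunP => j; have /ffunP/(_ j) := e; rewrite !ffunE /= => ej.
  have xl0 : xi j ^+ l j != 0 by rewrite expf_neq0 // xi_neq0.
  apply: (mulfI xl0); rewrite -ej (prim_expr_mod (xi_prim j)) mulrA -exprD.
  rewrite addnCA subnKC; last exact: ltnW.
  by rewrite exprD (prim_expr_order (xi_prim j)) mulr1.
apply/ffunP => j; apply: val_inj => /=.
have /ffunP/(_ j) := e; rewrite !ffunE elm => /(mulIf (Bt _ Bm j)) /eqP.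
rewrite (eq_prim_root_expr (xi_prim j)) !modn_small ?ltn_ord // => /eqP //.
Qed.

Lemma card_Gammabar : #|{: Gammabar r}| = (\prod_i r i)%N.
Proof.
rewrite card_dep_ffun foldrE big_map big_enum /=.
by apply: eq_bigr => j _; rewrite card_ord.
Qed.

(** The irreducible module of highest weight [psi] is the tensor product of the
    twists of the one of highest weight [Phi]. *)
Theorem associated_character_power (psi Phi : {linear hA h2 n -> C^o})
    (Vpsi VPhi : lmodType (env (gA h2 n))) :
  associated r xi B psi Phi ->
  irreducible_quotient psi Vpsi ->
  irreducible_quotient Phi VPhi ->
  exists chpsi chPhi,
    [/\ is_character Vpsi chpsi, is_character VPhi chPhi
      & chpsi = char_exp chPhi (\prod_i r i)].
Proof.
move=> [assoc assoc2] irrpsi irrPhi.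
pose Mpsi := irr_quotient_hwmod irrpsi; pose MPhi := irr_quotient_hwmod irrPhi.
have Bt lam : B lam -> torus lam by case: B_rep => Bt _; apply: Bt.
have data i : exists d (p : 'I_d -> mpoly.mpoly n C) (lam : 'I_d -> {ffun 'I_n -> C}),
  [/\ forall j, B (lam j), psi_ Phi (coroot' i) =1 exp_poly p lam
     & psi_ psi (coroot' i) =1 P_R r xi p lam] by apply: assoc.
have fin : exists bs : seq A, forall a, exists c,
    lspan (fun y => y \in bs) c /\ annihilator (phi_of Phi) (a - c).
  apply: (@separable_codim n C 'I_(km_size g) (fun i => psi_ Phi (coroot' i))) => i.
  have [d [p [lam [Bl e _]]]] := data i.
  rewrite (_ : (fun _ _ => _) = fun m l => \sum_j pexp (p j) (lam j) (m + l)); last first.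
    by apply/funext => m; apply/funext => l; rewrite e.
  apply: separable_sum => j; apply: pexp_separable; exact: Bt.
have [bs bsP] := fin.
have dimPhi mu : exists d, hasdim (wt_space (hwD MPhi) mu) d.
  exact (hw_finite (@km_root_free R g) MPhi mu bsP).
pose chPhi mu := projT1 (cid (dimPhi mu)).
have chPhiP mu : hasdim (wt_space (hwD MPhi) mu) (chPhi mu) := projT2 (cid (dimPhi mu)).
exists (char_exp chPhi (\prod_i r i)), chPhi; split=> //.
pose phik (k : Gammabar r) i a := phi_of Phi i (rescale (zeta k) a).
pose M k := twist MPhi (rescale_linear (zeta k)) (rescaleM (zetaD k)) (rescaleK (zeta_neq0 k)).
have phikE k i a : phik k i a = lev (fun m => zeta k m * psi_ Phi (coroot' i) m) a.
  exact: lev_rescale.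
(* the points [k . lam] and [l . mu] differ in some coordinate [u], and then
   [t_u] separates them *)
have co k l : k != l -> comaximal (annihilator (phik k)) (annihilator (phik l)).
  move=> kl.
  pose f k i m : C := zeta k m * psi_ Phi (coroot' i) m.
  have fE k' i : exists d (p : 'I_d -> mpoly.mpoly n C) (lam : 'I_d -> {ffun 'I_n -> C}),
      (forall j, B (lam j)) /\ f k' i = fun m => \sum_j pexp (p j) (Gamma_act xi k' (lam j)) m.
    have [d [p [lam [Bl e _]]]] := data i; exists d, p, lam; split=> //.
    apply/funext => m; rewrite /f e exp_polyE mulr_sumr.
    by apply: eq_bigr => j _; rewrite zeta_pexp.
  have co1 i j : comaximal (Ann (f k i)) (Ann (f l j)).
    have [d [p [lam [Bl ->]]]] := fE k i; have [d' [p' [lam' [Bl' ->]]]] := fE l j.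
    apply: (comaximal_sub (@Ann_sum n C _ _) (@Ann_sum n C _ _)).
    apply: comaximal_all2 => [s|s|s|s|s t];
      [exact: Ann_ideal|exact: Ann0|exact: Ann_ideal|exact: Ann0|].
    have [u ne] : exists u, Gamma_act xi k (lam s) u != Gamma_act xi l (lam' t) u.
      apply: contrapT => all; have := kl; rewrite (@Gamma_act_inj k l (lam s) (lam' t)) ?eqxx //.
      apply/ffunP => u; apply/eqP; apply: contrapT => /negP ne; by apply: all; exists u.
    by apply: Ann_comaximal ne _ _; apply: pexp_nilp; apply: Gamma_act_torus; apply: Bt.
  have annE k' a : (forall i, Ann (f k' i) a) -> annihilator (phik k') a.
    by move=> fa i b; rewrite phikE; apply: fa.
  have co2 := comaximal_all2 (fun i => Ann_ideal (f k i)) (fun i => @Ann0 n C (f k i))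
    (fun j => Ann_ideal (f l j)) (fun j => @Ann0 n C (f l j)) co1.
  exact (comaximal_sub (@annE k) (@annE l) co2).
have phikD k i : {morph phik k i : a b / a + b}.
  by move=> a b; rewrite !phikE; apply: linearD.
have [Ms dimMs] := iterate_tensor (@km_root_free R g) phikD (M := M) (fun k => chPhiP) co
  (enum_uniq (Gammabar r)).
have ephi : (fun i a => \sum_(k <- enum (Gammabar r)) phik k i a) = phi_of psi.
  apply/funext => i; apply/funext => a; rewrite big_enum.
  have [d [p [lam [Bl e e']]]] := data i.
  rewrite /phi_of (_ : psi_ psi (coroot' i) = fun m => \sum_k zeta k m * psi_ Phi (coroot' i) m).
    by rewrite lev_sum; apply: eq_bigr => k _; rewrite phikE.
  apply/funext => m; rewrite e'; apply: eq_bigr => k _.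
  by rewrite e !exp_polyE mulr_sumr; apply: eq_bigr => j _; rewrite zeta_pexp.
have sizeG : size (enum (Gammabar r)) = (\prod_i r i)%N by rewrite -cardE card_Gammabar.
(* on [h''] this is the normalisation of [Phi] by [1 / R]; on [h'] all the [R]
   summands of [P_R] agree at [m = 0] *)
have eLa : La_of Phi *+ size (enum (Gammabar r)) = La_of psi.
  rewrite sizeG; apply/lfunP => d.
  rewrite -scaler_nat scale_lfunE !La_ofE.
  have [y [z [hy hz ->]]] := hsecond_sum h2 d.
  have eD (chi : {linear hA h2 n -> C^o}) :
      chi (hA_d h2 n (y + z)) = (psi_ chi (Sub_ hy) 0 : C) + (chi (hA_second n hz) : C).
    rewrite /psi_ -[RHS](linearD chi); congr (chi _); apply: val_inj => /=.
    by rewrite linearD; apply: raddfD.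
  rewrite !eD assoc2 scalerDr; congr (_ + _).
    have [d' [p [lam [Bl e e']]]] := assoc (Sub_ hy).
    have exp0 mu : exp_fun mu (0 : Zn) = 1 :> C.
      by rewrite /exp_fun big1 // => j _; rewrite ffunE expr0z.
    have expp0 mu : exp_poly p mu 0 = \sum_j mpoly.meval (fun i => ((0 : Zn) i)%:~R) (p j) :> C.
      by apply: eq_bigr => j _; rewrite exp0 mulr1.
    rewrite e e' /P_R expp0; under [RHS]eq_bigr do rewrite expp0.
    by rewrite big_const iter_addr addr0 card_Gammabar scaler_nat.
  rewrite -[LHS]/((\prod_i r i)%:R * ((\prod_i r i)%:R^-1 * (psi (hA_second n hz) : C))).
  rewrite mulVKf // pnatr_eq0 -lt0n prodn_gt0 // => j.
  exact: prim_order_gt0 (xi_prim j).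
move: Ms dimMs; rewrite ephi eLa sizeG => Ms dimMs mu.
have dimpsi := @hwmod_unique _ _ _ _ _ _ _ _ Ms Mpsi mu _ (dimMs mu).
exact ((has_dimE irrpsi mu _).2 dimpsi).
Qed.
End Assembly.

Theorem proposition5p1 (R : realType) (g : kac_moody R)
    (h2 : cartan_complement g) (n : nat) (r : 'I_n -> nat) (xi : 'I_n -> R[i])
    (B : {ffun 'I_n -> R[i]} -> Prop)
    (psi Phi : {linear hA h2 n -> R[i]^o})
    (Vpsi VPhi : lmodType (env (gA h2 n))) :
  (forall i, (r i).-primitive_root (xi i)) ->
  orbit_representatives r xi B ->
  (2 <= \prod_i r i)%N ->
  (forall x, exp_polynomial (psi_ psi x)) ->
  (forall a, A_psi psi a <-> laurent_pow r a) ->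
  associated r xi B psi Phi ->
  irreducible_quotient psi Vpsi ->
  irreducible_quotient Phi VPhi ->
  exists chpsi chPhi,
    [/\ is_character Vpsi chpsi, is_character VPhi chPhi
      & chpsi = char_exp chPhi (\prod_i r i)].
Proof.
move=> xi_prim B_rep _ _ _; exact: associated_character_power xi_prim B_rep _ _ _ _.
Qed.
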